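(* Consider the two-sample setting described in the context, under the null hypothesis that $X^{(0)}$ and $X^{(1)}$ have the same distribution, and let $n_1\to\infty$ with $n_1/n\to 0$, where $n=n_0+n_1$. (1) If $\xi_{0,1}>0$, then $n_1^{1/2}T\xrightarrow{d}N(0,m_1^2\xi_{0,1})$. (2) Suppose $\xi_{0,1}=0$ and $\xi_{0,2}>0$, and at least one of the following holds: (a) $\xi_{1,0}=0$; (b) $n_1^2/n_0\to 0$. Then $$n_1T\xrightarrow{d}\frac{m_1(m_1-1)}{2}\,\eta,\qquad \eta=\sum_{j=1}^\infty\lambda_j(\chi^2_{1j}-1),$$ where the $\chi^2_{1j}$ are independent $\chi^2_1$ random variables and the $\lambda_j$ are the eigenvalues of the integral operator $Ag(x)=\int h_{0,2}(x,y)g(y)\,dF(y)$, with $F$ the distribution of $X^{(1)}$.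
   Context: Observations $X_1^{(0)},\dots,X_{n_0}^{(0)}$ (controls, class $Y=0$) are i.i.d. in $\mathbb{R}^p$, and $X_1^{(1)},\dots,X_{n_1}^{(1)}$ (cases, class $Y=1$) are i.i.d. in $\mathbb{R}^p$; the two samples are independent. Fix integers $m_0,m_1\ge1$. Let $h:(\mathbb{R}^p)^{m_0}\times(\mathbb{R}^p)^{m_1}\to\mathbb{R}$ be a measurable kernel that is symmetric in its first $m_0$ arguments and symmetric in its last $m_1$ arguments, with $\mathrm{E}\,h(X_1^{(0)},\dots,X_{m_0}^{(0)};X_1^{(1)},\dots,X_{m_1}^{(1)})=0$ and finite second moment. Define $$T=\binom{n_0}{m_0}^{-1}\binom{n_1}{m_1}^{-1}\sum h\big(X_{i_1}^{(0)},\dots,X_{i_{m_0}}^{(0)};X_{j_1}^{(1)},\dots,X_{j_{m_1}}^{(1)}\big),$$ the sum running over all $1\le i_1<\dots<i_{m_0}\le n_0$ and all $1\le j_1<\dots<j_{m_1}\le n_1$. For $0\le a\le m_0$, $0\le b\le m_1$ define the projection $$h_{a,b}(x_1,\dots,x_a;y_1,\dots,y_b)=\mathrm{E}\{h(X_1^{(0)},\dots,X_{m_0}^{(0)};X_1^{(1)},\dots,X_{m_1}^{(1)})\mid X_1^{(0)}=x_1,\dots,X_a^{(0)}=x_a,X_1^{(1)}=y_1,\dots,X_b^{(1)}=y_b\},$$ and $\xi_{a,b}=\operatorname{Var}\{h_{a,b}(X_1^{(0)},\dots,X_a^{(0)};X_1^{(1)},\dots,X_b^{(1)})\}$. *)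

(* Defs.v *)
From HB Require Import structures.
From mathcomp Require Import all_boot all_order all_algebra.
From mathcomp Require Import all_classical all_reals all_analysis.
Set Implicit Arguments. Unset Strict Implicit. Unset Printing Implicit Defensive.
Import Order.TTheory GRing.Theory Num.Theory.
Import numFieldNormedType.Exports.
Local Open Scope classical_set_scope.
Local Open Scope ring_scope.

Definition mutually_independent {d dS} {Omega : measurableType d}
    {S : measurableType dS} {R : realType} {I : eqType}
    (P : probability Omega R) (X : I -> Omega -> S) : Prop :=
  forall (J : seq I) (A : I -> set S), uniq J ->
    (forall i, i \in J -> measurable (A i)) ->
    P (\big[setI/setT]_(i <- J) (X i @^-1` A i)) =
    (\prod_(i <- J) P (X i @^-1` A i))%E.

Definition cvg_in_dist {d d'} {Omega : measurableType d}
    {Omega' : measurableType d'} {R : realType}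
    (P : probability Omega R) (Y : nat -> Omega -> R)
    (P' : probability Omega' R) (Z : Omega' -> R) : Prop :=
  forall f : R -> R, continuous f -> (exists M : R, forall x, `|f x| <= M) ->
    (fun k => fine (\int[P]_w (f (Y k w))%:E)%E) @ \oo -->
      fine (\int[P']_w (f (Z w))%:E)%E.

Section Ustat.
Variables (d : measure_display) (Omega : measurableType d) (R : realType)
  (p m0 m1 : nat).
Local Notation S := (p.-tuple R).
Variables (P : probability Omega R)
  (X : bool * nat -> Omega -> S)  (* X (false, i) = X_{i+1}^{(0)}, X (true, j) = X_{j+1}^{(1)} *)
  (h : m0.-tuple S -> m1.-tuple S -> R).

Definition Ustat (n0 n1 : nat) (w : Omega) : R :=
  ('C(n0, m0)%:R)^-1 * ('C(n1, m1)%:R)^-1 *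
  \sum_(s : m0.-tuple 'I_n0 | sorted (fun a b : 'I_n0 => (a < b)%N) s)
   \sum_(t : m1.-tuple 'I_n1 | sorted (fun a b : 'I_n1 => (a < b)%N) t)
     h [tuple X (false, nat_of_ord (tnth s i)) w | i < m0]
       [tuple X (true, nat_of_ord (tnth t j)) w | j < m1].

Definition hfill (a b : nat) (x y : nat -> S) (w : Omega) : R :=
  h [tuple if (i < a)%N then x (nat_of_ord i) else X (false, nat_of_ord i) w | i < m0]
    [tuple if (j < b)%N then y (nat_of_ord j) else X (true, nat_of_ord j) w | j < m1].

(** Projection h_{a,b}(x_1..x_a; y_1..y_b)
    = E h(x_1,..,x_a, X_{a+1}^{(0)},..; y_1,..,y_b, X_{b+1}^{(1)},..),
    a version of the conditional expectation in the paper (by independence). *)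
Definition hproj (a b : nat) (x y : nat -> S) : R :=
  fine ('E_P[hfill a b x y]).

Definition xi (a b : nat) : \bar R :=
  'V_P[fun w => hproj a b (fun i => X (false, i) w) (fun j => X (true, j) w)].

End Ustat.

(** [lam] lists the (nonzero) eigenvalues, repeated according to multiplicity
    (padded with zeros), of the integral operator
    A g (x) = \int k(x,y) g(y) dF(y) on L^2(F):
    there are F-orthonormal square-integrable eigenfunctions phi_j for the
    nonzero lam_j, and for each nonzero mu, the phi_j with lam_j = mu span the
    mu-eigenspace (no nonzero L^2(F) eigenfunction of mu is orthogonal to
    all of them). *)
Definition eigenvalue_seq {dS} {S : measurableType dS} {R : realType}
    (F : probability S R) (k : S -> S -> R) (lam : nat -> R) : Prop :=
  exists phi : nat -> S -> R,
    (forall j, lam j != 0 -> measurable_fun setT (phi j) /\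
        F.-integrable setT (fun x => (phi j x ^+ 2)%:E)) /\
    (forall i j, lam i != 0 -> lam j != 0 ->
        (\int[F]_x (phi i x * phi j x)%:E = (if i == j then 1 else 0)%:E)%E) /\
    (forall j, lam j != 0 ->
        {ae F, forall x, (\int[F]_y (k x y * phi j y)%:E = (lam j * phi j x)%:E)%E}) /\
    (forall (mu : R) (g : S -> R), mu != 0 ->
        measurable_fun setT g -> F.-integrable setT (fun x => (g x ^+ 2)%:E) ->
        {ae F, forall x, (\int[F]_y (k x y * g y)%:E = (mu * g x)%:E)%E} ->
        (forall j, lam j = mu -> (\int[F]_x (g x * phi j x)%:E = 0)%E) ->
        {ae F, forall x, g x = 0}).

(* Main.v *)
Require Import Defs.
From HB Require Import structures.
From mathcomp Require Import all_boot all_order all_algebra.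
From mathcomp Require Import perm.
From mathcomp Require Import all_classical all_reals all_analysis.
From mathcomp Require Import measurable_realfun ring lra.
Import Order.TTheory GRing.Theory Num.Theory.
Import numFieldNormedType.Exports.
Local Open Scope classical_set_scope.
Local Open Scope ring_scope.
Set Implicit Arguments.
Unset Strict Implicit.

(** Part (1) is Hajek projection: subtracting from [h] the sum of its first-order
projections [h_{0,1}] leaves a U-statistic whose variance is
[O(1/n0 + 1/n1^2) = o(1/n1)], so [sqrt n1 T] is asymptotically a normalized sum
of i.i.d. variables.  In part (2) [h_{0,1}] vanishes almost surely and the same
variance estimate, with condition (a) or (b) taking care of the order [1/n0]
terms, reduces [n1 T] to [m1 (m1 - 1) / 2] times the degenerate U-statistic of
order two with kernel [h_{0,2}].  The eigenfunction expansion of [h_{0,2}]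
converges in L2 (a symmetric L2 kernel which is nonzero after removal of the
listed eigenfunctions still has an eigenfunction for a nonzero eigenvalue, obtained
as a limit of normalized iterates of the kernel), and truncating it leaves finitely
many squares of normalized sums, to which the law of large numbers (for the
diagonal) and the central limit theorem apply.

The central limit theorem is proved by Lindeberg replacement, the steps being
exchanges of commuting averaging operators.  To avoid multivariate Taylor
expansions, test functions are compositions of a smooth function of one variable
with a sum [\sum_i theta_i (s_i)] of smooth functions of the coordinates with
bounded derivatives; [s ^+ 2] is replaced by [(1 - cos (e * s)) * 2 / e ^+ 2] with
[e] small. *)

(** * Expectations of real functions *)

Definition Ex {d} {T : measurableType d} {R : realType} (P : probability T R)
  (f : T -> R) : R := \int[P]_x f x.

Definition L1 {d} {T : measurableType d} {R : realType} (P : probability T R)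
  (f : T -> R) : Prop := P.-integrable setT (fun x => (f x)%:E).

Definition L2 {d} {T : measurableType d} {R : realType} (P : probability T R)
  (f : T -> R) : Prop :=
  measurable_fun setT f /\ L1 P (fun x => f x ^+ 2).

Section real_expectation.
Context {d : measure_display} {T : measurableType d} {R : realType}
  (P : probability T R).
Implicit Types (f g : T -> R).

Lemma eq_Ex f g : f =1 g -> Ex P f = Ex P g.
Proof. by move=> /funext ->. Qed.

Lemma eq_L1 f g : f =1 g -> L1 P f -> L1 P g.
Proof. by move=> /funext ->. Qed.

Lemma L1_measurable f : L1 P f -> measurable_fun setT f.
Proof. by move=> /measurable_int /measurable_EFinP. Qed.

Lemma L1_int f : L1 P f -> (\int[P]_x (f x)%:E = (Ex P f)%:E)%E.
Proof. by move=> Lf; rewrite fineK//; exact: integrable_fin_num. Qed.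

Lemma L1_dom f g : measurable_fun setT f -> (forall x, `|f x| <= g x) ->
  L1 P g -> L1 P f.
Proof.
move=> mf fg; apply: le_integrable => //; first exact/measurable_EFinP.
by move=> x _ /=; rewrite lee_fin (le_trans (fg x))// ler_norm.
Qed.

Lemma L1_dom_ae f g : measurable_fun setT f -> {ae P, forall x, `|f x| <= g x} ->
  L1 P g -> L1 P f.
Proof.
move=> mf fg Lg; have mg := L1_measurable Lg.
apply/integrableP; split; first exact/measurable_EFinP.
have /integrableP[_] := Lg; apply: le_lt_trans; apply: ae_ge0_le_integral => //.
- by apply: measurableT_comp => //; exact/measurable_EFinP.
- by apply: measurableT_comp => //; exact/measurable_EFinP.
- by apply: filterS fg => x fgx _; rewrite lee_fin (le_trans fgx)// ler_norm.
Qed.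

Lemma L1_cst (c : R) : L1 P (fun=> c).
Proof. exact: finite_measure_integrable_cst. Qed.

Lemma L1_bnd f (M : R) : measurable_fun setT f -> (forall x, `|f x| <= M) -> L1 P f.
Proof. by move=> mf fM; apply: (L1_dom (g := fun=> M)) => //; exact: L1_cst. Qed.

Lemma L1D f g : L1 P f -> L1 P g -> L1 P (fun x => f x + g x).
Proof. by move=> Lf Lg; exact: eq_integrable (integrableD measurableT Lf Lg). Qed.

Lemma L1B f g : L1 P f -> L1 P g -> L1 P (fun x => f x - g x).
Proof. by move=> Lf Lg; exact: eq_integrable (integrableB measurableT Lf Lg). Qed.

Lemma L1Z f (c : R) : L1 P f -> L1 P (fun x => c * f x).
Proof. by move=> Lf; exact: eq_integrable (integrableZl measurableT c Lf). Qed.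

Lemma L1_norm f : L1 P f -> L1 P (fun x => `|f x|).
Proof. by move=> Lf; exact: eq_integrable (integrable_abse Lf). Qed.

Lemma L1_sum (I : Type) (s : seq I) (Q : pred I) (F : I -> T -> R) :
  (forall i, Q i -> L1 P (F i)) -> L1 P (fun x => \sum_(i <- s | Q i) F i x).
Proof.
move=> LF; elim: s => [|i s IH].
  by apply: (@eq_L1 (fun=> 0)) (L1_cst 0) => x; rewrite big_nil.
apply: (@eq_L1 (fun x => (if Q i then F i x else 0) +
    \sum_(i <- s | Q i) F i x)) => [x|].
  by rewrite big_cons; case: (Q i); rewrite ?add0r.
by apply: L1D => //; case Qi: (Q i); [exact: LF|exact: L1_cst].
Qed.

Lemma ExD f g : L1 P f -> L1 P g -> Ex P (fun x => f x + g x) = Ex P f + Ex P g.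
Proof. by move=> Lf Lg; exact: RintegralD. Qed.

Lemma ExB f g : L1 P f -> L1 P g -> Ex P (fun x => f x - g x) = Ex P f - Ex P g.
Proof. by move=> Lf Lg; exact: RintegralB. Qed.

Lemma ExZ f (c : R) : L1 P f -> Ex P (fun x => c * f x) = c * Ex P f.
Proof. by move=> Lf; exact: RintegralZl. Qed.

Lemma Ex_cst (c : R) : Ex P (fun=> c) = c.
Proof.
rewrite /Ex Rintegral_cst// -[RHS]mulr1; congr (_ * _).
exact: (congr1 fine (probability_setT P)).
Qed.

Lemma Ex_sum (I : Type) (s : seq I) (Q : pred I) (F : I -> T -> R) :
  (forall i, Q i -> L1 P (F i)) ->
  Ex P (fun x => \sum_(i <- s | Q i) F i x) = \sum_(i <- s | Q i) Ex P (F i).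
Proof.
move=> LF; elim: s => [|i s IH].
  by rewrite big_nil -[RHS](Ex_cst 0); apply: eq_Ex => x; rewrite big_nil.
rewrite big_cons -IH; case Qi: (Q i); last first.
  by apply: eq_Ex => x; rewrite big_cons Qi.
rewrite -ExD; [by apply: eq_Ex => x; rewrite big_cons Qi|exact: LF|exact: L1_sum].
Qed.

Lemma Ex_ge0 f : (forall x, 0 <= f x) -> 0 <= Ex P f.
Proof. by move=> f0; exact: Rintegral_ge0. Qed.

Lemma le_Ex f g : L1 P f -> L1 P g -> (forall x, f x <= g x) -> Ex P f <= Ex P g.
Proof. by move=> Lf Lg fg; apply: le_Rintegral. Qed.

Lemma ae_eq_Ex f g : measurable_fun setT f -> measurable_fun setT g ->
  {ae P, forall x, f x = g x} -> Ex P f = Ex P g.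
Proof.
move=> mf mg fg; congr fine; apply: ae_eq_integral => //.
- exact/measurable_EFinP.
- exact/measurable_EFinP.
- by apply: filterS fg => x /= -> .
Qed.

Lemma ae_eq0_Ex f : measurable_fun setT f -> {ae P, forall x, f x = 0} -> Ex P f = 0.
Proof. by move=> mf f0; rewrite (ae_eq_Ex mf _ f0) ?Ex_cst. Qed.

Lemma le_Ex_ae f g : L1 P f -> L1 P g -> {ae P, forall x, f x <= g x} -> Ex P f <= Ex P g.
Proof.
move=> Lf Lg fg; have mf := L1_measurable Lf; have mg := L1_measurable Lg.
rewrite (@ae_eq_Ex f (fun x => Num.min (f x) (g x)))//.
- apply: le_Ex => //; last by move=> x; rewrite ge_min lexx orbT.
  apply: (L1_dom (g := fun x => `|f x| + `|g x|)); first exact: measurable_minr.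
    by move=> x; rewrite minEle; case: ifP => _; rewrite ?lerDl ?lerDr.
  by apply: L1D; exact: L1_norm.
- exact: measurable_minr.
- by apply: filterS fg => x fgx; rewrite minEle fgx.
Qed.

Lemma normr_Ex f : L1 P f -> `|Ex P f| <= Ex P (fun x => `|f x|).
Proof. by move=> Lf; exact: le_normr_Rintegral. Qed.

Lemma normr_Ex_le f (M : R) : L1 P f -> (forall x, `|f x| <= M) -> `|Ex P f| <= M.
Proof.
move=> Lf fM; apply: le_trans (normr_Ex Lf) _.
by rewrite -[leRHS]Ex_cst; apply: le_Ex => //; [exact: L1_norm|exact: L1_cst].
Qed.

Lemma Ex_dist_le f g (D : R) : L1 P f -> L1 P g -> (forall x, `|f x - g x| <= D) ->
  `|Ex P f - Ex P g| <= D.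
Proof. by move=> Lf Lg fgD; rewrite -ExB//; apply: normr_Ex_le => //; exact: L1B. Qed.

Lemma Ex0_ae f : L1 P f -> (forall x, 0 <= f x) -> Ex P f = 0 ->
  {ae P, forall x, f x = 0}.
Proof.
move=> Lf f0 Ef.
have : (\int[P]_x `|(f x)%:E| = 0)%E.
  by rewrite -[RHS]/((0 : R)%:E) -Ef -L1_int//; apply: eq_integral => x _ /=;
     rewrite ger0_norm.
move/ae_eq_integral_abs => /(_ measurableT (measurable_int P Lf)).
by apply: filterS => x /(_ I) [].
Qed.

Lemma Ex_not_L1 f : measurable_fun setT f -> ~ L1 P f -> Ex P f = 0.
Proof.
move=> mf nL; have mE : measurable_fun setT (fun x => (f x)%:E) by exact/measurable_EFinP.
rewrite /Ex /Rintegral integralE.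
have : (\int[P]_x `|(f x)%:E| = +oo)%E.
  apply/eqP; apply: contra_notT nL; rewrite -ltey => fin.
  by apply/integrableP; split.
have -> : (\int[P]_x `|(f x)%:E| = \int[P]_x ((fun y => (f y)%:E)^\+ x + (fun y => (f y)%:E)^\- x))%E.
  by apply: eq_integral => x _; rewrite -[LHS]/((abse \o (fun y => (f y)%:E)) x) fune_abse.
rewrite ge0_integralD//; [|exact: measurable_funepos|exact: measurable_funeneg].
have : (0 <= \int[P]_x (fun y => (f y)%:E)^\+ x)%E by apply: integral_ge0.
have : (0 <= \int[P]_x (fun y => (f y)%:E)^\- x)%E by apply: integral_ge0.
by case: (\int[P]_x _)%E => [a| |] //; case: (\int[P]_x _)%E => [b| |].
Qed.

(* Holds without integrability because [Ex] is then the junk value [0] on both sides. *)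
Lemma Ex_scale f (c : R) : measurable_fun setT f ->
  Ex P (fun x => c * f x) = c * Ex P f.
Proof.
move=> mf; have [Lf|nLf] := pselect (L1 P f); first exact: ExZ.
have [->|c0] := eqVneq c 0.
  by rewrite mul0r -[RHS](Ex_cst 0); apply: eq_Ex => x; rewrite mul0r.
rewrite (Ex_not_L1 mf nLf) mulr0 Ex_not_L1//; first exact: measurable_funM.
move=> Lcf; apply: nLf; apply: eq_L1 (L1Z c^-1 Lcf) => x.
by rewrite mulrA mulVf// mul1r.
Qed.

Lemma Ex_dct (f_ : nat -> T -> R) f g :
  (forall n, measurable_fun setT (f_ n)) -> measurable_fun setT f ->
  L1 P g -> (forall n x, `|f_ n x| <= g x) ->
  {ae P, forall x, f_ n x @[n --> \oo] --> f x} ->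
  Ex P (f_ n) @[n --> \oo] --> Ex P f.
Proof.
move=> mf_ mf Lg fg f_f.
have mE (u : T -> R) : measurable_fun setT u -> measurable_fun setT (fun x => (u x)%:E).
  by move=> mu; exact/measurable_EFinP.
have fE : {ae P, forall x, setT x -> (f_ n x)%:E @[n --> \oo] --> (f x)%:E}.
  by apply: filterS f_f => x fx _; apply: cvg_EFin => //; exact: nearW.
have gE : {ae P, forall x n, setT x -> (`|(f_ n x)%:E| <= (g x)%:E)%E}.
  by apply: aeW => x n _; rewrite lee_fin.
have [Lf _] := dominated_convergence measurableT (fun n => mE _ (mf_ n)) (mE _ mf) fE Lg gE.
by rewrite (L1_int Lf) => /fine_cvgP[].
Qed.

Lemma L1_fatou (f_ : nat -> T -> R) f (M : R) :
  (forall n, L1 P (f_ n)) -> (forall n x, 0 <= f_ n x) -> measurable_fun setT f ->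
  {ae P, forall x, f_ n x @[n --> \oo] --> f x} -> (\forall n \near \oo, Ex P (f_ n) <= M) ->
  L1 P f /\ Ex P f <= M.
Proof.
move=> Lf_ f_ge0 mf f_f EM.
have mE_ n := (measurable_EFinP setT (f_ n)).2 (L1_measurable (Lf_ n)).
have absE : {ae P, forall x, setT x -> `|(f x)%:E|%E = limn_einf (fun n => (f_ n x)%:E)}.
  apply: filterS f_f => x f_fx _.
  have f0 : 0 <= f x.
    by rewrite -(cvg_lim _ f_fx)//; apply: limr_ge; [exact: cvgP f_fx|exact: nearW].
  have f_fxE : (f_ n x)%:E @[n --> \oo] --> (f x)%:E by apply: cvg_EFin f_fx; exact: nearW.
  by rewrite (cvg_limn_einf_sup f_fxE).1 gee0_abs.
have int_le : (\int[P]_x `|(f x)%:E| <= M%:E)%E.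
  rewrite (ae_eq_integral _ _ measurableT _ _ absE)//.
  - apply: le_trans (fatou P measurableT mE_ (fun n x _ => f_ge0 n x)) _.
    rewrite limn_einf_lim; apply: lime_le; first exact: is_cvg_einfs.
    apply: filterS EM => n EnM.
    apply: (@le_trans _ _ (\int[P]_x (f_ n x)%:E)%E); last by rewrite L1_int ?lee_fin.
    by apply: ereal_inf_lbound; exists n => /=.
  - by apply: measurableT_comp => //; exact/measurable_EFinP.
  - apply: (emeasurable_fun_cvg (fun n x => einfs (fun k => (f_ k x)%:E) n)).
      by move=> n; exact: measurable_fun_einfs.
    by move=> x _; rewrite limn_einf_lim; exact: is_cvg_einfs.
have Lf : L1 P f.
  apply/integrableP; split; first exact/measurable_EFinP.
  by apply: le_lt_trans int_le _; exact: ltry.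
split=> //; apply: le_trans (ler_norm _) _; apply: le_trans (normr_Ex Lf) _.
by rewrite -lee_fin -L1_int//; exact: L1_norm.
Qed.

Lemma L2_measurable f : L2 P f -> measurable_fun setT f.
Proof. by case. Qed.

Lemma eq_L2 f g : f =1 g -> L2 P f -> L2 P g.
Proof. by move=> /funext ->. Qed.

Lemma L2M f g : L2 P f -> L2 P g -> L1 P (fun x => f x * g x).
Proof.
move=> [mf Lf] [mg Lg]; apply: (L1_dom (g := fun x => f x ^+ 2 + g x ^+ 2)).
- exact: measurable_funM.
- move=> x; rewrite normrM -(real_normK (num_real (f x))).
  rewrite -(real_normK (num_real (g x))).
  have := sqr_ge0 (`|f x| - `|g x|); have := normr_ge0 (f x).
  have := normr_ge0 (g x); nra.
- exact: L1D.
Qed.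

Lemma L2_cst (c : R) : L2 P (fun=> c).
Proof. by split => //; exact: L1_cst. Qed.

Lemma L2_L1 f : L2 P f -> L1 P f.
Proof.
by move=> Lf; apply: eq_L1 (L2M Lf (L2_cst 1)) => x; rewrite mulr1.
Qed.

Lemma L2_bnd f (M : R) : measurable_fun setT f -> (forall x, `|f x| <= M) -> L2 P f.
Proof.
move=> mf fM; split => //; apply: (L1_bnd (M := M ^+ 2)).
  exact: measurable_funX.
move=> x; rewrite normrX lerXn2r ?nnegrE//.
exact: le_trans (normr_ge0 _) (fM x).
Qed.

Lemma L2D f g : L2 P f -> L2 P g -> L2 P (fun x => f x + g x).
Proof.
move=> Lf Lg; split; first by apply: measurable_funD; [case: Lf|case: Lg].
apply: (@eq_L1 (fun x => f x ^+ 2 + (2 * (f x * g x) + g x ^+ 2))).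
  by move=> x; ring.
by apply: L1D; [case: Lf|apply: L1D; [exact/L1Z/L2M|case: Lg]].
Qed.

Lemma L2Z f (c : R) : L2 P f -> L2 P (fun x => c * f x).
Proof.
move=> Lf; split; first by apply: measurable_funM => //; case: Lf.
apply: (@eq_L1 (fun x => c ^+ 2 * f x ^+ 2)); first by move=> x; ring.
by apply: L1Z; case: Lf.
Qed.

Lemma L2B f g : L2 P f -> L2 P g -> L2 P (fun x => f x - g x).
Proof.
move=> Lf Lg; apply: (@eq_L2 (fun x => f x + -1 * g x)).
  by move=> x; ring.
exact/L2D/L2Z.
Qed.

Lemma L2_sum (I : Type) (s : seq I) (Q : pred I) (F : I -> T -> R) :
  (forall i, Q i -> L2 P (F i)) -> L2 P (fun x => \sum_(i <- s | Q i) F i x).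
Proof.
move=> LF; elim: s => [|i s IH].
  by apply: (@eq_L2 (fun=> 0)) (L2_cst 0) => x; rewrite big_nil.
apply: (@eq_L2 (fun x => (if Q i then F i x else 0) +
    \sum_(i <- s | Q i) F i x)) => [x|].
  by rewrite big_cons; case: (Q i); rewrite ?add0r.
by apply: L2D => //; case Qi: (Q i); [exact: LF|exact: L2_cst].
Qed.

Lemma L2_norm f : L2 P f -> L2 P (fun x => `|f x|).
Proof.
move=> [mf Lf]; split; first exact: measurableT_comp.
by apply: eq_L1 Lf => x; rewrite real_normK ?num_real.
Qed.

Lemma Ex_sqr_ge0 f : 0 <= Ex P (fun x => f x ^+ 2).
Proof. by apply: Ex_ge0 => x; exact: sqr_ge0. Qed.

Lemma Ex_sqrZ f (c : R) : L2 P f ->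
  Ex P (fun x => (c * f x) ^+ 2) = c ^+ 2 * Ex P (fun x => f x ^+ 2).
Proof. by move=> [_ Lf]; rewrite -ExZ//; apply: eq_Ex => x; rewrite exprMn. Qed.

Lemma Ex_sqrD f g : L2 P f -> L2 P g -> Ex P (fun x => (f x + g x) ^+ 2) =
  Ex P (fun x => f x ^+ 2) + 2 * Ex P (fun x => f x * g x) + Ex P (fun x => g x ^+ 2).
Proof.
move=> Lf Lg; have Lfg := L2M Lf Lg.
rewrite -(ExZ 2 Lfg) -(ExD Lf.2 (L1Z 2 Lfg)) -(ExD (L1D Lf.2 (L1Z 2 Lfg)) Lg.2).
by apply: eq_Ex => x; ring.
Qed.

Lemma Ex_sqrB f g : L2 P f -> L2 P g -> Ex P (fun x => (f x - g x) ^+ 2) =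
  Ex P (fun x => f x ^+ 2) - 2 * Ex P (fun x => f x * g x) + Ex P (fun x => g x ^+ 2).
Proof.
move=> Lf Lg; have Lfg := L2M Lf Lg.
rewrite -(ExZ 2 Lfg) -(ExB Lf.2 (L1Z 2 Lfg)) -(ExD (L1B Lf.2 (L1Z 2 Lfg)) Lg.2).
by apply: eq_Ex => x; ring.
Qed.

Lemma Ex_sqrD_le f g : L2 P f -> L2 P g ->
  Ex P (fun x => (f x + g x) ^+ 2) <=
  2 * Ex P (fun x => f x ^+ 2) + 2 * Ex P (fun x => g x ^+ 2).
Proof.
move=> Lf Lg; rewrite Ex_sqrD//.
have := Ex_sqr_ge0 (fun x => f x - g x); rewrite Ex_sqrB//; lra.
Qed.

Lemma Ex_sqr_sum (I : Type) (s : seq I) (Q : pred I) (F : I -> T -> R) :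
  (forall i, Q i -> L2 P (F i)) ->
  Ex P (fun x => (\sum_(i <- s | Q i) F i x) ^+ 2) =
  \sum_(i <- s | Q i) \sum_(j <- s | Q j) Ex P (fun x => F i x * F j x).
Proof.
move=> LF; under eq_Ex do rewrite expr2 big_distrlr.
rewrite Ex_sum => [|i Qi]; last by apply: L1_sum => j Qj; exact: L2M (LF _ Qi) (LF _ Qj).
by apply: eq_bigr => i Qi; rewrite Ex_sum// => j Qj; exact: L2M (LF _ Qi) (LF _ Qj).
Qed.

Lemma Ex_cauchy_schwarz f g : L2 P f -> L2 P g ->
  Ex P (fun x => f x * g x) ^+ 2 <=
  Ex P (fun x => f x ^+ 2) * Ex P (fun x => g x ^+ 2).
Proof.
move=> Lf Lg; set a := Ex P _; set b := Ex P _; set c := Ex P _.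
pose p : {poly R} := Poly [:: c; 2 * a; b].
have p_ge0 t : 0 <= p.[t].
  rewrite horner_Poly /= mul0r add0r.
  have -> : (b * t + 2 * a) * t + c = Ex P (fun x => (t * f x + g x) ^+ 2).
    rewrite Ex_sqrD//; last exact: L2Z.
    rewrite Ex_sqrZ// -/b -/c (_ : Ex P (fun x => t * f x * g x) = t * a); first by ring.
    by rewrite -ExZ; [apply: eq_Ex => x; rewrite mulrA|exact: L2M].
  exact: Ex_sqr_ge0.
by have := deg_le2_poly_ge0 (size_Poly [:: c; 2 * a; b]) p_ge0; rewrite !coef_Poly /=; lra.
Qed.

Lemma sqr_Ex_norm_le f : L2 P f ->
  Ex P (fun x => `|f x|) ^+ 2 <= Ex P (fun x => f x ^+ 2).
Proof.
move=> Lf; have := Ex_cauchy_schwarz (L2_norm Lf) (L2_cst 1).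
under eq_Ex do rewrite mulr1.
under [X in _ <= X * _]eq_Ex do rewrite real_normK ?num_real//.
by under [X in _ <= _ * X]eq_Ex do rewrite expr1n; rewrite Ex_cst mulr1.
Qed.

Lemma Ex_norm_le_sqrt f (e : R) : L2 P f -> 0 <= e ->
  Ex P (fun x => f x ^+ 2) <= e ^+ 2 -> Ex P (fun x => `|f x|) <= e.
Proof.
move=> Lf e0 fe; rewrite -(ler_pXn2r (n := 2))// ?nnegrE//.
  exact: le_trans (sqr_Ex_norm_le Lf) fe.
exact: Ex_ge0.
Qed.

Lemma Ex_sqr_eq0_ae f : L2 P f -> Ex P (fun x => f x ^+ 2) = 0 -> {ae P, forall x, f x = 0}.
Proof.
move=> [_ Lf] /(Ex0_ae Lf (fun x => sqr_ge0 _)); apply: filterS => x /eqP.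
by rewrite sqrf_eq0 => /eqP.
Qed.

Lemma ae_eq_Ex_sqr f g : measurable_fun setT f -> measurable_fun setT g ->
  {ae P, forall x, f x = g x} -> Ex P (fun x => f x ^+ 2) = Ex P (fun x => g x ^+ 2).
Proof.
by move=> mf mg fg; apply: ae_eq_Ex; [exact: measurable_funX..|apply: filterS fg => x ->].
Qed.

Lemma Ex_sqrB_eq0_ae f g : L2 P f -> L2 P g -> Ex P (fun x => (f x - g x) ^+ 2) = 0 ->
  {ae P, forall x, f x = g x}.
Proof.
move=> Lf Lg /(Ex_sqr_eq0_ae (L2B Lf Lg)); apply: filterS => x /eqP.
by rewrite subr_eq0 => /eqP.
Qed.

End real_expectation.

Section real_fubini.
Context {d d' : measure_display} {T : measurableType d} {T' : measurableType d'}
  {R : realType} (P : probability T R) (Q : probability T' R).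
Implicit Types (f : T * T' -> R).

Lemma measurable_slice1 f x : measurable_fun setT f ->
  measurable_fun setT (fun y => f (x, y)).
Proof. by move=> mf; exact: measurableT_comp. Qed.

Lemma measurable_slice2 f y : measurable_fun setT f ->
  measurable_fun setT (fun x => f (x, y)).
Proof. by move=> mf; exact: measurableT_comp. Qed.

Lemma measurable_Ex_slice f : measurable_fun setT f ->
  measurable_fun setT (fun x => Ex Q (fun y => f (x, y))).
Proof.
move=> mf; apply: measurableT_comp => //=.
have mfE : measurable_fun setT (fun z => (f z)%:E) by exact/measurable_EFinP.
rewrite (_ : (fun x => _) = (fun x => (fubini_F Q (fun z => (f z)%:E)^\+) x -
    (fubini_F Q (fun z => (f z)%:E)^\-) x)%E); last first.
  apply/funext => x; rewrite [LHS]integralE /fubini_F /=; congr (_ - _)%E.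
    by apply: eq_integral => y _; rewrite !funeposE.
  by apply: eq_integral => y _; rewrite !funenegE.
apply: emeasurable_funB; apply: measurable_fun_fubini_tonelli_F => //.
- exact: measurable_funepos.
- exact: measurable_funeneg.
Qed.

Lemma L1_fubini f : L1 (P \x Q)%E f -> L1 P (fun x => Ex Q (fun y => f (x, y))).
Proof.
move=> Lf; have Lf' := integrable_fubini_F Lf.
have mf : measurable_fun setT f by exact: (L1_measurable Lf).
move/integrableP : Lf' => [mF iF].
apply/integrableP; split; first by apply/measurable_EFinP; exact: measurable_Ex_slice.
apply: le_lt_trans iF; apply: ge0_le_integral => //.
- by apply/measurable_EFinP; apply: measurableT_comp => //; exact: measurable_Ex_slice.
- exact: measurableT_comp.
- move=> x _ /=; rewrite /Ex /Rintegral /fubini_F.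
  by case: (\int[Q]_y _)%E => //= *; rewrite ?normr0 ?leey.
Qed.

Lemma Ex_fubini f : L1 (P \x Q)%E f ->
  Ex (P \x Q)%E f = Ex P (fun x => Ex Q (fun y => f (x, y))).
Proof.
move=> Lf; rewrite /Ex /Rintegral -fubini1//; congr fine; apply: ae_eq_integral => //.
- exact: (measurable_fubini_F Lf).
- by apply/measurable_EFinP; apply: measurable_Ex_slice; exact: (L1_measurable Lf).
- apply: filterS (ae_integrable1 Lf) => x Lfx _.
  by rewrite -[LHS]fineK//; exact: integrable_fin_num.
Qed.

Lemma L1_slice_ae f : L1 (P \x Q)%E f -> {ae P, forall x, L1 Q (fun y => f (x, y))}.
Proof. by move=> Lf; exact: (ae_integrable1 Lf). Qed.

Lemma L1_tonelli f : measurable_fun setT f -> (forall x, L1 Q (fun y => f (x, y))) ->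
  L1 P (fun x => Ex Q (fun y => `|f (x, y)|)) -> L1 (P \x Q)%E f.
Proof.
move=> mf Lf LL; apply/integrableP; split; first exact/measurable_EFinP.
rewrite fubini_tonelli1//; last first.
  by apply: measurableT_comp => //; exact/measurable_EFinP.
rewrite (eq_integral (fun x => (Ex Q (fun y => `|f (x, y)|))%:E)); last first.
  by move=> x _; rewrite /fubini_F -L1_int//; exact: L1_norm.
by rewrite (L1_int LL) ltry.
Qed.

End real_fubini.

Section real_fubini_swap.
Context {d d' : measure_display} {T : measurableType d} {T' : measurableType d'}
  {R : realType} (P : probability T R) (Q : probability T' R).
Implicit Types (f : T * T' -> R).

Lemma measurable_swapped f : measurable_fun setT f ->
  measurable_fun setT (fun z : T' * T => f (z.2, z.1)).
Proof.
by move=> mf; apply: measurableT_comp => //; exact: measurable_fun_pair.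
Qed.

Lemma measurable_Ex_slice2 f : measurable_fun setT f ->
  measurable_fun setT (fun y => Ex P (fun x => f (x, y))).
Proof. by move=> /measurable_swapped; exact: measurable_Ex_slice. Qed.

Lemma Ex_fubini2 f : L1 (P \x Q)%E f ->
  Ex (P \x Q)%E f = Ex Q (fun y => Ex P (fun x => f (x, y))).
Proof.
move=> Lf; rewrite /Ex /Rintegral -fubini2//; congr fine; apply: ae_eq_integral => //.
- exact: (measurable_fubini_G Lf).
- by apply/measurable_EFinP; apply: measurable_Ex_slice2; exact: (L1_measurable Lf).
- apply: filterS (ae_integrable2 Lf) => x Lfx _.
  by rewrite -[LHS]fineK//; exact: integrable_fin_num.
Qed.

Lemma L1_slice2_ae f : L1 (P \x Q)%E f -> {ae Q, forall y, L1 P (fun x => f (x, y))}.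
Proof. by move=> Lf; exact: (ae_integrable2 Lf). Qed.

Lemma Ex_swap f : L1 (P \x Q)%E f ->
  Ex P (fun x => Ex Q (fun y => f (x, y))) = Ex Q (fun y => Ex P (fun x => f (x, y))).
Proof. by move=> Lf; rewrite -Ex_fubini// -Ex_fubini2. Qed.

Lemma L1_prod (f : T -> R) (g : T' -> R) : L1 P f -> L1 Q g ->
  L1 (P \x Q)%E (fun z => f z.1 * g z.2).
Proof.
move=> Lf Lg; apply: L1_tonelli.
- by apply: measurable_funM; apply: measurableT_comp => //;
    [exact: (L1_measurable Lf)|exact: (L1_measurable Lg)].
- by move=> x /=; exact: L1Z.
- apply: (@eq_L1 _ _ _ P (fun x => Ex Q (fun y => `|g y|) * `|f x|)).
    by move=> x /=; rewrite mulrC -ExZ; [apply: eq_Ex => y; rewrite normrM|exact: L1_norm].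
  exact/L1Z/L1_norm.
Qed.

Lemma Ex_prod (f : T -> R) (g : T' -> R) : L1 P f -> L1 Q g ->
  Ex (P \x Q)%E (fun z => f z.1 * g z.2) = Ex P f * Ex Q g.
Proof.
move=> Lf Lg; rewrite Ex_fubini; last exact: L1_prod.
rewrite mulrC -ExZ//; apply: eq_Ex => x /=; rewrite mulrC -ExZ//.
Qed.

Lemma L1_fst (f : T -> R) : L1 P f -> L1 (P \x Q)%E (fun z => f z.1).
Proof. by move=> Lf; apply: eq_L1 (L1_prod Lf (L1_cst Q 1)) => z; rewrite /= mulr1. Qed.

Lemma L1_snd (g : T' -> R) : L1 Q g -> L1 (P \x Q)%E (fun z => g z.2).
Proof. by move=> Lg; apply: eq_L1 (L1_prod (L1_cst P 1) Lg) => z; rewrite /= mul1r. Qed.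

Lemma Ex_fst (f : T -> R) : L1 P f -> Ex (P \x Q)%E (fun z => f z.1) = Ex P f.
Proof.
move=> Lf; have := Ex_prod Lf (L1_cst Q 1); rewrite Ex_cst mulr1 => <-.
by apply: eq_Ex => z; rewrite mulr1.
Qed.

Lemma Ex_snd (g : T' -> R) : L1 Q g -> Ex (P \x Q)%E (fun z => g z.2) = Ex Q g.
Proof.
move=> Lg; have := Ex_prod (L1_cst P 1) Lg; rewrite Ex_cst mul1r => <-.
by apply: eq_Ex => z; rewrite mul1r.
Qed.

End real_fubini_swap.

Section fubini_L2.
Context {d d' : measure_display} {T : measurableType d} {T' : measurableType d'}
  {R : realType} (P : probability T R) (Q : probability T' R).
Implicit Types (f : T * T' -> R).

Let sqr_Ex_le_integral (g : T' -> R) : measurable_fun setT g ->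
  ((Ex Q g ^+ 2)%:E <= \int[Q]_y (g y ^+ 2)%:E)%E.
Proof.
move=> mg; have [Lg|nLg] := pselect (L1 Q (fun y => g y ^+ 2)).
  have L2g : L2 Q g by [].
  rewrite L1_int// lee_fin; apply: le_trans (sqr_Ex_norm_le L2g).
  rewrite -real_normK ?num_real// ler_sqr ?nnegrE//; last exact: Ex_ge0.
  by apply: normr_Ex; exact: L2_L1.
rewrite [leRHS](_ : _ = +oo%E) ?leey//; apply/eqP; apply: contra_notT nLg.
rewrite -ltey => fin; apply/integrableP; split.
  by apply/measurable_EFinP; exact: measurable_funX.
by under eq_integral do rewrite /= ger0_norm ?sqr_ge0//.
Qed.

Lemma L2_fubini f : L2 (P \x Q)%E f -> L2 P (fun x => Ex Q (fun y => f (x, y))).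
Proof.
move=> [mf Lf]; have mg := measurable_Ex_slice Q mf; split => //.
have mf2 : measurable_fun setT (fun z => (f z ^+ 2)%:E).
  by apply/measurable_EFinP; exact: measurable_funX.
apply/integrableP; split; first by apply/measurable_EFinP; exact: measurable_funX.
have f20 z : (0 <= (f z ^+ 2)%:E)%E by rewrite lee_fin sqr_ge0.
have : (\int[(P \x Q)%E]_z (f z ^+ 2)%:E < +oo)%E by rewrite (L1_int Lf) ltey.
rewrite fubini_tonelli1//; apply: le_lt_trans; apply: ge0_le_integral => //.
- by apply: measurableT_comp => //; apply/measurable_EFinP; exact: measurable_funX.
- exact: measurable_fun_fubini_tonelli_F.
- move=> x _; rewrite /fubini_F /= ger0_norm ?sqr_ge0//.
  by apply: sqr_Ex_le_integral; exact: measurable_slice1.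
Qed.

Lemma L2_slice1_ae f : L2 (P \x Q)%E f -> {ae P, forall x, L2 Q (fun y => f (x, y))}.
Proof.
move=> [mf Lf]; apply: filterS (L1_slice_ae Lf) => x Lx; split => //.
exact: measurable_slice1.
Qed.

Lemma L2_slice2_ae f : L2 (P \x Q)%E f -> {ae Q, forall y, L2 P (fun x => f (x, y))}.
Proof.
move=> [mf Lf]; apply: filterS (L1_slice2_ae Lf) => x Lx; split => //.
exact: measurable_slice2.
Qed.

Lemma L2_prod (g : T -> R) (h : T' -> R) : L2 P g -> L2 Q h ->
  L2 (P \x Q)%E (fun z => g z.1 * h z.2).
Proof.
move=> Lg Lh; split.
  by apply: measurable_funM; apply: measurableT_comp => //; [case: Lg|case: Lh].
by apply: eq_L1 (L1_prod Lg.2 Lh.2) => z; rewrite exprMn.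
Qed.

End fubini_L2.

Section law.
Context {d dT : measure_display} {O : measurableType d} {T : measurableType dT}
  {R : realType} (P : probability O R) (G : probability T R) (U : O -> T).
Hypothesis mU : measurable_fun setT U.
Hypothesis UG : forall A, measurable A -> P (U @^-1` A) = G A.

Lemma ge0_integral_law (f : T -> \bar R) : measurable_fun setT f -> (forall t, 0 <= f t)%E ->
  (\int[P]_w f (U w) = \int[G]_t f t)%E.
Proof.
move=> mf f0; rewrite -[LHS](ge0_integral_pushforward mU P measurableT)//.
by apply: eq_measure_integral => A mA _; exact: UG.
Qed.

Lemma integral_law (f : T -> \bar R) : measurable_fun setT f ->
  (\int[P]_w f (U w) = \int[G]_t f t)%E.
Proof.
move=> mf; rewrite integralE [RHS]integralE; congr (_ - _)%E.
  rewrite -ge0_integral_law//; last exact: measurable_funepos.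
  by apply: eq_integral => w _; rewrite !funeposE.
rewrite -ge0_integral_law//; last exact: measurable_funeneg.
by apply: eq_integral => w _; rewrite !funenegE.
Qed.

Lemma L1_law (f : T -> R) : measurable_fun setT f -> L1 P (fun w => f (U w)) <-> L1 G f.
Proof.
move=> mf; have mfE : measurable_fun setT (fun t => (f t)%:E) by exact/measurable_EFinP.
have normE : (\int[P]_w `|(f (U w))%:E| = \int[G]_t `|(f t)%:E|)%E.
  by rewrite -ge0_integral_law//; exact: measurableT_comp.
split => /integrableP[_ fin]; apply/integrableP; split => //.
- by move: fin; rewrite /= normE.
- exact: (measurableT_comp mfE).
- by move: fin; rewrite /= normE.
Qed.

Lemma Ex_law (f : T -> R) : measurable_fun setT f -> Ex P (fun w => f (U w)) = Ex G f.
Proof. by move=> mf; congr fine; apply: integral_law; exact/measurable_EFinP. Qed.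

Lemma L2_law (f : T -> R) : measurable_fun setT f -> L2 P (fun w => f (U w)) <-> L2 G f.
Proof.
move=> mf; have H := L1_law (measurable_funX 2 mf).
by split => -[_ Lf]; split => //; [exact/H|exact: measurableT_comp|exact/H].
Qed.

Lemma ae_law (Q : T -> Prop) : {ae G, forall x, Q x} -> {ae P, forall w, Q (U w)}.
Proof.
move=> [A [mA A0 QA]]; exists (U @^-1` A); split.
- by rewrite -[X in measurable X]setTI; exact: mU.
- by rewrite UG.
- by move=> w nQ; exact: QA.
Qed.

Lemma ae_law_inv (g : T -> R) : measurable_fun setT g ->
  {ae P, forall w, g (U w) = 0} -> {ae G, forall x, g x = 0}.
Proof.
move=> mg g0.
have mA : measurable (g @^-1` (~` [set 0])).
  by rewrite -[X in measurable X]setTI; apply: mg => //; exact: measurableC.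
exists (g @^-1` (~` [set 0])); split => //.
rewrite -UG//; apply/negligibleP.
  by rewrite -[X in measurable X]setTI; exact: mU.
by apply: negligibleS g0 => w /= gw.
Qed.

End law.

(** * Laws of finite families *)

Section law_of_tuples.
Context {d : measure_display} {S : measurableType d} {R : realType}.

Lemma tuple_law_unique n (mu nu : probability (n.-tuple S) R) :
  (forall A : 'I_n -> set S, (forall i, measurable (A i)) ->
     mu [set t | forall i, A i (tnth t i)] = nu [set t | forall i, A i (tnth t i)]) ->
  forall B, measurable B -> mu B = nu B.
Proof.
move=> munu.
pose G := [set B : set (n.-tuple S) | exists2 A : 'I_n -> set S,
  (forall i, measurable (A i)) & B = [set t | forall i, A i (tnth t i)]].
have GT : G setT by exists (fun=> setT) => //; apply/seteqP; split.
apply: (measure_unique G (fun=> setT)) => //.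
- apply/seteqP; split => [B|B].
  + move=> mB; have {mB} : <<s \big[setU/set0]_(i < n)
      preimage_set_system setT (fun t : n.-tuple S => tnth t i) measurable >> B by exact: mB.
    apply: smallest_sub; first exact: smallest_sigma_algebra.
    move=> C; rewrite -bigcup_seq => -[i _] /= [B' mB' <-].
    apply: sub_sigma_algebra; exists (fun j => if j == i then B' else setT).
      by move=> j; case: ifP.
    rewrite setTI; apply/seteqP; split => [t /= Bt j|t /= /(_ i)]; last by rewrite eqxx.
    by case: ifPn => // /eqP ->.
  + apply: smallest_sub; first exact: sigma_algebra_measurable.
    move=> _ [A mA ->].
    rewrite (_ : [set t | _] = \bigcap_(i in [set: 'I_n]) ((fun t => tnth t i) @^-1` A i)).
      apply: fin_bigcap_measurable => // i _.
      by rewrite -[X in measurable X]setTI; exact: measurable_tnth.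
    by apply/seteqP; split => [t /= At i _|t /= At i]; exact: At.
- move=> _ _ [A mA ->] [B mB ->]; exists (fun i => A i `&` B i).
    by move=> i; exact: measurableI.
  apply/seteqP; split => [t [At Bt] i|t AB]; first by split.
  by split => i; case: (AB i).
- by apply/seteqP; split => // t _; exists 0%N.
- by move=> B [A mA ->]; exact: munu.
- by move=> k; rewrite ltey_eq fin_num_measure.
Qed.

End law_of_tuples.

Lemma bigsetIP (I : eqType) (T : Type) (L : seq I) (F : I -> set T) w :
  (\big[setI/setT]_(i <- L) F i) w <-> (forall i, i \in L -> F i w).
Proof.
elim: L => [|i L IH]; first by rewrite big_nil; split.
rewrite big_cons; split => [[Fi /IH FL] j|FL].
  by rewrite in_cons => /predU1P[->|/FL].
by split; [apply: FL; rewrite mem_head|apply/IH => j jL; apply: FL; rewrite in_cons jL orbT].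
Qed.

Section finitary_functionals.
Context {d : measure_display} {S : measurableType d} {R : realType} {I : eqType}.
Implicit Types (L : seq I) (Phi Psi : (I -> S) -> R).

(* A functional of a family [z : I -> S] which looks at the coordinates in [L]
   only and is measurable along every measurable family. *)
Definition finitary L Phi : Prop :=
  (forall z z', (forall i, i \in L -> z i = z' i) -> Phi z = Phi z') /\
  (forall (d' : measure_display) (T : measurableType d') (Y : I -> T -> S),
     (forall i, measurable_fun setT (Y i)) ->
     measurable_fun setT (fun w => Phi (Y ^~ w))).

Lemma measurable_finitary L Phi (d' : measure_display) (T : measurableType d')
    (Y : I -> T -> S) : finitary L Phi -> (forall i, measurable_fun setT (Y i)) ->
  measurable_fun setT (fun w => Phi (Y ^~ w)).
Proof. by move=> [_]; apply. Qed.

Lemma finitary_sub L L' Phi : {subset L <= L'} -> finitary L Phi -> finitary L' Phi.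
Proof.
by move=> LL' [Phi_dep Phi_meas]; split => // z z' zz'; apply: Phi_dep => i iL;
   apply: zz'; exact: LL'.
Qed.

Lemma finitary_undup L Phi : finitary L Phi -> finitary (undup L) Phi.
Proof. by apply: finitary_sub => i; rewrite mem_undup. Qed.

Lemma finitary_comp L Phi (g : R -> R) : measurable_fun setT g ->
  finitary L Phi -> finitary L (fun z => g (Phi z)).
Proof.
move=> mg [Phi_dep Phi_meas]; split => [z z' zz'|d' T Y mY].
  by rewrite (Phi_dep z z').
by apply: (measurableT_comp mg); exact: Phi_meas.
Qed.

Lemma finitaryM L L' Phi Psi : finitary L Phi -> finitary L' Psi ->
  finitary (L ++ L') (fun z => Phi z * Psi z).
Proof.
move=> [Phi_dep Phi_meas] [Psi_dep Psi_meas]; split => [z z' zz'|d' T Y mY].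
  by congr (_ * _); [apply: Phi_dep|apply: Psi_dep] => i iL; apply: zz';
     rewrite mem_cat iL ?orbT.
by apply: measurable_funM; [exact: Phi_meas|exact: Psi_meas].
Qed.

Lemma finitary_coord (g : S -> R) i : measurable_fun setT g ->
  finitary [:: i] (fun z => g (z i)).
Proof.
move=> mg; split => [z z' zz'|d' T Y mY]; first by rewrite zz' ?mem_head.
exact: measurableT_comp.
Qed.

Lemma finitary_prod (g : I -> S -> R) L : (forall i, measurable_fun setT (g i)) ->
  finitary L (fun z => \prod_(i <- L) g i (z i)).
Proof.
move=> mg; elim: L => [|i L IH].
  split => [z z' _|d' T Y mY]; first by rewrite !big_nil.
  by under eq_fun => w do rewrite big_nil; exact: measurable_cst.
have := finitaryM (finitary_coord i (mg i)) IH.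
by rewrite (_ : (fun z => _) = (fun z : I -> S => \prod_(j <- i :: L) g j (z j)))//;
   apply/funext => z; rewrite big_cons.
Qed.

Definition restrict (T : Type) L (Y : I -> T -> S) (w : T) : (size L).-tuple S :=
  [tuple Y (tnth (in_tuple L) i) w | i < size L].

Lemma measurable_restrict_family (d' : measure_display) (T : measurableType d') L
    (Y : I -> T -> S) :
  (forall i, measurable_fun setT (Y i)) -> measurable_fun setT (restrict L Y).
Proof.
move=> mY; apply/measurable_fun_tnthP => i.
by rewrite (_ : _ \o _ = Y (tnth (in_tuple L) i))//; apply/funext => w /=;
   rewrite tnth_mktuple.
Qed.

Lemma preimage_restrict (T : Type) L (Y : I -> T -> S) (A : 'I_(size L) -> set S) :
  uniq L -> restrict L Y @^-1` [set t | forall i, A i (tnth t i)] =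
  \big[setI/setT]_(i <- L) (Y i @^-1`
    (if insub (index i L) is Some j then A j else setT)).
Proof.
move=> uL; apply/seteqP; split => [w /= At|w /bigsetIP /= At i].
  apply/bigsetIP => i iL /=; case: insubP => //= j _ ji; have := At j.
  by rewrite tnth_mktuple (tnth_nth i) /= ji nth_index.
rewrite tnth_mktuple; have iL : tnth (in_tuple L) i \in L by exact: mem_tnth.
have := At _ iL; rewrite (_ : index _ L = i).
  by rewrite insubT//= => ?; rewrite (_ : Sub _ _ = i)//; exact: val_inj.
by rewrite (tnth_nth (tnth (in_tuple L) i)) /= index_uniq.
Qed.

Lemma finitary_restrict L Phi : finitary L Phi -> exists phi : (size L).-tuple S -> R,
  measurable_fun setT phi /\
  forall (T : Type) (Y : I -> T -> S) w, phi (restrict L Y w) = Phi (Y ^~ w).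
Proof.
move=> [Phi_dep Phi_meas]; exists (fun t => Phi (fun i => nth point t (index i L))); split.
  apply: (Phi_meas _ _ (fun i (t : (size L).-tuple S) => nth point t (index i L))) => i.
  have [iL|iL] := boolP (index i L < size L)%N.
    rewrite (_ : (fun _ => _) = fun t : (size L).-tuple S => tnth t (Ordinal iL)).
      exact: measurable_tnth.
    by apply/funext => t; rewrite (tnth_nth point).
  rewrite (_ : (fun _ => _) = fun=> point)//; apply/funext => t.
  by rewrite nth_default// size_tuple leqNgt.
move=> T Y w; apply: Phi_dep => i iL.
have iL' : (index i L < size L)%N by rewrite index_mem.
rewrite -[X in nth _ _ X]/(nat_of_ord (Ordinal iL')) -tnth_nth tnth_mktuple.
by rewrite (tnth_nth i) /= nth_index.
Qed.

End finitary_functionals.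

Section same_law.
Context {d d1 d2 : measure_display} {S : measurableType d} {R : realType} {I : eqType}
  {O1 : measurableType d1} {O2 : measurableType d2}
  (P1 : probability O1 R) (P2 : probability O2 R)
  (Y1 : I -> O1 -> S) (Y2 : I -> O2 -> S).
Implicit Types (L : seq I) (Phi : (I -> S) -> R).

Definition same_law L := forall A : I -> set S, (forall i, measurable (A i)) ->
  P1 (\big[setI/setT]_(i <- L) (Y1 i @^-1` A i)) =
  P2 (\big[setI/setT]_(i <- L) (Y2 i @^-1` A i)).

Lemma independent_same_law L : uniq L ->
  mutually_independent P1 Y1 -> mutually_independent P2 Y2 ->
  (forall i A, measurable A -> P1 (Y1 i @^-1` A) = P2 (Y2 i @^-1` A)) -> same_law L.
Proof.
move=> uL iY1 iY2 YY A mA; rewrite iY1// iY2//.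
by apply: eq_bigr => i _; exact: YY.
Qed.

Hypothesis mY1 : forall i, measurable_fun setT (Y1 i).
Hypothesis mY2 : forall i, measurable_fun setT (Y2 i).

Let U2 L : {RV P2 >-> (size L).-tuple S} :=
  mfun_Sub (mem_set (measurable_restrict_family (L := L) mY2)).

Let restrict_law L : uniq L -> same_law L -> forall B, measurable B ->
  P1 (restrict L Y1 @^-1` B) = distribution P2 (U2 L) B.
Proof.
move=> uL YY; pose U1 : {RV P1 >-> (size L).-tuple S} :=
  mfun_Sub (mem_set (measurable_restrict_family (L := L) mY1)).
apply: (tuple_law_unique (mu := distribution P1 U1)) => A mA.
change (P1 (restrict L Y1 @^-1` [set t | forall i, A i (tnth t i)]) =
        P2 (restrict L Y2 @^-1` [set t | forall i, A i (tnth t i)])).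
by rewrite !preimage_restrict//; apply: YY => i; case: insubP.
Qed.

Lemma same_law_integral L Phi : uniq L -> same_law L -> finitary L Phi ->
  (\int[P1]_w (Phi (Y1 ^~ w))%:E = \int[P2]_w (Phi (Y2 ^~ w))%:E)%E.
Proof.
move=> uL YY /finitary_restrict[phi [/measurable_EFinP mphi phiE]].
under eq_integral do rewrite -phiE.
under [RHS]eq_integral do rewrite -phiE.
have mU1 := measurable_restrict_family (L := L) mY1.
rewrite (integral_law mU1 (restrict_law uL YY) mphi).
by rewrite -(integral_law (P := P2) (U := U2 L) (measurable_funP _) _ mphi).
Qed.

Lemma same_law_Ex L Phi : same_law (undup L) -> finitary L Phi ->
  Ex P1 (fun w => Phi (Y1 ^~ w)) = Ex P2 (fun w => Phi (Y2 ^~ w)).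
Proof.
move=> YY /finitary_undup finPhi; congr fine.
exact: same_law_integral (undup_uniq L) YY finPhi.
Qed.

Lemma same_law_L1 L Phi : same_law (undup L) -> finitary L Phi ->
  L1 P1 (fun w => Phi (Y1 ^~ w)) <-> L1 P2 (fun w => Phi (Y2 ^~ w)).
Proof.
move=> YY finPhi; have [_ mPhi] := finPhi.
have finN : finitary (undup L) (fun z => `|Phi z|).
  by apply/finitary_undup/(finitary_comp (g := Num.norm)).
have normE := same_law_integral (undup_uniq L) YY finN.
split => /integrableP[_ fin]; apply/integrableP; split.
- by apply/measurable_EFinP; exact: mPhi.
- by move: fin; rewrite /= normE.
- by apply/measurable_EFinP; exact: mPhi.
- by move: fin; rewrite /= normE.
Qed.

End same_law.

Section independent_families.
Context {d dS : measure_display} {O : measurableType d} {S : measurableType dS}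
  {R : realType} {I : eqType} (P : probability O R) (X : I -> O -> S).
Hypothesis iX : mutually_independent P X.

Lemma independent_reindex (I' : eqType) (f : I' -> I) : injective f ->
  mutually_independent P (fun i => X (f i)).
Proof.
move=> fI J A uJ mA.
have [J0|[i0 _]] : J = [::] \/ exists i0, i0 \in J.
  by case: J {uJ mA} => [|i0 J]; [left|right; exists i0; rewrite mem_head].
  by rewrite J0 !big_nil probability_setT.
pose g j := nth i0 J (index j (map f J)).
have gf i : i \in J -> g (f i) = i by apply: nth_index_map => ? ? _ _; exact: fI.
transitivity (P (\big[setI/setT]_(j <- map f J) (X j @^-1` A (g j)))).
  by rewrite big_map; congr (P _); apply: eq_big_seq => i /gf ->.
rewrite iX ?map_inj_uniq//; last by move=> _ /mapP[i iJ ->]; rewrite gf//; exact: mA.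
by rewrite big_map; apply: eq_big_seq => i /gf ->.
Qed.

Lemma independent_comp (d' : measure_display) (S' : measurableType d')
    (g : I -> S -> S') : (forall i, measurable_fun setT (g i)) ->
  mutually_independent P (fun i w => g i (X i w)).
Proof.
move=> mg J A uJ mA; apply: (iX (A := fun i => g i @^-1` A i) uJ) => i iJ.
by rewrite -[X in measurable X]setTI; apply: mg => //; exact: mA.
Qed.

Hypothesis mX : forall i, measurable_fun setT (X i).

(* Independence: the coordinates in [A] may be resampled. *)
Definition remix (A : pred I) (i : I) (z : O * O) : S := X i (if A i then z.2 else z.1).

Lemma measurable_remix A i : measurable_fun setT (remix A i).
Proof. by rewrite /remix; case: (A i); exact: measurableT_comp. Qed.

Lemma remix_same_law A L : uniq L -> same_law P (P \x P)%E X (remix A) L.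
Proof.
move=> uL B mB.
have -> : \big[setI/setT]_(i <- L) (remix A i @^-1` B i) =
    (\big[setI/setT]_(i <- [seq i <- L | ~~ A i]) (X i @^-1` B i)) `*`
    (\big[setI/setT]_(i <- [seq i <- L | A i]) (X i @^-1` B i)).
  apply/seteqP; split => [z /bigsetIP zB|z [/bigsetIP z1 /bigsetIP z2]].
    split; apply/bigsetIP => i; rewrite mem_filter => /andP[Ai iL];
      by have := zB _ iL; rewrite /= /remix ?Ai ?(negbTE Ai).
  apply/bigsetIP => i iL; rewrite /= /remix; case: ifPn => Ai.
    by apply: z2; rewrite mem_filter Ai.
  by apply: z1; rewrite mem_filter Ai.
have mXB i : measurable (X i @^-1` B i) by rewrite -[X in measurable X]setTI; exact: mX.
have mXBs (s : seq I) : measurable (\big[setI/setT]_(i <- s) (X i @^-1` B i)).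
  exact: bigsetI_measurable.
apply: etrans (esym (product_measure1E P P (mXBs _) (mXBs _))).
have iXB (s : seq I) : uniq s -> P (\big[setI/setT]_(i <- s) (X i @^-1` B i)) =
    (\prod_(i <- s) P (X i @^-1` B i))%E by move=> us; exact: iX.
apply: etrans (iXB _ uL) _.
rewrite (bigID A) /= muleC.
by congr (_ * _)%E; rewrite -big_filter; exact/esym/iXB/filter_uniq.
Qed.

Lemma Ex_remix A L Phi : finitary L Phi ->
  Ex P (fun w => Phi (X ^~ w)) = Ex (P \x P)%E (fun z => Phi (remix A ^~ z)).
Proof.
apply: (same_law_Ex mX (measurable_remix A)).
exact/remix_same_law/undup_uniq.
Qed.

Lemma L1_remix A L Phi : finitary L Phi ->
  L1 P (fun w => Phi (X ^~ w)) <-> L1 (P \x P)%E (fun z => Phi (remix A ^~ z)).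
Proof.
apply: (same_law_L1 mX (measurable_remix A)).
exact/remix_same_law/undup_uniq.
Qed.

Lemma Ex_resample A L Phi : finitary L Phi -> L1 P (fun w => Phi (X ^~ w)) ->
  Ex P (fun w => Phi (X ^~ w)) =
  Ex P (fun w => Ex P (fun w' => Phi (fun i => X i (if A i then w' else w)))).
Proof.
move=> PhiL Lf; rewrite (Ex_remix A PhiL) Ex_fubini//.
exact: (L1_remix A PhiL).1.
Qed.

(* The conditional mean of [Phi (X ^~ w)] given the coordinates outside [A]. *)
Definition partial_mean (A : pred I) (Phi : (I -> S) -> R) (z : I -> S) : R :=
  Ex P (fun w => Phi (fun i => if A i then X i w else z i)).

Let remix_splice A (Phi : (I -> S) -> R) z :
  Phi (remix A ^~ z) = Phi (fun i => if A i then X i z.2 else X i z.1).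
Proof. by congr Phi; apply/funext => i; rewrite /remix; case: (A i). Qed.

Lemma finitary_partial_mean A L Phi : finitary L Phi -> finitary L (partial_mean A Phi).
Proof.
move=> finPhi; split => [z z' zz'|d' T Y mY].
  by apply: eq_Ex => w; apply: finPhi.1 => i iL; case: (A i) => //; exact: zz'.
apply: (measurable_Ex_slice P (f := fun q : T * O => Phi (fun i => if A i then X i q.2 else Y i q.1))).
apply: (measurable_finitary (Y := fun i (q : T * O) => if A i then X i q.2 else Y i q.1) finPhi) => i.
by case: (A i); [exact: (measurableT_comp (mX i))|exact: (measurableT_comp (mY i))].
Qed.

Lemma L2_partial_mean A L Phi : finitary L Phi -> L2 P (fun w => Phi (X ^~ w)) ->
  L2 P (fun w => partial_mean A Phi (X ^~ w)).
Proof.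
move=> finPhi [_ L2Phi]; have finPhi2 := finitary_comp (measurable_funX 2 (@measurable_id _ R setT)) finPhi.
have L2remix : L2 (P \x P)%E (fun z => Phi (remix A ^~ z)).
  split; first exact: measurable_finitary finPhi (measurable_remix A).
  exact/(L1_remix A finPhi2).
by apply: eq_L2 (L2_fubini L2remix) => w; apply: eq_Ex => w'; rewrite remix_splice.
Qed.

Lemma Ex_partial_mean A L Phi : finitary L Phi -> L1 P (fun w => Phi (X ^~ w)) ->
  Ex P (fun w => partial_mean A Phi (X ^~ w)) = Ex P (fun w => Phi (X ^~ w)).
Proof.
move=> finPhi LPhi; rewrite (Ex_resample A finPhi LPhi); apply: eq_Ex => w.
by apply: eq_Ex => w'; rewrite -(remix_splice A Phi (w, w')).
Qed.

Lemma L1_partial_ae A L Phi : finitary L Phi -> L1 P (fun w => Phi (X ^~ w)) ->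
  {ae P, forall w, L1 P (fun w' => Phi (fun i => if A i then X i w' else X i w))}.
Proof.
move=> finPhi /(L1_remix A finPhi) /L1_slice_ae; apply: filterS => w.
by apply: eq_L1 => w'; rewrite remix_splice.
Qed.

Lemma Ex_mul_partial_mean A L L' Phi Psi : finitary L Phi -> finitary L' Psi ->
  {in L', forall i, ~~ A i} -> L1 P (fun w => Phi (X ^~ w)) ->
  L1 P (fun w => Psi (X ^~ w) * Phi (X ^~ w)) ->
  Ex P (fun w => Psi (X ^~ w) * Phi (X ^~ w)) =
  Ex P (fun w => Psi (X ^~ w) * partial_mean A Phi (X ^~ w)).
Proof.
move=> finPhi finPsi L'A LPhi LPsiPhi; have finPP := finitaryM finPsi finPhi.
rewrite -(Ex_partial_mean A finPP LPsiPhi); apply: ae_eq_Ex.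
- exact: measurable_finitary (finitary_partial_mean A finPP) mX.
- exact: measurable_finitary (finitaryM finPsi (finitary_partial_mean A finPhi)) mX.
apply: filterS (L1_partial_ae A finPhi LPhi) => w Lw.
rewrite /partial_mean -ExZ//; apply: eq_Ex => w'; congr (_ * _).
by apply: finPsi.1 => i /L'A /negPf ->.
Qed.

Lemma independent_prod (g : I -> S -> R) (J : seq I) : uniq J ->
  (forall i, measurable_fun setT (g i)) -> (forall i, L1 P (fun w => g i (X i w))) ->
  L1 P (fun w => \prod_(i <- J) g i (X i w)) /\
  Ex P (fun w => \prod_(i <- J) g i (X i w)) = \prod_(i <- J) Ex P (fun w => g i (X i w)).
Proof.
move=> + mg Lg; elim: J => [_|i J IH /= /andP[iJ /IH[LJ EJ]]].
  rewrite big_nil -[RHS](Ex_cst P); split; last by apply: eq_Ex => w; rewrite big_nil.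
  by apply: eq_L1 (L1_cst P 1) => w; rewrite big_nil.
have finPhi := finitary_prod (i :: J) mg.
have remixE z : \prod_(j <- i :: J) g j (remix (pred1 i) j z) =
    (\prod_(j <- J) g j (X j z.1)) * g i (X i z.2).
  rewrite big_cons mulrC /remix /= eqxx; congr (_ * _).
  by apply: eq_big_seq => j jJ; rewrite (negPf (memPn iJ _ jJ)).
split.
  apply/(L1_remix (pred1 i) finPhi); apply: eq_L1 (L1_prod LJ (Lg i)) => z.
  by rewrite remixE.
rewrite (Ex_remix (pred1 i) finPhi); under eq_Ex do rewrite remixE.
by rewrite (Ex_prod LJ (Lg i)) EJ big_cons mulrC.
Qed.

End independent_families.

Lemma indic_bigsetI (T : Type) (R : pzRingType) (I : Type) (J : seq I) (A : I -> set T) x :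
  \1_(\big[setI/setT]_(i <- J) A i) x = \prod_(i <- J) (\1_(A i) x : R).
Proof.
elim: J => [|i J IH]; first by rewrite !big_nil indicT.
by rewrite !big_cons indicI -IH.
Qed.

Lemma Ex_indic {d : measure_display} {T : measurableType d} {R : realType}
    (P : probability T R) (A : set T) : measurable A -> P A = (Ex P \1_A)%:E.
Proof.
move=> mA; rewrite /Ex /Rintegral (integral_indic P measurableT mA) setIT fineK//.
exact: fin_num_measure.
Qed.

Lemma L1_indic {d : measure_display} {T : measurableType d} {R : realType}
    (P : probability T R) (A : set T) : measurable A -> L1 P \1_A.
Proof.
move=> mA; apply: (L1_bnd P (M := 1)); first exact: measurable_indic.
by move=> x; rewrite indicE; case: (x \in A); rewrite ?normr1 ?normr0.
Qed.

Section independent_pairs.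
Context {d dS : measure_display} {O : measurableType d} {S : measurableType dS}
  {R : realType} {I : eqType} (P : probability O R) (X : I -> O -> S).
Hypothesis iX : mutually_independent P X.
Hypothesis mX : forall i, measurable_fun setT (X i).

Lemma independent_pairs :
  mutually_independent (P \x P)%E (fun i z => (X i z.1, X i z.2)).
Proof.
move=> J A uJ mA.
pose V i (z : O * O) := (X i z.1, X i z.2).
have mV i : measurable_fun setT (V i).
  by apply: measurable_fun_pair; exact: (measurableT_comp (mX i)).
pose B i := if i \in J then A i else set0.
have mB i : measurable (B i) by rewrite /B; case: ifP => // /mA.
have mVB i : measurable (V i @^-1` B i) by rewrite -[X in measurable X]setTI; exact: mV.
have LB := L1_indic (P \x P)%E (mVB _).
pose g i s : R := Ex P (fun w => \1_(B i) (s, X i w)).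
have mBX i : measurable_fun setT (fun z : S * O => \1_(B i) (z.1, X i z.2) : R).
  apply: (measurableT_comp (measurable_indic (mB i))).
  by apply: measurable_fun_pair => //; exact: (measurableT_comp (mX i)).
have mg i : measurable_fun setT (g i) by exact: measurable_Ex_slice (mBX i).
have Lg i : L1 P (fun w => g i (X i w)) by exact: (L1_fubini (LB i)).
rewrite (eq_big_seq (fun i => V i @^-1` B i)); last by move=> i iJ; rewrite /B iJ.
rewrite [RHS](eq_big_seq (fun i => (P \x P)%E (V i @^-1` B i))); last first.
  by move=> i iJ; rewrite /B iJ.
under [RHS]eq_bigr do rewrite Ex_indic// (Ex_fubini (LB _)).
have mE : measurable (\big[setI/setT]_(i <- J) (V i @^-1` B i)) by exact: bigsetI_measurable.
rewrite Ex_indic// (Ex_fubini (L1_indic _ mE)) prodEFin; congr EFin.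
rewrite -(independent_prod iX mX uJ mg Lg).2; apply: eq_Ex => w.
under eq_Ex do rewrite indic_bigsetI.
have mBw i : measurable_fun setT (fun s => \1_(B i) (X i w, s) : R).
  exact: (measurable_slice1 (f := \1_(B i)) (X i w) (measurable_indic (mB i))).
apply: (independent_prod iX mX uJ mBw _).2 => i.
apply: (L1_bnd _ (M := 1)); first exact: (measurable_slice1 (f := fun z => \1_(B i) (z.1, X i z.2))).
by move=> w'; rewrite indicE; case: (_ \in _); rewrite ?normr1 ?normr0.
Qed.

End independent_pairs.

Section exchangeable_reindexing.
Context {d dS : measure_display} {O : measurableType d} {S : measurableType dS}
  {R : realType} {I : eqType} (P : probability O R) (X : I -> O -> S).
Hypothesis mX : forall i, measurable_fun setT (X i).
Hypothesis iX : mutually_independent P X.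
Hypothesis idX : forall i j A, measurable A -> P (X i @^-1` A) = P (X j @^-1` A).

Lemma reindex_same_law (f : I -> I) L : {in L &, injective f} ->
  same_law P P X (fun i => X (f i)) (undup L).
Proof.
move=> fI B mB; have {}fI : {in undup L &, injective f}.
  by move=> i j; rewrite !mem_undup; exact: fI.
move: (undup L) (undup_uniq L) fI => {}L uL fI.
have [->|[i0 _]] : L = [::] \/ exists i0, i0 \in L.
  by case: L {uL fI} => [|i0 L]; [left|right; exists i0; rewrite mem_head].
  by rewrite !big_nil.
pose g j := nth i0 L (index j (map f L)).
have gf i : i \in L -> g (f i) = i by exact: nth_index_map.
transitivity (P (\big[setI/setT]_(j <- map f L) (X j @^-1` B (g j)))); last first.
  by rewrite big_map; congr (P _); apply: eq_big_seq => i /gf ->.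
rewrite !iX ?map_inj_in_uniq// big_map.
by apply: eq_big_seq => i iL; rewrite gf//; exact: idX.
Qed.

Lemma Ex_reindex (f : I -> I) L Phi : {in L &, injective f} -> finitary L Phi ->
  Ex P (fun w => Phi (X ^~ w)) = Ex P (fun w => Phi (fun i => X (f i) w)).
Proof. by move=> /reindex_same_law; apply: same_law_Ex. Qed.

Lemma L1_reindex (f : I -> I) L Phi : {in L &, injective f} -> finitary L Phi ->
  L1 P (fun w => Phi (X ^~ w)) <-> L1 P (fun w => Phi (fun i => X (f i) w)).
Proof. by move=> /reindex_same_law; apply: same_law_L1. Qed.

Lemma ae_reindex (f : I -> I) L (Phi : (I -> S) -> R) :
  {in L &, injective f} -> finitary L Phi ->
  {ae P, forall w, Phi (X ^~ w) = 0} -> {ae P, forall w, Phi (fun i => X (f i) w) = 0}.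
Proof.
move=> fI finPhi Phi0; pose g (x : R) := Num.min `|x| 1.
have g01 x : 0 <= g x <= 1 by rewrite le_min normr_ge0 ler01 ge_min lexx orbT.
have mg : measurable_fun setT g by exact: measurable_minr.
have fing := finitary_comp mg finPhi.
have Ef0 : Ex P (fun w => g (Phi (fun i => X (f i) w))) = 0.
  rewrite -(Ex_reindex fI fing); apply: ae_eq0_Ex; first exact: measurable_finitary fing mX.
  by apply: filterS Phi0 => w ->; rewrite /g normr0 minEle ler01.
have Lf : L1 P (fun w => g (Phi (fun i => X (f i) w))).
  apply: (L1_bnd P (M := 1)); first exact: (measurable_finitary fing (fun i => mX (f i))).
  by move=> w; have /andP[? ?] := g01 (Phi (fun i => X (f i) w)); rewrite ger0_norm.
apply: filterS (Ex0_ae Lf (fun w => (andP (g01 _)).1) Ef0) => w.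
rewrite /g minEle; case: ifP => _; first by move/normr0_eq0.
by move/eqP; rewrite oner_eq0.
Qed.

End exchangeable_reindexing.

Section iid_pairs.
Context {d dS : measure_display} {O : measurableType d} {S : measurableType dS}
  {R : realType} {I : eqType} (P : probability O R) (X : I -> O -> S) (F : probability S R).
Hypothesis mX : forall i, measurable_fun setT (X i).
Hypothesis iX : mutually_independent P X.
Hypothesis FX : forall e A, measurable A -> P (X e @^-1` A) = F A.

Lemma measurable_sample_pair e e' : measurable_fun setT (fun w => (X e w, X e' w)).
Proof. exact: measurable_fun_pair. Qed.

Lemma pair_law e e' : e != e' -> forall B, measurable B ->
  P ((fun w => (X e w, X e' w)) @^-1` B) = (F \x F)%E B.
Proof.
move=> ee' B mB.
pose V : {RV P >-> (S * S)%type} := mfun_Sub (mem_set (measurable_sample_pair e e')).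
apply/esym; apply: (product_measure_unique (m1 := F) (m2 := F) (m' := distribution P V)) => // A C mA mC.
have := iX (J := [:: e; e']) (A := fun i => if i == e then A else C).
rewrite /= inE ee' /= => /(_ isT) H.
have {}H := H (fun i => ltac:(by case: ifP)).
move: H; rewrite !big_cons !big_nil eqxx eq_sym (negbTE ee') setIT mule1 !FX// => <-.
Qed.

Lemma Ex_iid_mul e e' (f g : S -> R) : e != e' -> L1 F f -> L1 F g ->
  Ex P (fun w => f (X e w) * g (X e' w)) = Ex F f * Ex F g.
Proof.
move=> ee' Lf Lg; rewrite -Ex_prod//.
apply: (Ex_law (measurable_sample_pair e e') (pair_law ee')).
exact: (L1_measurable (L1_prod Lf Lg)).
Qed.

End iid_pairs.

(** * Weak convergence *)

Section derivative_bounds.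
Context {R : realType}.
Implicit Types (f : R -> R) (K M : R).

Lemma klipschitzP K f : K.-lipschitz f <-> forall x y : R, `|f x - f y| <= K * `|x - y|.
Proof. by split => [fK x y|fK [x y] _]; [exact: (fK (x, y))|exact: fK]. Qed.

Lemma klipschitz_ge0 K f : K.-lipschitz f -> 0 <= K.
Proof.
move=> /klipschitzP /(_ 1 0); rewrite subr0 normr1 mulr1; exact: le_trans.
Qed.

Lemma klipschitz_le K K' f : K <= K' -> K.-lipschitz f -> K'.-lipschitz f.
Proof.
move=> KK' /klipschitzP fK; apply/klipschitzP => x y.
by apply: le_trans (fK x y) _; rewrite ler_wpM2r.
Qed.

Lemma klipschitz_continuous K f : K.-lipschitz f -> continuous f.
Proof.
move=> fK x; have K0 := klipschitz_ge0 fK; move/klipschitzP : fK => fK.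
apply/cvgrPdist_le => e e0; near=> y; rewrite (le_trans (fK _ _))//.
have : `|x - y| <= e / (K + 1).
  by near: y; apply: cvgr_dist_le => //; rewrite divr_gt0// ltr_wpDl.
rewrite ler_pdivlMr ?ltr_wpDl// mulrDr mulr1 mulrC; have := normr_ge0 (x - y); lra.
Unshelve. all: by end_near. Qed.

Lemma continuous_measurable f : continuous f -> measurable_fun setT f.
Proof. by move=> cf; exact: continuous_measurable_fun. Qed.

Lemma is_derive_continuous (f f1 : R -> R) : (forall x : R, is_derive x 1 f (f1 x)) -> continuous f.
Proof.
move=> df x; apply: differentiable_continuous; apply/derivable1_diffP.
by case: (df x).
Qed.

Lemma derive_mvt (f f1 : R -> R) (x y : R) : (forall x : R, is_derive x 1 f (f1 x)) ->
  exists2 c, `|c - x| <= `|y - x| & f y - f x = f1 c * (y - x).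
Proof.
move=> df; have cf := is_derive_continuous df.
have [xy|yx] := leP x y.
  have [c cI E] := MVT_segment xy (fun t _ => df t) (continuous_subspaceT cf).
  exists c => //; move: cI; rewrite in_itv /= => /andP[xc cy].
  by rewrite !ger0_norm ?subr_ge0// lerB.
have [c cI E] := MVT_segment (ltW yx) (fun t _ => df t) (continuous_subspaceT cf).
exists c; last by rewrite -opprB E -mulrN opprB.
move: cI; rewrite in_itv /= => /andP[xc cy].
by rewrite !ler0_norm ?subr_le0// ?(ltW yx)// !opprB lerB.
Qed.

Lemma derive_klipschitz f (f1 : R -> R) M : (forall x : R, is_derive x 1 f (f1 x)) ->
  (forall x, `|f1 x| <= M) -> M.-lipschitz f.
Proof.
move=> df f1M; apply/klipschitzP => x y; have [c _ ->] := derive_mvt y x df.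
by rewrite normrM ler_wpM2r.
Qed.

Lemma taylor2_quad f (f1 f2 : R -> R) M : (forall x : R, is_derive x 1 f (f1 x)) ->
  (forall x : R, is_derive x 1 f1 (f2 x)) -> (forall x, `|f2 x| <= M) ->
  forall x h, `|f (x + h) - f x - f1 x * h| <= M * h ^+ 2.
Proof.
move=> df df1 f2M x h; have [c cx ->] := derive_mvt x (x + h) df.
rewrite addrAC subrr add0r in cx *.
rewrite -mulrBl normrM -(real_normK (num_real h)) expr2 mulrA.
have f1M := derive_klipschitz df1 f2M.
apply: ler_wpM2r => //; apply: le_trans ((klipschitzP _ _).1 f1M c x) _.
by apply: ler_wpM2l => //; exact: klipschitz_ge0 f1M.
Qed.

Lemma taylor2_cubic f (f1 f2 : R -> R) K : (forall x : R, is_derive x 1 f (f1 x)) ->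
  (forall x : R, is_derive x 1 f1 (f2 x)) -> K.-lipschitz f2 ->
  forall x h, `|f (x + h) - f x - f1 x * h - f2 x * h ^+ 2 / 2| <= K * `|h| ^+ 3.
Proof.
move=> df df1 f2K x h.
pose g y := f y - f1 x * (y - x) - f2 x * (y - x) ^+ 2 / 2.
have dg (y : R) : is_derive y 1 g (f1 y - f1 x - f2 x * (y - x)).
  have dl : is_derive y 1 (fun y => y - x) (1 : R).
    by have := is_deriveB (is_derive_id y (1 : R)) (is_derive_cst x y (1 : R));
       rewrite subr0.
  have := is_deriveB (is_deriveB (df y) (is_deriveZ (f1 x) dl))
    (is_deriveZ (f2 x / 2) (is_deriveM dl dl)).
  rewrite (_ : _ - _ - _ = g); last first.
    by apply/funext => t; rewrite /g /=; rewrite !fctE /= /GRing.scale /=; ring.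
  by move=> dgy; apply: is_derive_eq; rewrite /GRing.scale /=; field.
have [c cx gE] := derive_mvt x (x + h) dg.
have -> : f (x + h) - f x - f1 x * h - f2 x * h ^+ 2 / 2 = g (x + h) - g x.
  by rewrite /g; ring.
rewrite gE addrAC subrr add0r in cx *.
have [e ex ->] := derive_mvt x c df1.
rewrite -mulrBl !normrM (_ : K * _ = K * `|h| * `|h| * `|h|); last by ring.
apply: ler_pM => //; apply: ler_pM => //.
apply: le_trans ((klipschitzP _ _).1 f2K _ _) _.
by apply: ler_wpM2l; [exact: klipschitz_ge0 f2K|exact: le_trans cx].
Qed.

Definition C2_lipschitz M f (f1 f2 : R -> R) : Prop :=
  [/\ forall x : R, is_derive x 1 f (f1 x), forall x : R, is_derive x 1 f1 (f2 x),
      forall x, `|f1 x| <= M, forall x, `|f2 x| <= M & M.-lipschitz f2].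

Lemma C2_lipschitz_le M M' f (f1 f2 : R -> R) : M <= M' ->
  C2_lipschitz M f f1 f2 -> C2_lipschitz M' f f1 f2.
Proof.
move=> MM' [df df1 f1M f2M f2L]; split => // [x|x|]; [exact: le_trans MM'..|].
exact: klipschitz_le f2L.
Qed.

Lemma C2_lipschitz_ge0 M f (f1 f2 : R -> R) : C2_lipschitz M f f1 f2 -> 0 <= M.
Proof. by case=> _ _ _ _ /klipschitz_ge0. Qed.

Lemma C2_lipschitz_continuous M f (f1 f2 : R -> R) : C2_lipschitz M f f1 f2 -> continuous f.
Proof. by case=> df _ _ _ _; exact: is_derive_continuous df. Qed.

Definition smooth f : Prop := exists f1 f2 M,
  C2_lipschitz M f f1 f2 /\ forall x, `|f x| <= M.

Lemma smooth_bounded_lipschitz f : smooth f ->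
  exists2 M, forall x, `|f x| <= M & M.-lipschitz f.
Proof.
move=> [f1 [f2 [M [[df _ f1M _ _] fM]]]]; exists M => //.
exact: derive_klipschitz f1M.
Qed.

End derivative_bounds.

Section smoothing.
Context {R : realType}.
Implicit Types (f : R -> R).
Local Notation mu := (@lebesgue_measure R).

Definition difference_quotient (h : R) f (x : R) : R := h^-1 * (f (x + h) - f x).

Lemma difference_quotient_bnd (h K : R) f : 0 < h -> K.-lipschitz f ->
  forall x, `|difference_quotient h f x| <= K.
Proof.
move=> h0 /klipschitzP fK x; rewrite normrM gtr0_norm ?invr_gt0// ler_pdivrMl// mulrC.
by rewrite (le_trans (fK _ _))// addrAC subrr add0r gtr0_norm.
Qed.

Lemma difference_quotient_klipschitz (h K : R) f : 0 < h -> K.-lipschitz f ->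
  (h^-1 * (2 * K)).-lipschitz (difference_quotient h f).
Proof.
move=> h0 /klipschitzP fK; apply/klipschitzP => x y.
rewrite /difference_quotient -mulrBr normrM gtr0_norm ?invr_gt0// -mulrA.
rewrite ler_pM2l ?invr_gt0//.
have -> : f (x + h) - f x - (f (y + h) - f y) = (f (x + h) - f (y + h)) - (f x - f y) by ring.
rewrite (le_trans (ler_normB _ _))//; have := fK (x + h) (y + h); have := fK x y.
have -> : x + h - (y + h) = x - y by ring.
lra.
Qed.

Lemma is_derive_shift (c x : R) f (f'x : R) : is_derive (x + c) 1 f f'x ->
  is_derive x 1 (fun y => f (y + c)) f'x.
Proof.
have dshift : is_derive x 1 (fun y => y + c) (1 : R).
  by have := is_deriveD (is_derive_id x (1 : R)) (is_derive_cst c x (1 : R)); rewrite addr0.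
move=> df; have := @is_derive1_comp R f (fun y => y + c) x _ _ df dshift.
by rewrite mulr1.
Qed.

Lemma is_derive_difference_quotient (h : R) f f1 : (forall x : R, is_derive x 1 f (f1 x)) ->
  forall x : R, is_derive x 1 (difference_quotient h f) (difference_quotient h f1 x).
Proof.
move=> df x; have dfh := is_derive_shift (df (x + h)).
exact: (is_deriveZ h^-1 (is_deriveB dfh (df x))).
Qed.

Definition moving_average (e : R) f (x : R) : R :=
  e^-1 * \int[mu]_(t in `[x, x + e]) f t.

Lemma continuous_integrable_itv f (a b : R) : continuous f ->
  mu.-integrable `[a, b] (EFin \o f).
Proof.
move=> cf; apply: continuous_compact_integrable; first exact: segment_compact.
exact: continuous_subspaceT.
Qed.

Lemma is_derive_moving_average (e : R) f (x : R) : 0 < e -> continuous f ->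
  is_derive x 1 (moving_average e f) (difference_quotient e f x).
Proof.
move=> e0 cf; pose a := x - 1.
pose F y := \int[mu]_(t in [set` Interval (BLeft a) (BRight y)]) f t.
have dF (y : R) : a < y -> is_derive y 1 F (f y).
  move=> ay.
  have yy1 : y < y + 1 by rewrite ltrDl.
  have [|dFy Fy] := continuous_FTC1 yy1 (continuous_integrable_itv a (y + 1) cf) _ (cf y).
    by rewrite lte_fin.
  by apply: DeriveDef; [exact: dFy|rewrite -Fy derive1E].
have ax : a < x by rewrite /a ltrBlDr ltrDl.
have FE : \forall y \near x, e^-1 * (F (y + e) - F y) = moving_average e f y.
  near=> y; congr (_ * _).
  have ay : a < y by near: y; exact: lt_nbhsr.
  rewrite /F Rintegral_itvB.
  - rewrite Rintegral_itv_obnd_cbnd//.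
    have iy := continuous_integrable_itv y (y + e) cf.
    by apply: integrableS iy => //; exact: subset_itv_oc_cc.
  - exact: continuous_integrable_itv.
  - by rewrite bnd_simp ltW.
  - by rewrite bnd_simp lerDl ltW.
apply: near_eq_is_derive FE _.
have axe : a < x + e by rewrite (lt_trans ax)// ltrDl.
have dFe := is_derive_shift (dF _ axe).
exact: (is_deriveZ e^-1 (is_deriveB dFe (dF x ax))).
Unshelve. all: by end_near. Qed.

Lemma moving_average_between (e m M : R) f : 0 < e -> continuous f -> forall x : R,
  (forall y : R, x <= y <= x + e -> m <= f y <= M) -> m <= moving_average e f x <= M.
Proof.
move=> e0 cf x mfM.
have xe : x < x + e by rewrite ltrDl.
have int_cst (c : R) : \int[mu]_(t in `[x, x + e]) c = c * e.
  rewrite Rintegral_cst//; congr (_ * _).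
  have := lebesgue_measure_itv (`[x, x + e] : interval R).
  by rewrite /= lte_fin xe => /(congr1 fine) E; apply: etrans E _; rewrite /= addrAC subrr add0r.
have intc (c : R) : mu.-integrable `[x, x + e] (EFin \o (fun=> c)).
  by apply: continuous_integrable_itv => y; exact: cvg_cst.
have intf := continuous_integrable_itv x (x + e) cf.
apply/andP; split; rewrite /moving_average mulrC.
  rewrite ler_pdivlMr// -int_cst; apply: le_Rintegral => // y /=.
  by rewrite in_itv /= => /mfM /andP[].
rewrite ler_pdivrMr// -int_cst; apply: le_Rintegral => // y /=.
by rewrite in_itv /= => /mfM /andP[].
Qed.

Lemma moving_average_near (e K : R) f : 0 < e -> K.-lipschitz f ->
  forall x, `|moving_average e f x - f x| <= K * e.
Proof.
move=> e0 fK x; have K0 := klipschitz_ge0 fK; have cf := klipschitz_continuous fK.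
rewrite ler_distl; apply: moving_average_between => // y /andP[xy ye].
rewrite -ler_distl (le_trans ((klipschitzP _ _).1 fK _ _))// ler_wpM2l//.
by rewrite ger0_norm ?subr_ge0// lerBlDl.
Qed.

Lemma moving_average_bnd (e M : R) f : 0 < e -> continuous f ->
  (forall x, `|f x| <= M) -> forall x, `|moving_average e f x| <= M.
Proof.
by move=> e0 cf fM x; rewrite ler_norml; apply: moving_average_between => // y _;
   rewrite -ler_norml.
Qed.

(* Averaging twice makes a Lipschitz function C^2 with Lipschitz second derivative. *)
Lemma smooth_moving_average2 (h K M : R) f : 0 < h -> K.-lipschitz f ->
  (forall x, `|f x| <= M) -> smooth (moving_average h (moving_average h f)).
Proof.
move=> h0 fK fM; have cf := klipschitz_continuous fK; have K0 := klipschitz_ge0 fK.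
have M0 : 0 <= M := le_trans (normr_ge0 _) (fM 0).
set g := moving_average h f; pose g1 := difference_quotient h f.
have dg (x : R) : is_derive x 1 g (g1 x) by exact: is_derive_moving_average.
have gK : K.-lipschitz g := derive_klipschitz dg (difference_quotient_bnd h0 fK).
have cg := klipschitz_continuous gK.
have g1L : (h^-1 * (2 * K)).-lipschitz g1 := difference_quotient_klipschitz h0 fK.
have g2L := difference_quotient_klipschitz h0 g1L.
exists (difference_quotient h g), (difference_quotient h g1),
  (M + K + h^-1 * (2 * K) + h^-1 * (2 * (h^-1 * (2 * K)))).
have L1_ge0 := klipschitz_ge0 g1L; have L2_ge0 := klipschitz_ge0 g2L.
split; [split|].
- by move=> x; exact: is_derive_moving_average.
- exact: is_derive_difference_quotient.
- by move=> x; apply: le_trans (difference_quotient_bnd h0 gK x) _; lra.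
- by move=> x; apply: le_trans (difference_quotient_bnd h0 g1L x) _; lra.
- by apply: klipschitz_le g2L; lra.
- move=> x; apply: le_trans (moving_average_bnd h0 cg (moving_average_bnd h0 cf fM) x) _; lra.
Qed.

Lemma klipschitz_smooth_approx f (K M e : R) : 0 < e -> K.-lipschitz f ->
  (forall x, `|f x| <= M) -> exists2 g, smooth g & forall x, `|g x - f x| <= e.
Proof.
move=> e0 fK fM; have K0 := klipschitz_ge0 fK.
pose h := e / (2 * (K + 1)).
have h0 : 0 < h by rewrite divr_gt0// mulr_gt0// ltr_wpDl.
set g := moving_average h f; exists (moving_average h g).
  exact: smooth_moving_average2 h0 fK fM.
have gK : K.-lipschitz g.
  have cf := klipschitz_continuous fK.
  apply: (derive_klipschitz (fun x => is_derive_moving_average x h0 cf)).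
  exact: difference_quotient_bnd.
move=> x; rewrite -(subrKA (g x)) (le_trans (ler_normD _ _))//.
apply: le_trans (lerD (moving_average_near h0 gK x) (moving_average_near h0 fK x)) _.
rewrite -mulr2n -mulr_natl mulrA /h mulrCA mulrA.
rewrite ler_pdivrMr ?mulr_gt0 ?ltr_wpDl//; nra.
Qed.

End smoothing.

Section inf_convolution.
Context {R : realType} (f : R -> R) (M : R).
Hypothesis fM : forall x, `|f x| <= M.

(* The largest [c]-Lipschitz function below [f]. *)
Definition inf_convolution (c x : R) : R := inf [set f y + c * `|x - y| | y in setT].

Let nonempty c x : [set f y + c * `|x - y| | y in setT] !=set0.
Proof. by exists (f x + c * `|x - x|); exists x. Qed.

Let lower_bound c x : 0 <= c -> lbound [set f y + c * `|x - y| | y in setT] (- M).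
Proof.
move=> c0 _ [y _ <-]; have := fM y; rewrite ler_norml => /andP[fMy _].
by rewrite (le_trans fMy)// lerDl mulr_ge0.
Qed.

Lemma inf_convolution_le c x y : 0 <= c -> inf_convolution c x <= f y + c * `|x - y|.
Proof. by move=> c0; apply: ge_inf; [exists (- M); exact: lower_bound|exists y]. Qed.

Lemma inf_convolution_le_id c x : 0 <= c -> inf_convolution c x <= f x.
Proof.
by move=> c0; apply: le_trans (inf_convolution_le x x c0) _; rewrite subrr normr0 mulr0 addr0.
Qed.

Lemma inf_convolution_bnd c x : 0 <= c -> `|inf_convolution c x| <= M.
Proof.
move=> c0; rewrite ler_norml; apply/andP; split.
  by apply: lb_le_inf => //; exact: lower_bound.
by apply: le_trans (inf_convolution_le_id x c0) _; exact: le_trans (ler_norm _) (fM x).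
Qed.

Lemma inf_convolution_klipschitz c : 0 <= c -> c.-lipschitz (inf_convolution c).
Proof.
move=> c0; have half x y : inf_convolution c x - c * `|x - y| <= inf_convolution c y.
  apply: lb_le_inf => // _ [t _ <-]; rewrite lerBlDr.
  apply: le_trans (inf_convolution_le x t c0) _.
  rewrite -addrA lerD2l -mulrDr ler_wpM2l// (le_trans _ (ler_normD _ _))//.
  by rewrite [leRHS](_ : _ = `|x - t|)//; congr (`|_|); ring.
apply/klipschitzP => x y; rewrite ler_norml.
by have := half x y; have := half y x; rewrite distrC; lra.
Qed.

Lemma inf_convolution_cvg : continuous f ->
  forall x, inf_convolution j%:R x @[j --> \oo] --> f x.
Proof.
move=> cf x; apply/cvgrPdist_le => a a0.
have /cvgrPdist_lt /(_ a a0) := cf x.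
rewrite -nbhs_ballE => -[r /= r0 ball_r].
near=> j; rewrite ger0_norm ?subr_ge0 ?inf_convolution_le_id// lerBlDr -lerBlDl.
apply: lb_le_inf => // _ [y _ <-].
have [xy|xy] := ltP `|x - y| r.
  have := ball_r y xy; rewrite ltr_norml => /andP[_ fxy].
  have : 0 <= j%:R * `|x - y| by rewrite mulr_ge0.
  lra.
have : 2 * M <= j%:R * r.
  by rewrite -ler_pdivrMr//; near: j; exact: nbhs_infty_ger.
have : j%:R * r <= j%:R * `|x - y| by rewrite ler_wpM2l.
have := fM x; have := fM y; rewrite !ler_norml; lra.
Unshelve. all: by end_near. Qed.

End inf_convolution.

Section continuous_functionals.
Context {d : measure_display} {O : measurableType d} {R : realType} (P : probability O R)
  (Y : O -> R).
Hypothesis mY : measurable_fun setT Y.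

Lemma measurable_continuous_comp (f : R -> R) : continuous f ->
  measurable_fun setT (fun w => f (Y w)).
Proof. by move=> cf; apply: measurableT_comp => //; exact: continuous_measurable. Qed.

Lemma L1_continuous_comp (f : R -> R) (M : R) : continuous f -> (forall x, `|f x| <= M) ->
  L1 P (fun w => f (Y w)).
Proof. by move=> cf fM; apply: (L1_bnd P (M := M)) => //; exact: measurable_continuous_comp. Qed.

Lemma Ex_klipschitz_diff (f : R -> R) (M : R) (Y' : O -> R) : (forall x, `|f x| <= M) ->
  M.-lipschitz f -> measurable_fun setT Y' -> L1 P (fun w => Y w - Y' w) ->
  `|Ex P (fun w => f (Y w)) - Ex P (fun w => f (Y' w))| <= M * Ex P (fun w => `|Y w - Y' w|).
Proof.
move=> fM fL mY' LYY'; have cf := klipschitz_continuous fL.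
have LfY : L1 P (fun w => f (Y w)) by exact: L1_continuous_comp fM.
have LfY' : L1 P (fun w => f (Y' w)).
  by apply: (L1_bnd P (M := M)) => //; apply: measurableT_comp => //; exact: continuous_measurable.
rewrite -ExB//; apply: le_trans (normr_Ex (L1B LfY LfY')) _.
rewrite -ExZ; last exact: L1_norm.
apply: le_Ex => [||w]; [by apply: L1_norm; exact: L1B|by apply: L1Z; exact: L1_norm|].
exact: (klipschitzP _ _).1.
Qed.

End continuous_functionals.

Section portmanteau.
Context {d d' : measure_display} {O : measurableType d} {O' : measurableType d'}
  {R : realType} (P : probability O R) (P' : probability O' R)
  (Y : nat -> O -> R) (Z : O' -> R).
Hypothesis mY : forall k, measurable_fun setT (Y k).
Hypothesis mZ : measurable_fun setT Z.

Section lipschitz_test_functions.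
Hypothesis cvg_lipschitz : forall (f : R -> R) (K M : R), K.-lipschitz f ->
  (forall x, `|f x| <= M) -> Ex P (fun w => f (Y k w)) @[k --> \oo] --> Ex P' (fun w => f (Z w)).

Let lower_semicontinuity (f : R -> R) (M : R) : continuous f -> (forall x, `|f x| <= M) ->
  forall e : R, 0 < e ->
    \forall k \near \oo, Ex P' (fun w => f (Z w)) - e <= Ex P (fun w => f (Y k w)).
Proof.
move=> cf fM e e0; pose g (j : nat) := inf_convolution f j%:R.
have gK j : j%:R.-lipschitz (g j) by exact: (inf_convolution_klipschitz fM (ler0n R j)).
have gM j x : `|g j x| <= M by exact: inf_convolution_bnd.
have cg j : continuous (g j) by exact: klipschitz_continuous (gK j).
have cvg_g : Ex P' (fun w => g j (Z w)) @[j --> \oo] --> Ex P' (fun w => f (Z w)).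
  apply: (Ex_dct (g := fun=> M)) => //.
  - by move=> j; exact: measurable_continuous_comp.
  - exact: measurable_continuous_comp.
  - exact: L1_cst.
  - by apply: aeW => w; exact: inf_convolution_cvg fM cf _.
have e20 : 0 < e / 2 by rewrite divr_gt0.
have /cvgrPdist_le /(_ _ e20) [j _ /(_ j (leqnn j)) gj_near] := cvg_g.
have /cvgrPdist_le /(_ _ e20) := cvg_lipschitz (gK j) (gM j).
apply: filterS => k cvg_gj.
apply: (@le_trans _ _ (Ex P (fun w => g j (Y k w)))); last first.
  apply: le_Ex => [||w]; last exact: inf_convolution_le_id fM _ _ _.
    exact: (L1_continuous_comp P (mY k) (cg j) (gM j)).
  exact: (L1_continuous_comp P (mY k) cf fM).
move: gj_near cvg_gj; rewrite !ler_norml; lra.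
Qed.

Lemma cvg_in_dist_lipschitz : cvg_in_dist P Y P' Z.
Proof.
move=> f cf [M fM].
change (Ex P (fun w => f (Y k w)) @[k --> \oo] --> Ex P' (fun w => f (Z w))).
apply/cvgrPdist_le => e e0.
have cNf : continuous (fun x => - f x) by move=> x; apply: cvgN; exact: cf.
have NfM x : `|- f x| <= M by rewrite normrN.
have := lower_semicontinuity cf fM e0; have := lower_semicontinuity cNf NfM e0.
apply: filterS2 => k lowerN lower; rewrite ler_norml.
have ExN dT (T : measurableType dT) (Q : probability T R) (V : T -> R) :
    measurable_fun setT V -> Ex Q (fun w => - f (V w)) = - Ex Q (fun w => f (V w)).
  move=> mV; rewrite -mulN1r -ExZ; first by apply: eq_Ex => w; rewrite mulN1r.
  exact: (L1_continuous_comp Q mV cf fM).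
move: lowerN lower; rewrite !ExN//; lra.
Qed.

End lipschitz_test_functions.

Lemma cvg_in_dist_smooth :
  (forall f : R -> R, smooth f ->
     Ex P (fun w => f (Y k w)) @[k --> \oo] --> Ex P' (fun w => f (Z w))) ->
  cvg_in_dist P Y P' Z.
Proof.
move=> cvg_smooth; apply: cvg_in_dist_lipschitz => f K M fK fM.
have cf := klipschitz_continuous fK.
apply/cvgrPdist_le => e e0.
have e30 : 0 < e / 3 by rewrite divr_gt0.
have [g sg gf] := klipschitz_smooth_approx e30 fK fM.
have [N gN gL] := smooth_bounded_lipschitz sg.
have cg := klipschitz_continuous gL.
have close dT (T : measurableType dT) (Q : probability T R) (V : T -> R) :
    measurable_fun setT V -> `|Ex Q (fun w => g (V w)) - Ex Q (fun w => f (V w))| <= e / 3.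
  move=> mV; apply: Ex_dist_le => //; first exact: (L1_continuous_comp Q mV cg gN).
  exact: (L1_continuous_comp Q mV cf fM).
have /cvgrPdist_le /(_ _ e30) := cvg_smooth g sg.
apply: filterS => k; have := close _ _ P _ (mY k); have := close _ _ P' _ mZ.
rewrite !ler_norml; lra.
Qed.

End portmanteau.

(** * Lindeberg's replacement argument *)

Lemma cvg_invsqrtn (R : realType) : (Num.sqrt n%:R)^-1 @[n --> \oo] --> (0 : R).
Proof.
apply/cvgrPdist_le => e e0; near=> n.
have en : e^-1 <= Num.sqrt n%:R.
  have e'0 : 0 <= e^-1 by rewrite invr_ge0 ltW.
  rewrite -(ger0_norm e'0) -sqrtr_sqr ler_wsqrtr//.
  by near: n; exact: nbhs_infty_ger.
have s0 : 0 < Num.sqrt n%:R :> R by apply: lt_le_trans en; rewrite invr_gt0.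
by rewrite sub0r normrN ger0_norm ?invr_ge0// -[e]invrK lef_pV2// posrE invr_gt0.
Unshelve. all: by end_near. Qed.

Section test_functionals.
Context {R : realType} {I : finType}.
Implicit Types (phi : (I -> R) -> R) (r v : I -> R).

Definition norm1 v : R := \sum_i `|v i|.

Lemma norm1_ge0 v : 0 <= norm1 v.
Proof. exact: sumr_ge0. Qed.

Lemma norm1Z (c : R) v : norm1 (fun i => c * v i) = `|c| * norm1 v.
Proof. by rewrite /norm1 mulr_sumr; apply: eq_bigr => i _; rewrite normrM. Qed.

Lemma sum_norm_expn_le v n : \sum_i `|v i| ^+ n.+1 <= norm1 v ^+ n.+1.
Proof.
have v_le i : `|v i| <= norm1 v by rewrite /norm1 (bigD1 i)//= lerDl sumr_ge0.
rewrite [leRHS]exprS [X in X * _]/norm1 mulr_suml; apply: ler_sum => i _.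
by rewrite exprS ler_wpM2l// lerXn2r// nnegrE norm1_ge0.
Qed.

Definition taylor2_functional (C : R) phi : Prop :=
  exists (grad : (I -> R) -> I -> R) (hess : (I -> R) -> I -> I -> R), forall r v,
  `|phi (fun i => r i + v i) - phi r - \sum_i grad r i * v i -
    \sum_i \sum_j hess r i j * (v i * v j)| <=
  C * Num.min (norm1 v ^+ 2) (norm1 v ^+ 3).

Definition bounded_test (M : R) phi : Prop :=
  finitary (enum I) phi /\ forall r, `|phi r| <= M.

Lemma finitary_enum phi :
  (forall (d : measure_display) (T : measurableType d) (Y : I -> T -> R),
     (forall i, measurable_fun setT (Y i)) -> measurable_fun setT (fun w => phi (Y ^~ w))) ->
  finitary (enum I) phi.
Proof.
move=> mphi; split => // r r' rr'; congr phi; apply/funext => i.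
by apply: rr'; rewrite mem_enum.
Qed.

Lemma L1_bounded_test (M : R) phi (d : measure_display) (T : measurableType d)
    (Q : probability T R) (Y : I -> T -> R) : bounded_test M phi ->
  (forall i, measurable_fun setT (Y i)) -> L1 Q (fun w => phi (Y ^~ w)).
Proof.
move=> [finphi phiM] mY; apply: (L1_bnd Q (M := M)) => // .
exact: measurable_finitary finphi mY.
Qed.

End test_functionals.

Section taylor_of_composition.
Context {R : realType} (f f1 f2 : R -> R) (M : R).
Hypothesis fC2 : C2_lipschitz M f f1 f2.
(* [D] is the increment of the inner function, [a] and [b] are its terms of order
   one and two, and [N] is the size of the displacement. *)
Variables (t D a b N : R).
Hypothesis N_ge0 : 0 <= N.
Hypothesis D_le : `|D| <= M * N.
Hypothesis a_le : `|a| <= M * N.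
Hypothesis b_le : `|b| <= M * N ^+ 2.
Hypothesis Da_le : `|D - a| <= M * N ^+ 2.
Hypothesis Dab_le : `|D - a - b| <= M * N ^+ 3.

Let M_ge0 : 0 <= M := C2_lipschitz_ge0 fC2.

Let f1_le : `|f1 t| <= M. Proof. by case: fC2. Qed.

Let f2_le : `|f2 t| <= M. Proof. by case: fC2. Qed.

Let norm_half (x : R) : `|x / 2| <= `|x|.
Proof. rewrite normrM [`|2^-1|]ger0_norm ?invr_ge0//; have := normr_ge0 x; lra. Qed.

Lemma taylor_comp_quad :
  `|f (t + D) - f t - f1 t * a - (f1 t * b + f2 t * a ^+ 2 / 2)| <=
  (2 * M ^+ 3 + 2 * M ^+ 2) * N ^+ 2.
Proof.
have [df df1 _ f2M _] := fC2.
have -> : f (t + D) - f t - f1 t * a - (f1 t * b + f2 t * a ^+ 2 / 2) =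
    (f (t + D) - f t - f1 t * D) + f1 t * (D - a) - f1 t * b - f2 t * a ^+ 2 / 2 by ring.
have sqr_le x : `|x| <= M * N -> x ^+ 2 <= (M * N) ^+ 2.
  by move=> xMN; rewrite -(real_normK (num_real x)) lerXn2r// nnegrE mulr_ge0.
have outer_le : `|f (t + D) - f t - f1 t * D| <= M * (M * N) ^+ 2.
  by apply: le_trans (taylor2_quad df df1 f2M t D) _; rewrite ler_wpM2l ?sqr_le.
have linear_le : `|f1 t * (D - a)| <= M * (M * N ^+ 2) by rewrite normrM ler_pM.
have inner_le : `|f1 t * b| <= M * (M * N ^+ 2) by rewrite normrM ler_pM.
have square_le : `|f2 t * a ^+ 2 / 2| <= M * (M * N) ^+ 2.
  by apply: le_trans (norm_half _) _; rewrite normrM ler_pM// ger0_norm ?sqr_ge0 ?sqr_le.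
have -> : (2 * M ^+ 3 + 2 * M ^+ 2) * N ^+ 2 =
    M * (M * N) ^+ 2 + M * (M * N ^+ 2) + M * (M * N ^+ 2) + M * (M * N) ^+ 2 by ring.
apply: le_trans (ler_normB _ _) _; apply: lerD => //.
apply: le_trans (ler_normB _ _) _; apply: lerD => //.
by apply: le_trans (ler_normD _ _) _; apply: lerD.
Qed.

Lemma taylor_comp_cubic :
  `|f (t + D) - f t - f1 t * a - (f1 t * b + f2 t * a ^+ 2 / 2)| <=
  (M ^+ 4 + 2 * M ^+ 3 + M ^+ 2) * N ^+ 3.
Proof.
have [df df1 _ _ f2L] := fC2.
have -> : f (t + D) - f t - f1 t * a - (f1 t * b + f2 t * a ^+ 2 / 2) =
    (f (t + D) - f t - f1 t * D - f2 t * D ^+ 2 / 2) + f1 t * (D - a - b) +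
    f2 t * ((D - a) * (D + a)) / 2 by field.
have outer_le : `|f (t + D) - f t - f1 t * D - f2 t * D ^+ 2 / 2| <= M * (M * N) ^+ 3.
  apply: le_trans (taylor2_cubic df df1 f2L t D) _.
  by rewrite ler_wpM2l// lerXn2r// nnegrE mulr_ge0.
have inner_le : `|f1 t * (D - a - b)| <= M * (M * N ^+ 3) by rewrite normrM ler_pM.
have square_le : `|f2 t * ((D - a) * (D + a)) / 2| <= M * (M * N ^+ 2 * (M * N + M * N)).
  apply: le_trans (norm_half _) _; rewrite !normrM ler_pM ?mulr_ge0// ler_pM//.
  by apply: le_trans (ler_normD _ _) _; apply: lerD.
have -> : (M ^+ 4 + 2 * M ^+ 3 + M ^+ 2) * N ^+ 3 =
    M * (M * N) ^+ 3 + M * (M * N ^+ 3) + M * (M * N ^+ 2 * (M * N + M * N)) by ring.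
apply: le_trans (ler_normD _ _) _; apply: lerD => //.
by apply: le_trans (ler_normD _ _) _; apply: lerD.
Qed.

End taylor_of_composition.

Section additive_test_functions.
Context {R : realType} {I : finType} (M : R).
Variables (f f1 f2 : R -> R) (theta theta1 theta2 : I -> R -> R).
Hypothesis fC2 : C2_lipschitz M f f1 f2.
Hypothesis thetaC2 : forall i, C2_lipschitz M (theta i) (theta1 i) (theta2 i).

Definition additive_test (r : I -> R) : R := f (\sum_i theta i (r i)).

Let inner (r : I -> R) : R := \sum_i theta i (r i).

Let grad (r : I -> R) (i : I) : R := f1 (inner r) * theta1 i (r i).

Let hess (r : I -> R) (i j : I) : R :=
  (if i == j then f1 (inner r) * theta2 i (r i) / 2 else 0) +
  f2 (inner r) / 2 * (theta1 i (r i) * theta1 j (r j)).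

Let hess_sum (r v : I -> R) : \sum_i \sum_j hess r i j * (v i * v j) =
  f1 (inner r) * (\sum_i theta2 i (r i) * v i ^+ 2 / 2) +
  f2 (inner r) * (\sum_i theta1 i (r i) * v i) ^+ 2 / 2.
Proof.
set t := inner r.
rewrite mulr_sumr expr2 mulr_suml mulr_sumr mulr_suml -big_split /=.
apply: eq_bigr => i _; rewrite mulr_sumr mulr_sumr mulr_suml.
rewrite (eq_bigr (fun j => (if i == j then f1 t * theta2 i (r i) / 2 * v i ^+ 2 else 0) +
   f2 t * (theta1 i (r i) * v i * (theta1 j (r j) * v j)) / 2)).
  rewrite big_split /=; congr (_ + _).
  by rewrite -big_mkcond (big_pred1 i)/=; [ring|move=> j; rewrite eq_sym].
by move=> j _; rewrite /hess -/t; case: eqP => [<-|_]; ring.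
Qed.

Let M_ge0 : 0 <= M := C2_lipschitz_ge0 fC2.

Let sum_le (g v : I -> R) n : (forall i, `|g i| <= M * `|v i| ^+ n.+1) ->
  `|\sum_i g i| <= M * norm1 v ^+ n.+1.
Proof.
move=> gM; apply: le_trans (ler_norm_sum _ _ _) _.
apply: le_trans (_ : \sum_i M * `|v i| ^+ n.+1 <= _); first exact: ler_sum.
by rewrite -mulr_sumr ler_wpM2l// sum_norm_expn_le.
Qed.

Lemma taylor2_additive_test :
  taylor2_functional (M ^+ 4 + 2 * M ^+ 3 + 2 * M ^+ 2) additive_test.
Proof.
exists grad, hess => r v; rewrite hess_sum.
set t := inner r; set N := norm1 v; have N_ge0 : 0 <= N := norm1_ge0 v.
pose D := \sum_i (theta i (r i + v i) - theta i (r i)).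
pose a := \sum_i theta1 i (r i) * v i.
pose b := \sum_i theta2 i (r i) * v i ^+ 2 / 2.
have tD : inner (fun i => r i + v i) = t + D.
  by rewrite /D /t -big_split/=; apply: eq_bigr => i _; ring.
have gradE : \sum_i grad r i * v i = f1 t * a.
  by rewrite /a mulr_sumr; apply: eq_bigr => i _; rewrite /grad mulrA.
rewrite /additive_test -/(inner _) tD gradE -/t -/a -/b.
have D_le : `|D| <= M * N.
  apply: (sum_le (n := 0)) => i; have [dti _ t1M _ _] := thetaC2 i.
  have := (klipschitzP _ _).1 (derive_klipschitz dti t1M) (r i + v i) (r i).
  by rewrite addrAC subrr add0r expr1.
have a_le : `|a| <= M * N.
  by apply: (sum_le (n := 0)) => i; have [_ _ ? _ _] := thetaC2 i; rewrite expr1 normrM ler_wpM2r.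
have b_le : `|b| <= M * N ^+ 2.
  apply: (sum_le (n := 1)) => i; have [_ _ _ t2M _] := thetaC2 i.
  rewrite normrM normrM normrX [`|2^-1|]ger0_norm ?invr_ge0//.
  have := normr_ge0 (theta2 i (r i)); have := t2M (r i); have := sqr_ge0 `|v i|; nra.
have Da_le : `|D - a| <= M * N ^+ 2.
  rewrite /D /a -sumrB; apply: (sum_le (n := 1)) => i; have [dti dt1 _ t2M _] := thetaC2 i.
  by rewrite real_normK ?num_real//; exact: (taylor2_quad dti dt1 t2M).
have Dab_le : `|D - a - b| <= M * N ^+ 3.
  rewrite /D /a /b -!sumrB; apply: (sum_le (n := 2)) => i; have [dti dt1 _ _ t2L] := thetaC2 i.
  exact: (taylor2_cubic dti dt1 t2L).
have Mn n : 0 <= M ^+ n by exact: exprn_ge0.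
have := Mn 4; have := Mn 3; have := Mn 2; rewrite minEle; case: ifP => _ M2 M3 M4.
  apply: le_trans (taylor_comp_quad fC2 t N_ge0 D_le a_le b_le Da_le) _.
  by rewrite ler_wpM2r ?exprn_ge0//; lra.
apply: le_trans (taylor_comp_cubic fC2 t N_ge0 D_le a_le Da_le Dab_le) _.
by rewrite ler_wpM2r ?exprn_ge0//; lra.
Qed.

Lemma bounded_additive_test (K : R) : (forall x, `|f x| <= K) -> bounded_test K additive_test.
Proof.
move=> fK; split; last by move=> r; exact: fK.
apply: finitary_enum => d T Y mY; apply: measurableT_comp.
  exact: continuous_measurable (C2_lipschitz_continuous fC2).
apply: measurable_sum => i; apply: measurableT_comp (mY i).
exact: continuous_measurable (C2_lipschitz_continuous (thetaC2 i)).
Qed.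

End additive_test_functions.

(* Replacing the summands one at a time is carried out with the operators
   [phi |-> E phi (. + U)], which commute and do not expand the sup norm. *)
Section smearing.
Context {R : realType} {I : finType}.
Implicit Types (phi psi : (I -> R) -> R) (r : I -> R).

Definition smear {d} {T : measurableType d} (Q : probability T R) (U : I -> T -> R)
  phi r : R := Ex Q (fun w => phi (fun i => r i + U i w)).

Section one_law.
Context {d : measure_display} {T : measurableType d} (Q : probability T R) (U : I -> T -> R).
Hypothesis mU : forall i, measurable_fun setT (U i).

Let L1_shift (M : R) phi r : bounded_test M phi ->
  L1 Q (fun w => phi (fun i => r i + U i w)).
Proof. by move=> phiM; apply: L1_bounded_test phiM _ => i; exact: measurable_funD. Qed.

Lemma bounded_smear (M : R) phi : bounded_test M phi -> bounded_test M (smear Q U phi).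
Proof.
move=> phiM; have [finphi phi_le] := phiM; split; last first.
  by move=> r; apply: normr_Ex_le => //; exact: L1_shift phiM.
apply: finitary_enum => d' T' Y mY.
apply: (measurable_Ex_slice Q (f := fun z => phi (fun i => Y i z.1 + U i z.2))).
apply: (measurable_finitary (Y := fun i z => Y i z.1 + U i z.2) finphi) => i.
by apply: measurable_funD; [exact: (measurableT_comp (mY i))|exact: (measurableT_comp (mU i))].
Qed.

Lemma smear_dist_le (M D : R) phi psi : bounded_test M phi -> bounded_test M psi ->
  (forall r, `|phi r - psi r| <= D) -> forall r, `|smear Q U phi r - smear Q U psi r| <= D.
Proof.
move=> phiM psiM phipsi r; apply: Ex_dist_le => //.
  exact: L1_shift phiM.
exact: L1_shift psiM.
Qed.

End one_law.

Section two_laws.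
Context {d d' : measure_display} {T : measurableType d} {T' : measurableType d'}
  (Q : probability T R) (Q' : probability T' R) (U : I -> T -> R) (V : I -> T' -> R).
Hypothesis mU : forall i, measurable_fun setT (U i).
Hypothesis mV : forall i, measurable_fun setT (V i).

Let L1_two_shifts (M : R) phi r : bounded_test M phi ->
  L1 (Q \x Q')%E (fun z => phi (fun i => r i + (U i z.1 + V i z.2))).
Proof.
move=> phiM; apply: (L1_bounded_test (Y := fun i z => r i + (U i z.1 + V i z.2)) _ phiM) => i.
apply: measurable_funD => //; apply: measurable_funD.
  exact: (measurableT_comp (mU i)).
exact: (measurableT_comp (mV i)).
Qed.

Lemma smear_smear (M : R) phi r : bounded_test M phi ->
  smear Q U (smear Q' V phi) r =
  Ex (Q \x Q')%E (fun z => phi (fun i => r i + (U i z.1 + V i z.2))).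
Proof.
move=> phiM; rewrite (Ex_fubini (L1_two_shifts r phiM)).
by apply: eq_Ex => w; apply: eq_Ex => w'; congr phi; apply/funext => i; rewrite addrA.
Qed.

Lemma smear_comm (M : R) phi r : bounded_test M phi ->
  smear Q U (smear Q' V phi) r = smear Q' V (smear Q U phi) r.
Proof.
move=> phiM; rewrite (smear_smear r phiM) (Ex_fubini2 (L1_two_shifts r phiM)).
apply: eq_Ex => w'; apply: eq_Ex => w; congr phi; apply/funext => i /=.
by rewrite addrA addrAC.
Qed.

End two_laws.

End smearing.

Section stable_families.
Context {R : realType} {I : finType} {d : measure_display} {O : measurableType d}
  (P : probability O R) (W : I -> O -> R).
Hypothesis mW : forall i, measurable_fun setT (W i).

(* Independent copies [W], [W'] satisfy [a W + b W' ~ sqrt (a^2 + b^2) W] as families. *)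
Definition stable_family : Prop := forall a b : R, 0 <= a -> 0 <= b ->
  same_law (P \x P)%E P (fun i z => a * W i z.1 + b * W i z.2)
    (fun i w => Num.sqrt (a ^+ 2 + b ^+ 2) * W i w) (enum I).

Lemma smear_stable (a b M : R) (phi : (I -> R) -> R) r : stable_family ->
  0 <= a -> 0 <= b -> bounded_test M phi ->
  smear P (fun i w => a * W i w) (smear P (fun i w => b * W i w) phi) r =
  smear P (fun i w => Num.sqrt (a ^+ 2 + b ^+ 2) * W i w) phi r.
Proof.
move=> sW a0 b0 phiM; have mcW (c : R) i : measurable_fun setT (fun w => c * W i w).
  exact: measurable_funM.
rewrite (smear_smear P P (mcW a) (mcW b) r phiM).
have finphi : finitary (enum I) (fun y : I -> R => phi (fun i => r i + y i)).
  apply: finitary_enum => d' T Y mY.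
  apply: (measurable_finitary (Y := fun i w => r i + Y i w) phiM.1) => i.
  exact: measurable_funD.
rewrite -(undup_id (enum_uniq I)) in finphi *.
apply: (same_law_Ex _ (mcW _) _ finphi) => [i|]; last first.
  by rewrite !undup_id ?enum_uniq//; exact: sW.
by apply: measurable_funD; [exact: (measurableT_comp (mcW a i))|exact: (measurableT_comp (mcW b i))].
Qed.

End stable_families.

Section one_replacement.
Context {R : realType} {I : finType}.
Implicit Types (phi : (I -> R) -> R) (r : I -> R) (c : R).

Definition taylor_remainder {d} {T : measurableType d} (Q : probability T R)
    (U : I -> T -> R) c : R :=
  Ex Q (fun w => Num.min ((c * norm1 (U ^~ w)) ^+ 2) ((c * norm1 (U ^~ w)) ^+ 3)).

Section one_law.
Context {d : measure_display} {T : measurableType d} (Q : probability T R) (U : I -> T -> R).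
Hypothesis L2U : forall i, L2 Q (U i).

Let L2_norm1 : L2 Q (fun w => norm1 (U ^~ w)).
Proof. by apply: L2_sum => i _; exact: L2_norm. Qed.

Lemma L1_taylor_remainder c : 0 <= c ->
  L1 Q (fun w => Num.min ((c * norm1 (U ^~ w)) ^+ 2) ((c * norm1 (U ^~ w)) ^+ 3)).
Proof.
move=> c0; have [mcN LcN2] := L2Z c L2_norm1.
apply: L1_dom LcN2 => [|w].
  by apply: measurable_minr; exact: measurable_funX.
have cN_ge0 : 0 <= c * norm1 (U ^~ w) by rewrite mulr_ge0// norm1_ge0.
by rewrite ger0_norm ?ge_min ?lexx// le_min !exprn_ge0.
Qed.

Lemma Ex_quadratic_form (g : I -> R) (h : I -> I -> R) c : (forall i, Ex Q (U i) = 0) ->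
  let q w := \sum_i g i * (c * U i w) + \sum_i \sum_j h i j * (c * U i w * (c * U j w)) in
  L1 Q q /\ Ex Q q = c ^+ 2 * \sum_i \sum_j h i j * Ex Q (fun w => U i w * U j w).
Proof.
move=> EU q; have LU i := L2_L1 (L2U i).
have LUU i j : L1 Q (fun w => c * U i w * (c * U j w)) by apply: L2M; exact: L2Z.
have Llin : L1 Q (fun w => \sum_i g i * (c * U i w)).
  by apply: L1_sum => i _; apply: L1Z; exact: L1Z.
have Lquad i : L1 Q (fun w => \sum_j h i j * (c * U i w * (c * U j w))).
  by apply: L1_sum => j _; exact: L1Z.
split; first by apply: L1D => //; exact: L1_sum.
rewrite ExD//; last exact: L1_sum.
rewrite Ex_sum => [|i _]; last by apply: L1Z; exact: L1Z.
rewrite big1 ?add0r => [|i _]; last by rewrite !ExZ ?EU ?mulr0//; exact: L1Z.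
rewrite Ex_sum// mulr_sumr; apply: eq_bigr => i _.
rewrite Ex_sum => [|j _]; last exact: L1Z.
rewrite mulr_sumr; apply: eq_bigr => j _.
rewrite ExZ// mulrCA -[in RHS]ExZ; last exact: L2M.
by congr (_ * _); apply: eq_Ex => w; ring.
Qed.

Lemma taylor_smear (C c M : R) phi
    (grad : (I -> R) -> I -> R) (hess : (I -> R) -> I -> I -> R) r :
  0 <= c -> bounded_test M phi -> (forall i, Ex Q (U i) = 0) ->
  (forall r v, `|phi (fun i => r i + v i) - phi r - \sum_i grad r i * v i -
      \sum_i \sum_j hess r i j * (v i * v j)| <=
    C * Num.min (norm1 v ^+ 2) (norm1 v ^+ 3)) ->
  `|smear Q (fun i w => c * U i w) phi r - phi r -
    c ^+ 2 * \sum_i \sum_j hess r i j * Ex Q (fun w => U i w * U j w)|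
  <= C * taylor_remainder Q U c.
Proof.
move=> c0 phiM EU taylor.
have [Lq <-] := Ex_quadratic_form (grad r) (hess r) c EU; set q := (fun w => _ + _) in Lq *.
have Lphi : L1 Q (fun w => phi (fun i => r i + c * U i w)).
  apply: (L1_bounded_test (Y := fun i w => r i + c * U i w) _ phiM) => i.
  by apply: measurable_funD => //; apply: measurable_funM => //; exact: L2_measurable.
rewrite -(Ex_cst Q (phi r)) -ExB//; last exact: L1_cst.
have Lrem := L1_taylor_remainder c0.
rewrite -ExB//; last by apply: L1B => //; exact: L1_cst.
rewrite -ExZ//; apply: le_trans (normr_Ex _) _.
  by apply: L1B => //; apply: L1B => //; exact: L1_cst.
apply: le_Ex => [||w].
- by apply: L1_norm; apply: L1B => //; apply: L1B => //; exact: L1_cst.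
- exact: L1Z.
- have := taylor r (fun i => c * U i w); rewrite norm1Z (ger0_norm c0).
  by rewrite /q opprD addrA.
Qed.

Lemma taylor_remainder_cvg :
  n%:R * taylor_remainder Q U (Num.sqrt n%:R)^-1 @[n --> \oo] --> (0 : R).
Proof.
pose c n : R := (Num.sqrt n%:R)^-1; pose N w := norm1 (U ^~ w).
pose g n w := n%:R * Num.min ((c n * N w) ^+ 2) ((c n * N w) ^+ 3).
have c_ge0 n : 0 <= c n by rewrite invr_ge0.
rewrite (_ : (fun n => _) = (fun n => Ex Q (g n))); last first.
  by apply/funext => n; rewrite ExZ//; exact: (L1_taylor_remainder (c_ge0 n)).
have N_ge0 w : 0 <= N w := norm1_ge0 _.
have g_ge0 n w : 0 <= g n w by rewrite mulr_ge0// le_min !exprn_ge0// mulr_ge0.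
have nc2 n : n != 0%N -> n%:R * c n ^+ 2 = 1.
  by move=> n0; rewrite exprVn sqr_sqrtr// divff// pnatr_eq0.
rewrite -[X in _ --> X](Ex_cst Q 0); apply: (Ex_dct (g := fun w => N w ^+ 2)) => //.
- move=> n; apply: measurable_funM => //; apply: measurable_minr; apply: measurable_funX;
  by apply: measurable_funM => //; exact: L2_measurable L2_norm1.
- exact: L2_norm1.2.
- move=> n w; rewrite ger0_norm//.
  have [->|n0] := eqVneq n 0%N; first by rewrite /g mul0r sqr_ge0.
  apply: (@le_trans _ _ (n%:R * (c n * N w) ^+ 2)); first by rewrite ler_wpM2l// ge_min lexx.
  by rewrite exprMn mulrA nc2// mul1r.
apply: aeW => w; apply: (@squeeze_cvgr _ _ _ _ (fun=> 0) (fun n => c n * N w ^+ 3)).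
- near=> n; have n0 : n != 0%N by rewrite -lt0n; near: n; exact: nbhs_infty_gt.
  rewrite g_ge0/=; apply: (@le_trans _ _ (n%:R * (c n * N w) ^+ 3)).
    by rewrite ler_wpM2l// ge_min lexx orbT.
  rewrite [leLHS](_ : _ = n%:R * c n ^+ 2 * (c n * N w ^+ 3)); last by ring.
  by rewrite nc2// mul1r.
- exact: cvg_cst.
- rewrite -[X in _ --> X](mul0r (N w ^+ 3)); apply: cvgM; last exact: cvg_cst.
  exact: cvg_invsqrtn.
Unshelve. all: by end_near. Qed.

End one_law.

Context {d d' : measure_display} {O : measurableType d} {O' : measurableType d'}
  (P : probability O R) (P' : probability O' R) (V : I -> O -> R) (W : I -> O' -> R).
Hypothesis L2V : forall i, L2 P (V i).
Hypothesis L2W : forall i, L2 P' (W i).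
Hypothesis EV : forall i, Ex P (V i) = 0.
Hypothesis EW : forall i, Ex P' (W i) = 0.
Hypothesis covVW : forall i j,
  Ex P (fun w => V i w * V j w) = Ex P' (fun w => W i w * W j w).

Definition replacement_error (C c : R) : R :=
  C * (taylor_remainder P V c + taylor_remainder P' W c).

Lemma one_replacement (C M : R) phi c r :
  taylor2_functional C phi -> bounded_test M phi -> 0 <= c ->
  `|smear P (fun i w => c * V i w) phi r - smear P' (fun i w => c * W i w) phi r| <=
  replacement_error C c.
Proof.
move=> [grad [hess taylor]] phiM c0.
have := taylor_smear L2V r c0 phiM EV taylor.
have := taylor_smear L2W r c0 phiM EW taylor.
under [in X in _ -> X -> _]eq_bigr do under eq_bigr do rewrite covVW.
by rewrite /replacement_error mulrDr !ler_norml; lra.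
Qed.

Lemma replacement_error_cvg (C : R) :
  n%:R * replacement_error C (Num.sqrt n%:R)^-1 @[n --> \oo] --> (0 : R).
Proof.
rewrite (_ : (fun n => _) = (fun n => C * (n%:R * taylor_remainder P V (Num.sqrt n%:R)^-1 +
   n%:R * taylor_remainder P' W (Num.sqrt n%:R)^-1))); last first.
  by apply/funext => n; rewrite /replacement_error; ring.
rewrite -[X in _ --> X](mulr0 C); apply: cvgM; first exact: cvg_cst.
by rewrite -[X in _ --> X]addr0; apply: cvgD; exact: taylor_remainder_cvg.
Qed.

End one_replacement.

Section central_limit.
Context {R : realType} {I : finType} {d d' dS : measure_display} {O : measurableType d}
  {O' : measurableType d'} {S : measurableType dS}
  (P : probability O R) (P' : probability O' R) (F : probability S R)
  (X : nat -> O -> S) (u : I -> S -> R) (W : I -> O' -> R).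
Hypothesis mX : forall k, measurable_fun setT (X k).
Hypothesis iX : mutually_independent P X.
Hypothesis FX : forall k A, measurable A -> P (X k @^-1` A) = F A.
Hypothesis L2u : forall i, L2 F (u i).
Hypothesis L2W : forall i, L2 P' (W i).
Hypothesis stableW : stable_family P' W.
Implicit Types (phi : (I -> R) -> R) (r : I -> R) (c : R).

Let mu_ i : measurable_fun setT (u i) := L2_measurable (L2u i).

Let mW i : measurable_fun setT (W i) := L2_measurable (L2W i).

Let muX i k : measurable_fun setT (fun w => u i (X k w)).
Proof. exact: (measurableT_comp (mu_ i)). Qed.

Let scaled_sum c n i w := c * \sum_(k < n) u i (X k w).

Let measurable_scaled_sum c n i : measurable_fun setT (scaled_sum c n i).
Proof. by apply: measurable_funM => //; apply: measurable_sum => k. Qed.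

Let measurable_scaledW c i : measurable_fun setT (fun w => c * W i w).
Proof. exact: measurable_funM. Qed.

Let smear_sumS (c M : R) n phi r : bounded_test M phi ->
  smear P (scaled_sum c n.+1) phi r =
  smear P (scaled_sum c n) (smear P (fun i w => c * u i (X n w)) phi) r.
Proof.
move=> phiM; pose Phi (z : nat -> S) := phi (fun i => r i + c * \sum_(k < n.+1) u i (z k)).
have finPhi : finitary (iota 0 n.+1) Phi.
  split => [z z' zz'|dT T Y mY].
    congr phi; apply/funext => i; congr (_ + _ * _); apply: eq_bigr => k _.
    by rewrite zz'// mem_iota add0n ltn_ord.
  apply: (measurable_finitary (Y := fun i w => r i + c * \sum_(k < n.+1) u i (Y k w)) phiM.1).
  move=> i; apply: measurable_funD => //; apply: measurable_funM => //.
  by apply: measurable_sum => k; exact: (measurableT_comp (mu_ i)).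
have LPhi : L1 P (fun w => Phi (X ^~ w)).
  apply: (L1_bounded_test (Y := fun i w => r i + scaled_sum c n.+1 i w) _ phiM) => i.
  exact: measurable_funD.
rewrite [LHS](Ex_resample iX mX (pred1 n) finPhi LPhi).
apply: eq_Ex => w; apply: eq_Ex => w'; congr phi; apply/funext => i /=.
rewrite big_ord_recr /= eqxx mulrDr addrA; congr (_ + _ * _ + _).
by apply: eq_bigr => k _; rewrite ltn_eqF.
Qed.

Let smear_WS (c M : R) n phi r : 0 <= c -> bounded_test M phi ->
  smear P' (fun i w => c * Num.sqrt n.+1%:R * W i w) phi r =
  smear P' (fun i w => c * W i w) (smear P' (fun i w => c * Num.sqrt n%:R * W i w) phi) r.
Proof.
move=> c0 phiM; rewrite (smear_stable mW r stableW c0 _ phiM) ?mulr_ge0//.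
have -> : c ^+ 2 + (c * Num.sqrt n%:R) ^+ 2 = c ^+ 2 * n.+1%:R.
  by rewrite exprMn sqr_sqrtr// -[n.+1]addn1 natrD; ring.
by rewrite sqrtrM ?sqr_ge0// sqrtr_sqr ger0_norm.
Qed.

Lemma all_replacements (c D M : R) phi : 0 <= c -> bounded_test M phi ->
  (forall k r, `|smear P (fun i w => c * u i (X k w)) phi r -
     smear P' (fun i w => c * W i w) phi r| <= D) ->
  forall n r, `|smear P (scaled_sum c n) phi r -
    smear P' (fun i w => c * Num.sqrt n%:R * W i w) phi r| <= n%:R * D.
Proof.
move=> c0 phiM replace; elim=> [|n IH] r.
  rewrite mul0r (_ : smear P _ _ _ = phi r); last first.
    rewrite -[RHS](Ex_cst P); apply: eq_Ex => w; congr phi; apply/funext => i.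
    by rewrite /scaled_sum big_ord0 mulr0 addr0.
  rewrite (_ : smear P' _ _ _ = phi r) ?subrr ?normr0//.
  rewrite -[RHS](Ex_cst P'); apply: eq_Ex => w; congr phi; apply/funext => i.
  by rewrite sqrtr0 mulr0 mul0r addr0.
have muXc k i : measurable_fun setT (fun w => c * u i (X k w)) by exact: measurable_funM.
rewrite (smear_sumS _ _ _ phiM) (smear_WS _ _ c0 phiM) -natr1 mulrDl mul1r [leRHS]addrC.
rewrite -(subrKA (smear P (scaled_sum c n) (smear P' (fun i w => c * W i w) phi) r)).
apply: le_trans (ler_normD _ _) _; apply: lerD.
  apply: (smear_dist_le P _ _ _ (replace n)) => //; exact: bounded_smear phiM.
rewrite (smear_comm _ _ _ _ _ phiM)//.
apply: (smear_dist_le P' _ _ _ IH) => //; exact: bounded_smear phiM.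
Qed.

Hypothesis Eu : forall i, Ex F (u i) = 0.
Hypothesis EW : forall i, Ex P' (W i) = 0.
Hypothesis covuW : forall i j, Ex F (fun x => u i x * u j x) = Ex P' (fun w => W i w * W j w).

Theorem lindeberg_clt (C M : R) phi : taylor2_functional C phi -> bounded_test M phi ->
  Ex P (fun w => phi (fun i => (Num.sqrt n%:R)^-1 * \sum_(k < n) u i (X k w))) @[n --> \oo] -->
  Ex P' (fun w => phi (fun i => W i w)).
Proof.
move=> taylor phiM; pose c n : R := (Num.sqrt n%:R)^-1.
pose D n := replacement_error F P' u W C (c n).
have remainderE n k : taylor_remainder P (fun i w => u i (X k w)) (c n) =
    taylor_remainder F u (c n).
  apply: (Ex_law (mX k) (FX k)); apply: L1_measurable (L1_taylor_remainder L2u _).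
  by rewrite invr_ge0.
have replace n k r : `|smear P (fun i w => c n * u i (X k w)) phi r -
    smear P' (fun i w => c n * W i w) phi r| <= D n.
  rewrite /D /replacement_error -(remainderE n k); apply: one_replacement taylor phiM _ => //.
  - by move=> i; exact/(L2_law (mX k) (FX k)).
  - by move=> i; rewrite (Ex_law (mX k) (FX k)).
  - move=> i j; rewrite -covuW; apply: (Ex_law (mX k) (FX k) (f := fun x => u i x * u j x)).
    exact: measurable_funM.
  - by rewrite invr_ge0.
have sum_near n : `|Ex P (fun w => phi (fun i => c n.+1 * \sum_(k < n.+1) u i (X k w))) -
    Ex P' (fun w => phi (fun i => W i w))| <= n.+1%:R * D n.+1.
  have c0 : 0 <= c n.+1 by rewrite invr_ge0.
  have := all_replacements c0 phiM (replace n.+1) n.+1 (fun=> 0).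
  rewrite /smear; under eq_Ex do under eq_fun do rewrite add0r.
  under [in X in _ - X]eq_Ex do under eq_fun do
    rewrite add0r mulVf ?mul1r ?gt_eqF ?sqrtr_gt0 ?ltr0n//.
  by [].
have cvgD : n%:R * D n @[n --> \oo] --> (0 : R) by exact: replacement_error_cvg.
apply/cvgrPdist_le => e e0.
move/cvgrPdist_le : cvgD => /(_ _ e0) [N _ D_small].
exists N.+1 => // -[//|n] /= Nn; rewrite distrC; apply: le_trans (sum_near n) _.
have := D_small n.+1 (leqW Nn); rewrite sub0r normrN; apply: le_trans; exact: ler_norm.
Qed.

End central_limit.

(** * The normal law *)

Lemma product_law {d1 d2 d1' d2' : measure_display} {R : realType}
    {O1 : measurableType d1} {O2 : measurableType d2}
    {S1 : measurableType d1'} {S2 : measurableType d2'}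
    (P1 : probability O1 R) (P2 : probability O2 R)
    (F1 : probability S1 R) (F2 : probability S2 R) (U1 : O1 -> S1) (U2 : O2 -> S2) :
  measurable_fun setT U1 -> measurable_fun setT U2 ->
  (forall A, measurable A -> P1 (U1 @^-1` A) = F1 A) ->
  (forall A, measurable A -> P2 (U2 @^-1` A) = F2 A) ->
  forall B, measurable B ->
    (P1 \x P2)%E ((fun z => (U1 z.1, U2 z.2)) @^-1` B) = (F1 \x F2)%E B.
Proof.
move=> mU1 mU2 lawU1 lawU2 B mB.
have mU : measurable_fun setT (fun z => (U1 z.1, U2 z.2)).
  by apply: measurable_fun_pair; exact: measurableT_comp.
pose U : {RV (P1 \x P2)%E >-> (S1 * S2)%type} := mfun_Sub (mem_set mU).
apply/esym; apply: (product_measure_unique (m' := distribution (P1 \x P2)%E U)) => // A1 A2 mA1 mA2.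
have mUA1 : measurable (U1 @^-1` A1) by rewrite -[X in measurable X]setTI; exact: mU1.
have mUA2 : measurable (U2 @^-1` A2) by rewrite -[X in measurable X]setTI; exact: mU2.
apply: etrans (product_measure1E P1 P2 mUA1 mUA2) _.
by congr (_ * _)%E; [exact: lawU1|exact: lawU2].
Qed.

Section normal_law.
Context {R : realType}.
Local Notation mu := (@lebesgue_measure R).

Lemma rays_law_unique (nu nu' : probability (measurableTypeR R) R) :
  (forall x : R, nu `[x, +oo[%classic = nu' `[x, +oo[%classic) ->
  forall A, measurable A -> nu A = nu' A.
Proof.
move=> rays A; apply: (measure_unique (T := measurableTypeR R) (@RGenCInfty.G R)
  (fun n => `[- n%:R, +oo[%classic)).
- exact: RGenCInfty.measurableE.
- move=> _ _ [x ->] [y ->]; exists (Num.max x y).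
  by apply/seteqP; split => t /=; rewrite !in_itv /= !andbT ge_max => /andP.
- by move=> n; exists (- n%:R).
- apply/seteqP; split => // x _; have [n xn] := nbhs_infty_ger `|x|.
  move=> h; exists n => //=; rewrite in_itv /= andbT lerNl.
  by apply: le_trans (h n (leqnn n)); rewrite -normrN ler_norm.
- by move=> _ [x ->]; exact: rays.
- by move=> n; rewrite ltey_eq fin_num_measure.
Qed.

Lemma normal_peakM (s : R) : 0 < s -> normal_peak s = s^-1 * normal_peak 1.
Proof.
move=> s0; rewrite /normal_peak expr1n mul1r -invfM -mulrnAr sqrtrM ?sqr_ge0//.
by rewrite sqrtr_sqr gtr0_norm.
Qed.

Lemma normal_pdf_affine (m s x : R) : 0 < s ->
  normal_pdf m s (m + s * x) * s = normal_pdf 0 1 x.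
Proof.
move=> s0; have sn : s != 0 by rewrite gt_eqF.
rewrite !normal_pdfE ?oner_eq0//= (normal_peakM s0) /normal_fun.
rewrite (_ : - (m + s * x - m) ^+ 2 / (s ^+ 2 *+ 2) = - (x - 0) ^+ 2 / (1 ^+ 2 *+ 2)).
  by field.
by field.
Qed.

Lemma normal_affine (m s : R) (A : set R) : 0 < s -> measurable A ->
  normal_prob m s A = normal_prob 0 1 ((fun x => m + s * x) @^-1` A).
Proof.
move=> s0; pose T := measurableTypeR R; pose aff (x : T) : T := m + s * x.
have maff : measurable_fun setT aff.
  by apply: measurable_funD => //; apply: measurable_funM.
pose V : {RV (normal_prob (0 : R) 1) >-> T} := mfun_Sub (mem_set maff).
apply: (rays_law_unique (nu' := distribution (normal_prob 0 1) V)) => r.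
rewrite [RHS](_ : _ = normal_prob 0 1 `[(r - m) / s, +oo[%classic); last first.
  congr (normal_prob 0 1 _); apply/seteqP; split => x /=;
    by rewrite /aff !in_itv /= !andbT ler_pdivrMr// mulrC lerBlDl.
rewrite /normal_prob; set a := (r - m) / s.
have affa : aff a = r by rewrite /aff /a; field; rewrite gt_eqF.
have daff (x : R) : is_derive x 1 (aff : R -> R) s.
  have := is_deriveD (is_derive_cst (m : R^o) x (1 : R))
    (is_deriveZ s (is_derive_id x (1 : R))).
  by rewrite add0r /GRing.scale /= mulr1.
have caff : continuous (aff : R -> R) := is_derive_continuous daff.
have daffE : (aff : R -> R)^`()%classic = fun=> s.
  by apply/funext => x; rewrite derive1E; have := daff x => ?; rewrite derive_val.
have sn : s != 0 by rewrite gt_eqF.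
transitivity (\int[mu]_(x in `[aff a, +oo[) (normal_pdf m s x)%:E)%E; first by rewrite affa.
rewrite increasing_ge0_integration_by_substitutiony.
- apply: eq_integral => x _; congr EFin.
  by rewrite !fctE daffE normal_pdf_affine.
- by move=> x y _ _ xy; rewrite ltrD2l ltr_pM2l.
- by rewrite daffE => x _; exact: cvg_cst.
- by rewrite daffE; exact: is_cvg_cst.
- by rewrite daffE; exact: is_cvg_cst.
- split; first by move=> x _; case: (daff x).
  by apply: cvg_at_right_filter; exact: caff.
- rewrite (_ : aff = (fun x : R => (x + m / s) * s)); last first.
    by apply/funext => x; rewrite /aff; field.
  by apply/gt0_cvgMly => //; exact: cvg_addrr.
- by apply: continuous_subspaceT; exact: continuous_normal_pdf.
- by move=> x _; exact: normal_pdf_ge0.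
Qed.

Let normal_prob_density (m s : R) (f : R -> R) (M : R) : measurable_fun setT f ->
  (forall x, `|f x| <= M) ->
  (\int[normal_prob m s]_x (f x)%:E = \int[mu]_x (f x * normal_pdf m s x)%:E)%E.
Proof.
move=> mf fM.
have If : (normal_prob m s).-integrable setT (EFin \o f).
  exact: (L1_bnd (normal_prob m s) mf fM).
rewrite -(Radon_Nikodym_change_of_variables (normal_prob_dominates m s))//=.
apply: ae_eq_integral => //.
- apply: emeasurable_funM => //; first exact/measurable_EFinP.
  apply: (measurable_int mu); apply: (integrableS _ _ (@subsetT _ _)) => //=.
  by apply: Radon_Nikodym_integrable; exact: normal_prob_dominates.
- apply/measurable_EFinP/measurable_funM => //; exact: measurable_normal_pdf.
- under [X in ae_eq _ _ _ X]eq_fun do rewrite EFinM.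
  apply: ae_eqe_mul2l => /=.
  rewrite Radon_NikodymE//=; first exact: normal_prob_dominates.
  move=> abmu.
  case: cid => /= h [h1 h2 h3].
  apply: integral_ae_eq => //=.
  + by apply/measurable_EFinP; exact: measurable_normal_pdf.
  + by move=> E E01 mE; rewrite -h3.
Qed.

Let measurable_borel_id : measurable_fun setT (fun x : measurableTypeR R => x : R).
Proof. exact: measurable_id. Qed.

(* [normal_prob] as a law on [R] itself rather than on its Borel alias. *)
Definition normalR (m s : R) : probability R R :=
  distribution (normal_prob m s)
    (mfun_Sub (mem_set measurable_borel_id) : {RV (normal_prob m s) >-> R}).

Lemma normalRE (m s : R) A : normalR m s A = normal_prob m s A.
Proof. by []. Qed.

Lemma normal_density (m s : R) (f : R -> R) (M : R) : measurable_fun setT f ->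
  (forall x, `|f x| <= M) ->
  (\int[normalR m s]_x (f x)%:E = \int[mu]_x (f x * normal_pdf m s x)%:E)%E.
Proof.
move=> mf fM; rewrite -(normal_prob_density m s mf fM).
by apply/esym/(integral_law measurable_borel_id) => //; exact/measurable_EFinP.
Qed.

Lemma normal_pdf_product (a b x y : R) : 0 < b ->
  let c := Num.sqrt (a ^+ 2 + b ^+ 2) in
  normal_pdf (a * x) b y * normal_pdf 0 1 x =
  normal_pdf 0 c y * normal_pdf (a * y / c ^+ 2) (b / c) x.
Proof.
move=> b0 c.
have c2 : c ^+ 2 = a ^+ 2 + b ^+ 2 by rewrite sqr_sqrtr// addr_ge0// sqr_ge0.
have c0 : 0 < c by rewrite sqrtr_gt0 ltr_wpDl ?sqr_ge0// exprn_gt0.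
have cn : c != 0 by rewrite gt_eqF.
have bn : b != 0 by rewrite gt_eqF.
have c2n : a ^+ 2 + b ^+ 2 != 0 by rewrite -c2 sqrf_eq0.
have bc0 : 0 < b / c by rewrite divr_gt0.
rewrite !normal_pdfE ?oner_eq0 ?(gt_eqF bc0)//= (normal_peakM b0) (normal_peakM c0) (normal_peakM bc0).
rewrite /normal_fun mulrACA [RHS]mulrACA -!expRD; congr (_ * expR _).
  by field; rewrite bn cn.
rewrite expr_div_n c2; field; by rewrite bn c2n.
Qed.

Lemma normal_pdf_mixture (a b y : R) : 0 < b ->
  (\int[mu]_x (normal_pdf (a * x) b y * normal_pdf 0 1 x)%:E =
   (normal_pdf 0 (Num.sqrt (a ^+ 2 + b ^+ 2)) y)%:E)%E.
Proof.
move=> b0; set c := Num.sqrt _.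
under eq_integral do rewrite normal_pdf_product// -/c EFinM.
rewrite ge0_integralZl//.
- by rewrite integral_normal_pdf mule1.
- by apply/measurable_EFinP; exact: measurable_normal_pdf.
- by move=> x _; rewrite lee_fin normal_pdf_ge0.
- by rewrite lee_fin normal_pdf_ge0.
Qed.

Let measurable_normal_pdf_mean (a b : R) : b != 0 ->
  measurable_fun setT (fun z : R * R => normal_pdf (a * z.1) b z.2).
Proof.
move=> bn; rewrite (_ : (fun z => _) = fun z : R * R =>
    normal_peak b * expR (- (z.2 - a * z.1) ^+ 2 / (b ^+ 2 *+ 2))).
  apply: measurable_funM => //; apply: measurableT_comp => //.
  apply: measurable_funM => //; apply: measurableT_comp => //; apply: measurable_funX.
  by apply: measurable_funB => //; apply: measurable_funM.
by apply/funext => z; rewrite normal_pdfE.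
Qed.

Lemma normal_mixture (a b : R) (A : set R) : 0 < b -> measurable A ->
  (\int[mu]_x (fine (normal_prob (a * x) b A) * normal_pdf 0 1 x)%:E =
   normal_prob 0 (Num.sqrt (a ^+ 2 + b ^+ 2)) A)%E.
Proof.
move=> b0 mA.
pose h (z : R * R) : R := \1_A z.2 * (normal_pdf (a * z.1) b z.2 * normal_pdf 0 1 z.1).
have mh : measurable_fun setT h.
  apply: measurable_funM; first exact: (measurableT_comp (measurable_indic mA)).
  apply: measurable_funM; first by apply: measurable_normal_pdf_mean; rewrite gt_eqF.
  exact: (measurableT_comp (measurable_normal_pdf 0 1)).
have h0 z : 0 <= h z by rewrite mulr_ge0// mulr_ge0 ?normal_pdf_ge0.
transitivity (\int[mu]_x \int[mu]_y (h (x, y))%:E)%E.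
  apply: eq_integral => x _; rewrite EFinM fineK; last exact: fin_num_measure.
  rewrite /normal_prob integral_mkcond muleC -ge0_integralZl//.
  - apply: eq_integral => y _; rewrite patchE /h indicE /=.
    by case: (y \in A); rewrite ?mul0r ?mule0// mul1r -EFinM mulrC.
  - apply/(measurable_restrict _ mA) => //; apply: measurable_funTS.
    by apply/measurable_EFinP; exact: measurable_normal_pdf.
  - by move=> y _; rewrite patchE; case: ifP => // _; rewrite lee_fin normal_pdf_ge0.
  - by rewrite lee_fin normal_pdf_ge0.
have := @fubini_tonelli _ _ _ _ R mu mu (fun z => (h z)%:E).
rewrite /fubini_F /fubini_G => -> //; last exact/measurable_EFinP.
rewrite [RHS]integral_mkcond; apply: eq_integral => y _; rewrite patchE.
under eq_integral do rewrite /h indicE /=.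
case: (y \in A); last by under eq_integral do rewrite mul0r; rewrite integral0.
by under eq_integral do rewrite mul1r; exact: normal_pdf_mixture.
Qed.

Lemma normal_stable (a b : R) (A : set R) : 0 <= a -> 0 <= b -> measurable A ->
  (normalR 0 1 \x normalR 0 1)%E ((fun z => a * z.1 + b * z.2) @^-1` A) =
  normalR 0 1 ((fun x => Num.sqrt (a ^+ 2 + b ^+ 2) * x) @^-1` A).
Proof.
move=> a0; have mlin (c e : R) : measurable_fun setT (fun x : R => c + e * x).
  by apply: measurable_funD => //; apply: measurable_funM.
have mpre (g : R -> R) : measurable_fun setT g -> measurable A -> measurable (g @^-1` A).
  by move=> mg mA; rewrite -[X in measurable X]setTI; exact: mg.
rewrite le_eqVlt => /predU1P[<- mA|b0 mA].
  rewrite expr0n /= addr0 sqrtr_sqr ger0_norm//.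
  have maA : measurable ((fun x => a * x) @^-1` A) by apply: mpre => //; exact: measurable_funM.
  rewrite (_ : _ @^-1` _ = ((fun x => a * x) @^-1` A) `*` setT).
    apply: etrans (product_measure1E _ _ maA measurableT) _.
    by rewrite [X in (_ * X)%E](probability_setT (normalR 0 1)) mule1.
  by apply/seteqP; split => z /=; rewrite mul0r addr0 => // -[].
have c0 : 0 < Num.sqrt (a ^+ 2 + b ^+ 2) by rewrite sqrtr_gt0 ltr_wpDl ?sqr_ge0// exprn_gt0.
set c := Num.sqrt _ in c0 *.
have mab : measurable_fun setT (fun z : R * R => a * z.1 + b * z.2).
  by apply: measurable_funD; apply: measurable_funM.
have mabA : measurable ((fun z : R * R => a * z.1 + b * z.2) @^-1` A).
  by rewrite -[X in measurable X]setTI; exact: mab.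
transitivity (normal_prob 0 c A); last first.
  by rewrite (normal_affine 0 c0 mA) normalRE; under eq_fun do rewrite add0r.
rewrite -(normal_mixture a b0 mA) (Ex_indic _ mabA) (Ex_fubini (L1_indic _ mabA)).
have sliceE x : Ex (normalR 0 1) (fun y => \1_((fun z => a * z.1 + b * z.2) @^-1` A) (x, y)) =
    fine (normal_prob (a * x) b A).
  rewrite (normal_affine _ b0 mA) -normalRE Ex_indic//; exact: mpre.
under eq_Ex do rewrite sliceE.
have mprob : measurable_fun setT (fun x => fine (normal_prob (a * x) b A)).
  under eq_fun do rewrite -sliceE.
  exact: (measurable_Ex_slice (normalR 0 1) (measurable_indic mabA)).
have prob_le x : `|fine (normal_prob (a * x) b A)| <= 1.
  rewrite ger0_norm ?fine_ge0// -lee_fin fineK ?fin_num_measure//; exact: probability_le1.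
rewrite -(normal_density _ _ mprob prob_le) L1_int//; exact: L1_bnd prob_le.
Qed.

End normal_law.

Section normal_moments.
Context {R : realType}.
Local Notation mu := (@lebesgue_measure R).
Local Notation N01 := (normalR (0 : R) 1).

Lemma normal_exp_sqr (h : R) : 0 <= h ->
  Ex N01 (fun x => expR (- (h * x ^+ 2))) = (Num.sqrt (1 + 2 * h))^-1.
Proof.
move=> h0; pose s := (Num.sqrt (1 + 2 * h))^-1.
have h1 : 0 < 1 + 2 * h by lra.
have s0 : 0 < s by rewrite invr_gt0 sqrtr_gt0.
have sn : s != 0 by rewrite gt_eqF.
have s2 : s ^- 2 = 1 + 2 * h by rewrite exprVn invrK sqr_sqrtr ?ltW.
have mexp : measurable_fun setT (fun x : R => expR (- (h * x ^+ 2))).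
  apply: measurableT_comp => //; apply: measurableT_comp => //.
  by apply: measurable_funM => //; exact: measurable_funX.
have exp_le1 (x : R) : `|expR (- (h * x ^+ 2))| <= 1.
  by rewrite ger0_norm ?expR_ge0// expR_le1 oppr_le0 mulr_ge0// sqr_ge0.
have pdf_shrink (x : R) : expR (- (h * x ^+ 2)) * normal_pdf 0 1 x = s * normal_pdf 0 s x.
  rewrite !normal_pdfE ?oner_eq0//= (normal_peakM s0) /normal_fun mulrCA -expRD.
  rewrite [RHS](_ : _ = normal_peak 1 * expR (- (x - 0) ^+ 2 / (s ^+ 2 *+ 2))); last by field.
  by congr (_ * expR _); rewrite -[s ^+ 2]invrK s2; field; rewrite gt_eqF.
apply: EFin_inj; rewrite -(L1_int (L1_bnd _ mexp exp_le1)) (normal_density _ _ mexp exp_le1).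
under eq_integral do rewrite pdf_shrink EFinM.
rewrite ge0_integralZl ?lee_fin ?(ltW s0)//.
- by rewrite integral_normal_pdf mule1.
- by apply/measurable_EFinP; exact: measurable_normal_pdf.
- by move=> x _; rewrite lee_fin normal_pdf_ge0.
Qed.

(* [(1 - exp (- h x^2)) / h] increases to [x^2] as [h] decreases to [0]. *)
Definition saturated_sqr (h x : R) : R := h^-1 * (1 - expR (- (h * x ^+ 2))).

Lemma measurable_saturated_sqr h : measurable_fun setT (saturated_sqr h).
Proof.
apply: measurable_funM => //; apply: measurable_funB => //.
apply: measurableT_comp => //; apply: measurableT_comp => //.
by apply: measurable_funM => //; exact: measurable_funX.
Qed.

Lemma saturated_sqr_ge0 h x : 0 < h -> 0 <= saturated_sqr h x.
Proof.
move=> h0; rewrite mulr_ge0 ?invr_ge0 ?(ltW h0)// subr_ge0 expR_le1 oppr_le0.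
by rewrite mulr_ge0 ?sqr_ge0 ?(ltW h0).
Qed.

Lemma saturated_sqr_le h x : 0 < h -> saturated_sqr h x <= x ^+ 2.
Proof.
move=> h0; rewrite /saturated_sqr mulrC ler_pdivrMr// [leRHS]mulrC.
by have := expR_ge1Dx (- (h * x ^+ 2)); lra.
Qed.

Lemma saturated_sqr_ge h x : 0 < h -> x ^+ 2 - h * x ^+ 4 <= saturated_sqr h x.
Proof.
move=> h0; set v := h * x ^+ 2.
have v0 : 0 <= v by rewrite mulr_ge0 ?sqr_ge0 ?(ltW h0).
have exp_le : (1 + v) * expR (- v) <= 1.
  by rewrite -[leRHS]expR0 -(subrr v) expRD ler_wpM2r ?expR_ge0 ?expR_ge1Dx.
have v2_ge0 : 0 <= v * v * expR (- v) by rewrite mulr_ge0 ?expR_ge0// mulr_ge0.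
rewrite /saturated_sqr ler_pdivlMl// -/v.
rewrite (_ : h * (x ^+ 2 - h * x ^+ 4) = v - v * v); last by rewrite /v; ring.
nra.
Qed.

Lemma L1_saturated_sqr h : 0 < h -> L1 N01 (saturated_sqr h).
Proof.
move=> h0; apply: (L1_bnd _ (M := h^-1) (measurable_saturated_sqr h)) => x.
rewrite ger0_norm ?saturated_sqr_ge0// -[leRHS]mulr1.
by rewrite ler_wpM2l ?invr_ge0 ?gerBl ?expR_ge0 ?(ltW h0).
Qed.

Lemma Ex_saturated_sqr h (s := (Num.sqrt (1 + 2 * h))^-1) : 0 < h ->
  Ex N01 (saturated_sqr h) = 2 * s ^+ 2 / (1 + s).
Proof.
move=> h0; have h1 : 0 < 1 + 2 * h by lra.
have s0 : 0 < s by rewrite invr_gt0 sqrtr_gt0.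
have s2 : s ^+ 2 * (1 + 2 * h) = 1.
  by rewrite exprVn sqr_sqrtr ?mulVf ?gt_eqF// ltW.
have -> : Ex N01 (saturated_sqr h) = h^-1 * (1 - s).
  have Lexp : L1 N01 (fun x : R => expR (- (h * x ^+ 2))).
    apply: eq_L1 (L1B (L1_cst N01 1) (L1Z h (L1_saturated_sqr h0))) => x.
    by rewrite /saturated_sqr mulrA mulfV ?gt_eqF// mul1r; ring.
  rewrite ExZ; last by apply: L1B => //; exact: L1_cst.
  by rewrite ExB//; [rewrite Ex_cst normal_exp_sqr// ltW|exact: L1_cst].
have -> : 1 - s = 2 * h * s ^+ 2 / (1 + s).
  by apply: (mulIf (x := 1 + s)); rewrite ?gt_eqF ?addr_gt0// divfK ?gt_eqF ?addr_gt0//; lra.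
by field; rewrite !gt_eqF ?addr_gt0.
Qed.

Let h_ (n : nat) : R := n.+1%:R^-1.

Let h_gt0 n : 0 < h_ n.
Proof. by rewrite invr_gt0 ltr0n. Qed.

Lemma cvg_saturated_sqr x : saturated_sqr (h_ n) x @[n --> \oo] --> x ^+ 2.
Proof.
apply: (@squeeze_cvgr _ _ _ _ (fun n => x ^+ 2 - h_ n * x ^+ 4) (fun=> x ^+ 2)).
- by apply: nearW => n; rewrite saturated_sqr_ge// saturated_sqr_le.
- rewrite -[X in _ --> X]subr0 -[X in _ - X](mul0r (x ^+ 4)).
  by apply: cvgB; [exact: cvg_cst|apply: cvgM; [exact: cvg_harmonic|exact: cvg_cst]].
- exact: cvg_cst.
Qed.

Lemma cvg_Ex_saturated_sqr : Ex N01 (saturated_sqr (h_ n)) @[n --> \oo] --> (1 : R).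
Proof.
under eq_fun do rewrite Ex_saturated_sqr//.
pose phi (h : R) : R := 2 * (Num.sqrt (1 + 2 * h))^-1 ^+ 2 / (1 + (Num.sqrt (1 + 2 * h))^-1).
have phi0 : phi 0 = 1 by rewrite /phi mulr0 addr0 sqrtr1; field.
suff : phi h @[h --> (0 : R)] --> phi 0 by rewrite phi0 => /(cvg_comp _ _ (@cvg_harmonic R)).
have cs : (Num.sqrt (1 + 2 * h))^-1 @[h --> (0 : R)] --> (Num.sqrt (1 + 2 * 0 : R))^-1.
  apply: cvgV; first by rewrite mulr0 addr0 sqrtr1 oner_eq0.
  apply: (@cvg_comp _ _ _ (fun h : R => 1 + 2 * h) Num.sqrt); last exact: sqrt_continuous.
  by apply: cvgD; [exact: cvg_cst|apply: cvgM; [exact: cvg_cst|exact: cvg_id]].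
apply: cvgM; first by apply: cvgM; [exact: cvg_cst|exact: (cvgM cs cs)].
apply: cvgV; last by apply: cvgD => //; exact: cvg_cst.
by rewrite mulr0 addr0 sqrtr1; lra.
Qed.

Lemma L2_normal : L2 N01 (fun x : R => x).
Proof.
split; first exact: measurable_id.
suff [] : L1 N01 (fun x : R => x ^+ 2) /\ Ex N01 (fun x : R => x ^+ 2) <= 2 by [].
apply: (L1_fatou (f_ := fun n => saturated_sqr (h_ n))).
- by move=> n; exact: L1_saturated_sqr.
- by move=> n x; exact: saturated_sqr_ge0.
- exact: measurable_funX.
- by apply: aeW => x; exact: cvg_saturated_sqr.
- by apply: (cvgr_le _ cvg_Ex_saturated_sqr); rewrite ltr1n.
Qed.

Lemma normal_variance : Ex N01 (fun x : R => x ^+ 2) = 1.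
Proof.
rewrite -[RHS](cvg_lim _ cvg_Ex_saturated_sqr)//; apply/esym/cvg_lim => //.
apply: (Ex_dct (g := fun x : R => x ^+ 2)).
- by move=> n; exact: measurable_saturated_sqr.
- exact: measurable_funX.
- by case: L2_normal.
- by move=> n x; rewrite ger0_norm ?saturated_sqr_ge0 ?saturated_sqr_le.
- by apply: aeW => x; exact: cvg_saturated_sqr.
Qed.

(* By stability the sum of two independent copies of [x] has the law of [sqrt 2 * x],
   so the mean [m] satisfies [m + m = sqrt 2 * m]. *)
Lemma normal_mean : Ex N01 (fun x : R => x) = 0.
Proof.
have Lid := L2_L1 L2_normal; set m := Ex N01 _; pose c : R := Num.sqrt (1 ^+ 2 + 1 ^+ 2).
have c2 : c ^+ 2 = 2 by rewrite sqr_sqrtr ?addr_ge0 ?sqr_ge0//; lra.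
have msum : measurable_fun setT (fun z : R * R => 1 * z.1 + 1 * z.2).
  by apply: measurable_funD; apply: measurable_funM.
have mscale : measurable_fun setT (fun x : R => c * x) by exact: measurable_funM.
have Esum : Ex (N01 \x N01)%E (fun z : R * R => 1 * z.1 + 1 * z.2) = m + m.
  under eq_Ex do rewrite !mul1r.
  by rewrite (ExD (L1_fst _ Lid) (L1_snd _ Lid)) (Ex_fst _ Lid) (Ex_snd _ Lid).
pose scale : {RV N01 >-> R} := mfun_Sub (mem_set mscale).
have sum_law (A : set R) : measurable A ->
    (N01 \x N01)%E ((fun z : R * R => 1 * z.1 + 1 * z.2) @^-1` A) = distribution N01 scale A.
  by move=> mA; apply: etrans (normal_stable ler01 ler01 mA) _.
have scale_law (A : set R) : measurable A -> N01 (scale @^-1` A) = distribution N01 scale A by [].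
have m2 : m + m = c * m.
  rewrite -Esum (Ex_law msum sum_law (f := id))// -(Ex_law (G := distribution N01 scale) mscale scale_law (f := id))//.
  exact: ExZ.
have : (2 - c) * m = 0 by rewrite mulrBl -m2; ring.
move=> /eqP; rewrite mulf_eq0 => /predU1P[c_2|/eqP//].
have c_eq2 : c = 2 by lra.
by exfalso; move: c2; rewrite c_eq2 expr2; lra.
Qed.

End normal_moments.

Section gaussian_family.
Context {R : realType} {I : finType} {d : measure_display} {O : measurableType d}
  (P : probability O R) (Z : I -> O -> R) (s : I -> R).
Hypothesis mZ : forall i, measurable_fun setT (Z i).
Hypothesis iZ : mutually_independent P Z.
Hypothesis normalZ : forall i A, measurable A -> P (Z i @^-1` A) = normalR 0 1 A.

Lemma gaussian_stable : stable_family P (fun i w => s i * Z i w).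
Proof.
move=> a b a0 b0; pose c := Num.sqrt (a ^+ 2 + b ^+ 2).
have mscale (e : R) : measurable_fun setT (fun x : R => e * x) by exact: measurable_funM.
have mcomb (x y : R) : measurable_fun setT (fun z : R * R => x * z.1 + y * z.2).
  by apply: measurable_funD; apply: measurable_funM.
apply: independent_same_law (enum_uniq _) _ _ _.
- apply: (independent_comp (independent_pairs iZ mZ)
    (g := fun i z => a * (s i * z.1) + b * (s i * z.2))) => i.
  by apply: measurable_funD; apply: measurable_funM => //; exact: measurable_funM.
- by apply: (independent_comp iZ (g := fun i x => c * (s i * x))) => i; exact: measurable_funM.
move=> i A mA; pose B := (fun x : R => s i * x) @^-1` A.
have mB : measurable B by rewrite -[X in measurable X]setTI; exact: mscale.
have mcombB : measurable ((fun z : R * R => a * z.1 + b * z.2) @^-1` B).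
  by rewrite -[X in measurable X]setTI; exact: mcomb.
have mcB : measurable ((fun x : R => c * x) @^-1` B).
  by rewrite -[X in measurable X]setTI; exact: mscale.
transitivity ((P \x P)%E ((fun w => (Z i w.1, Z i w.2)) @^-1`
    ((fun z : R * R => a * z.1 + b * z.2) @^-1` B))).
  by congr (_ _); apply/funext => w; rewrite /B /preimage /=; congr (A _); ring.
rewrite (product_law (mZ i) (mZ i) (normalZ i) (normalZ i) mcombB) (normal_stable a0 b0 mB).
rewrite -[LHS](normalZ i mcB).
by congr (P _); apply/funext => w; rewrite /B /preimage /=; congr (A _); exact: mulrCA.
Qed.

Lemma gaussian_L2 i : L2 P (fun w => s i * Z i w).
Proof. by apply: L2Z; exact/(L2_law (mZ i) (normalZ i) (f := id))/L2_normal. Qed.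

Lemma gaussian_mean i : Ex P (fun w => s i * Z i w) = 0.
Proof.
have LZ : L1 P (Z i) by exact/(L1_law (mZ i) (normalZ i) (f := id))/L2_L1/L2_normal.
by rewrite ExZ// (Ex_law (mZ i) (normalZ i) (f := id))// normal_mean mulr0.
Qed.

Lemma gaussian_cov i j :
  Ex P (fun w => (s i * Z i w) * (s j * Z j w)) = if i == j then s i ^+ 2 else 0.
Proof.
have Ls k : L1 (normalR 0 1) (fun x : R => s k * x) by apply: L1Z; exact: L2_L1 L2_normal.
case: eqVneq => [<-|ij].
  under eq_Ex do rewrite -expr2.
  rewrite (Ex_sqrZ _ ((L2_law (mZ i) (normalZ i) (f := id) _).2 L2_normal))//.
  by rewrite (Ex_law (mZ i) (normalZ i) (f := fun x => x ^+ 2))// normal_variance mulr1.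
rewrite (Ex_iid_mul mZ iZ normalZ ij (Ls i) (Ls j)).
by rewrite (ExZ _ (L2_L1 L2_normal)) normal_mean mulr0 mul0r.
Qed.

End gaussian_family.

Section additive_clt.
Context {R : realType} {I : finType} {d d' dS : measure_display} {O : measurableType d}
  {O' : measurableType d'} {S : measurableType dS}
  (P : probability O R) (P' : probability O' R) (F : probability S R)
  (X : nat -> O -> S) (u : I -> S -> R) (Z : I -> O' -> R) (s : I -> R).
Hypothesis mX : forall k, measurable_fun setT (X k).
Hypothesis iX : mutually_independent P X.
Hypothesis FX : forall k A, measurable A -> P (X k @^-1` A) = F A.
Hypothesis mZ : forall i, measurable_fun setT (Z i).
Hypothesis iZ : mutually_independent P' Z.
Hypothesis normalZ : forall i A, measurable A -> P' (Z i @^-1` A) = normalR 0 1 A.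
Hypothesis L2u : forall i, L2 F (u i).
Hypothesis Eu : forall i, Ex F (u i) = 0.
Hypothesis covu : forall i j, Ex F (fun x => u i x * u j x) = if i == j then s i ^+ 2 else 0.

Lemma additive_clt (f : R -> R) (theta : I -> R -> R) : smooth f ->
  (forall i, exists theta1 theta2 M, C2_lipschitz M (theta i) theta1 theta2) ->
  Ex P (fun w => f (\sum_i theta i ((Num.sqrt n%:R)^-1 * \sum_(k < n) u i (X k w))))
    @[n --> \oo] --> Ex P' (fun w => f (\sum_i theta i (s i * Z i w))).
Proof.
move=> [f1 [f2 [M [fC2 fM]]]] /choice[theta1 /choice[theta2 /choice[N thetaC2]]].
have M_ge0 := C2_lipschitz_ge0 fC2; have N_ge0 i := C2_lipschitz_ge0 (thetaC2 i).
pose K := M + \sum_i N i.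
have fK : C2_lipschitz K f f1 f2 by apply: C2_lipschitz_le fC2; rewrite lerDl sumr_ge0.
have thetaK i : C2_lipschitz K (theta i) (theta1 i) (theta2 i).
  apply: C2_lipschitz_le (thetaC2 i); rewrite /K (bigD1 i)//= addrCA lerDl.
  by rewrite addr_ge0 ?sumr_ge0.
apply: (lindeberg_clt mX iX FX L2u (gaussian_L2 s mZ normalZ) (gaussian_stable s mZ iZ normalZ)
  Eu (gaussian_mean s mZ normalZ) _ (taylor2_additive_test fK thetaK)
  (bounded_additive_test fK thetaK fM)) => i j.
by rewrite covu gaussian_cov.
Qed.

End additive_clt.

(** * Counting overlaps *)

Lemma bin_falling_le (n m r : nat) : (r <= m)%N -> (m <= n)%N ->
  ('C(n - r, m - r) * n ^ r <= 'C(n, m) * m ^ r)%N.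
Proof.
elim: r => [|r IH] rm mn; first by rewrite !subn0 !expn0.
have rn : (r < n)%N by exact: leq_trans rm mn.
have falling_le := IH (ltnW rm) mn.
rewrite -(leq_pmul2l (m := n - r)) ?subn_gt0//.
have diag : ((n - r) * 'C(n - r.+1, m - r.+1) = (m - r) * 'C(n - r, m - r))%N.
  rewrite -[in LHS](subnSK rn) -[in RHS](subnSK rn) -[in RHS](subnSK rm).
  exact: mul_bin_diag.
rewrite mulnA diag !expnS.
rewrite [leqLHS](_ : _ = (n * (m - r)) * ('C(n - r, m - r) * n ^ r))%N; last by ring.
rewrite [leqRHS](_ : _ = (m * (n - r)) * ('C(n, m) * m ^ r))%N; last by ring.
apply: leq_mul => //; rewrite !mulnBr mulnC leq_sub2l//.
by rewrite leq_mul2r mn orbT.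
Qed.

Lemma card_supersets (T : finType) (D : {set T}) (m : nat) : (#|D| <= m)%N ->
  #|[set A : {set T} | (D \subset A) && (#|A| == m)]%SET| = 'C(#|T| - #|D|, m - #|D|).
Proof.
move=> D_le_m; have -> : (#|T| - #|D| = #|~: D|)%N by rewrite -(cardsC D) addKn.
have disjointI (B : {set T}) : B \subset ~: D -> B :&: D = finset.set0.
  by rewrite -finset.disjoints_subset => /disjoint_setI0.
have disjointUK (B : {set T}) : B \subset ~: D -> (B :|: D) :\: D = B.
  move=> BD; rewrite finset.setDUl finset.setDv finset.setU0.
  by apply/finset.setDidPl; rewrite finset.disjoints_subset.
rewrite -cards_draws -[RHS](card_in_imset (f := fun B => B :|: D)); last first.
  move=> B B'; rewrite !inE => /andP[BD _] /andP[BD' _] BUD.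
  by rewrite -(disjointUK _ BD) BUD disjointUK.
congr #|pred_of_set _|; apply/setP => A; rewrite !inE; apply/andP/imsetP.
  move=> [DA /eqP Am]; exists (A :\: D).
    by rewrite !inE finset.setDE finset.subsetIr -finset.setDE cardsDS// Am /=.
  by rewrite -{1}(finset.setID A D) (finset.setIidPr DA) finset.setUC.
move=> [B]; rewrite !inE => /andP[BD /eqP Bm] ->; rewrite finset.subsetUr.
by rewrite cardsU Bm (disjointI _ BD) cards0 subn0 subnK.
Qed.

Section overlaps.
Local Open Scope set_scope.
Context {R : realType} (n m : nat).
Implicit Types (A B D : {set 'I_n}) (t : m.-tuple 'I_n).

Definition increasing t : bool := sorted (fun i j : 'I_n => (i < j)%N) t.

Lemma increasing_uniq t : increasing t -> uniq t.
Proof.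
apply: (sorted_uniq (leT := fun i j : 'I_n => (i < j)%N)).
- by move=> i j k; exact: ltn_trans.
- by move=> i; rewrite ltnn.
Qed.

Definition entries t : {set 'I_n} := [set i in t].

Lemma card_entries t : increasing t -> #|entries t| = m.
Proof. by move=> /increasing_uniq ut; rewrite cardsE (card_uniqP ut) size_tuple. Qed.

Lemma entries_inj : {in [set t | increasing t] &, injective entries}.
Proof.
move=> t t'; rewrite !inE => incrt incrt' /setP tt'.
apply/val_inj; apply: (irr_sorted_eq (leT := fun i j : 'I_n => (i < j)%N)) => //.
- by move=> i j k; exact: ltn_trans.
- by move=> i; rewrite ltnn.
- by move=> i; have := tt' i; rewrite !inE.
Qed.

Lemma imset_entries : entries @: [set t | increasing t] = [set A : {set 'I_n} | #|A| == m].
Proof.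
apply/eqP; rewrite eqEcard; apply/andP; split.
  by apply/fintype.subsetP => _ /imsetP[t + ->]; rewrite !inE => /card_entries ->.
rewrite (card_in_imset entries_inj) card_draws card_ord.
rewrite (_ : #|_| = #|[set t : m.-tuple 'I_n | sorted ltn (map val t)]|).
  by rewrite card_ltn_sorted_tuples.
by congr #|pred_of_set _|; apply/setP => t; rewrite !inE /increasing sorted_map.
Qed.

Lemma sum_increasing (F : {set 'I_n} -> R) :
  \sum_(t : m.-tuple 'I_n | increasing t) F (entries t) =
  \sum_(A : {set 'I_n} | #|A| == m) F A.
Proof.
transitivity (\sum_(A in [set A : {set 'I_n} | #|A| == m]) F A); last first.
  by apply: eq_bigl => A; rewrite inE.
rewrite -imset_entries (big_imset _ entries_inj) /=.
by apply: eq_bigl => t; rewrite inE.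
Qed.

Lemma overlap_le_common_subsets (r : nat) A B : (r <= #|A :&: B|)%N%:R <=
  \sum_(D : {set 'I_n} | (D \subset A) && (#|D| == r)) (D \subset B)%:R :> R.
Proof.
have [/card_geqP[s [us sr /= sAB]]|_] := leqP r; last exact: sumr_ge0.
have sA : [set x in s] \subset A.
  by apply/fintype.subsetP => x; rewrite inE => /sAB; rewrite inE => /andP[].
have sB : [set x in s] \subset B.
  by apply/fintype.subsetP => x; rewrite inE => /sAB; rewrite inE => /andP[].
rewrite (bigD1 [set x in s]) /=; last by rewrite sA cardsE (card_uniqP us) sr eqxx.
by rewrite sB lerDl; exact: sumr_ge0.
Qed.

Lemma sum_supersets D : (#|D| <= m)%N ->
  \sum_(B : {set 'I_n} | #|B| == m) (D \subset B)%:R = 'C(n - #|D|, m - #|D|)%:R :> R.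
Proof.
move=> Dm; have := card_supersets Dm; rewrite card_ord => <-.
rewrite -sum1_card natr_sum (bigID (fun B : {set 'I_n} => D \subset B)) /=.
rewrite [X in _ + X]big1 ?addr0 => [|B /andP[_ /negPf ->]]//.
by apply: eq_big => [B|B /andP[_ ->]//]; rewrite inE andbC.
Qed.

Lemma sum_overlap_set_le (r : nat) A : (r <= m)%N -> #|A| = m ->
  \sum_(B : {set 'I_n} | #|B| == m) (r <= #|A :&: B|)%N%:R <=
  'C(m, r)%:R * 'C(n - r, m - r)%:R :> R.
Proof.
move=> rm Am; apply: le_trans (ler_sum _ (fun B _ => overlap_le_common_subsets r A B)) _.
rewrite exchange_big /= -[in leRHS]Am -(cards_draws A r) Am -sum1_card natr_sum mulr_suml.
rewrite le_eqVlt; apply/predU1P; left; apply: eq_big => [D|D /andP[_ /eqP Dr]].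
  by rewrite inE.
by rewrite mul1r -[in RHS]Dr sum_supersets// Dr.
Qed.

Lemma sum_overlap_le (r : nat) :
  ('C(n, m)%:R ^-1) ^+ 2 *
  (\sum_(t : m.-tuple 'I_n | increasing t) \sum_(t' : m.-tuple 'I_n | increasing t')
     (r <= #|entries t :&: entries t'|)%N%:R) <=
  'C(m, r)%:R * (m%:R / n%:R) ^+ r :> R.
Proof.
rewrite (sum_increasing (fun A : {set 'I_n} =>
  \sum_(t' : m.-tuple 'I_n | increasing t') (r <= #|A :&: entries t'|)%N%:R)).
under eq_bigr do rewrite (sum_increasing (fun B : {set 'I_n} => (r <= #|_ :&: B|)%N%:R)).
have [mn|nm] := leqP m n; last first.
  by rewrite bin_small// invr0 expr0n mul0r mulr_ge0// exprn_ge0// divr_ge0.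
have [rm|mr] := leqP r m; last first.
  rewrite (bin_small mr) mul0r big1 ?mulr0// => A /eqP Am; rewrite big1// => B _.
  by rewrite leqNgt (leq_ltn_trans (subset_leq_card (finset.subsetIl _ _)))// Am.
have C0 : 0 < 'C(n, m)%:R :> R by rewrite ltr0n bin_gt0.
apply: (@le_trans _ _ (('C(n, m)%:R ^-1) ^+ 2 *
    ('C(n, m)%:R * ('C(m, r)%:R * 'C(n - r, m - r)%:R)))).
  rewrite ler_wpM2l ?sqr_ge0//.
  apply: le_trans (ler_sum _ (fun A Am => sum_overlap_set_le rm (eqP Am))) _.
  rewrite sumr_const (_ : #|_| = 'C(n, m)); first by rewrite [leRHS]mulr_natl.
  by have := card_draws 'I_n m; rewrite card_ord => <-; apply: eq_card => A; rewrite !inE.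
rewrite [leLHS](_ : _ = 'C(m, r)%:R * ('C(n - r, m - r)%:R / 'C(n, m)%:R)); last first.
  by field; rewrite gt_eqF.
rewrite ler_wpM2l// expr_div_n ler_pdivrMr// mulrAC.
have [r0|r0] := posnP r; first by rewrite r0 !subn0 !expr0 divr1 mul1r.
have n0 : (0 < n)%N by apply: leq_trans mn; exact: leq_trans rm.
rewrite ler_pdivlMr ?exprn_gt0 ?ltr0n// -!natrX -!natrM ler_nat [leqRHS]mulnC.
exact: bin_falling_le.
Qed.

End overlaps.

(** * Variance of a two-sample U-statistic *)

Lemma sum_prod_pairs (R : realType) (I J : finType) (Q1 : pred I) (Q2 : pred J)
    (f : I -> I -> R) (g : J -> J -> R) :
  \sum_(q : I * J | Q1 q.1 && Q2 q.2) \sum_(q' : I * J | Q1 q'.1 && Q2 q'.2)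
    f q.1 q'.1 * g q.2 q'.2 =
  (\sum_(i | Q1 i) \sum_(i' | Q1 i') f i i') * (\sum_(j | Q2 j) \sum_(j' | Q2 j') g j j').
Proof.
rewrite mulr_suml -(pair_big Q1 Q2 (fun i j => \sum_(q' : I * J | Q1 q'.1 && Q2 q'.2)
  f i q'.1 * g j q'.2)) /=.
apply: eq_bigr => i _; rewrite mulr_sumr; apply: eq_bigr => j _.
by rewrite -(pair_big Q1 Q2 (fun i' j' => f i i' * g j j')) /= big_distrlr.
Qed.

Lemma reorder_tuple m (s s' : m.-tuple nat) : exists so : m.-tuple nat,
  perm_eq s so /\ (forall i : 'I_m, (tnth so i \in s') = (i < count (mem s') s)%N).
Proof.
pose q := [seq i <- s | i \in s'] ++ [seq i <- s | i \notin s'].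
have sq : perm_eq q s by rewrite /q perm_filterC.
have qm : size q == m by rewrite (perm_size sq) size_tuple.
exists (Tuple qm); split => [|i]; first by rewrite perm_sym.
rewrite (tnth_nth 0%N) /= /q nth_cat size_filter; case: ltnP => i_count.
  have : nth 0%N [seq i <- s | i \in s'] i \in [seq i <- s | i \in s'].
    by rewrite mem_nth// size_filter.
  by rewrite mem_filter => /andP[].
have : nth 0%N [seq i <- s | i \notin s'] (i - count (mem s') s) \in
    [seq i <- s | i \notin s'].
  rewrite mem_nth// ltn_subLR// size_filter.
  by have := eqP qm; rewrite size_cat !size_filter => ->.
by rewrite mem_filter => /andP[/negbTE].
Qed.

Definition labels (s t : seq nat) : seq (bool * nat) :=
  [seq (false, i) | i <- s] ++ [seq (true, j) | j <- t].

Lemma mem_labels (s t : seq nat) e :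
  (e \in labels s t) = (e.2 \in (if e.1 then t else s)).
Proof.
case: e => b i; rewrite mem_cat; case: b => /=.
  rewrite (mem_map (f := pair true)); last by move=> ? ? [].
  by rewrite orb_idl// => /mapP[].
rewrite (mem_map (f := pair false)); last by move=> ? ? [].
by rewrite orb_idr// => /mapP[].
Qed.

Definition relabel (s t : seq nat) (e : bool * nat) : bool * nat :=
  (e.1, nth 0%N (if e.1 then t else s) e.2).

Section two_sample_kernels.
Context {R : realType} {dS : measure_display} {S : measurableType dS} {m0 m1 : nat}.
Implicit Types (r : m0.-tuple S -> m1.-tuple S -> R) (s : m0.-tuple nat) (t : m1.-tuple nat)
  (z : bool * nat -> S).

Definition head_labels : seq (bool * nat) := labels (iota 0 m0) (iota 0 m1).

Lemma relabel_inj s t : uniq s -> uniq t -> {in head_labels &, injective (relabel s t)}.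
Proof.
move=> us ut [b i] [b' i']; rewrite !mem_labels /= => + + [bb']; rewrite -{b'}bb'.
case: b => /=; rewrite !mem_iota !add0n => i_lt i'_lt /eqP;
  by rewrite nth_uniq ?size_tuple// => /eqP ->.
Qed.

Definition sym_kernel r : Prop :=
  [/\ measurable_fun setT (fun z : m0.-tuple S * m1.-tuple S => r z.1 z.2),
      (forall (x x' : m0.-tuple S) (y : m1.-tuple S), perm_eq x x' -> r x y = r x' y) &
      (forall (x : m0.-tuple S) (y y' : m1.-tuple S), perm_eq y y' -> r x y = r x y')].

Definition kernel_at r s t z : R :=
  r [tuple z (false, tnth s i) | i < m0] [tuple z (true, tnth t j) | j < m1].

Definition kernel_head r z : R :=
  r [tuple z (false, nat_of_ord i) | i < m0] [tuple z (true, nat_of_ord j) | j < m1].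

Lemma kernel_at_relabel r s t z :
  kernel_at r s t z = kernel_head r (fun e => z (relabel s t e)).
Proof. by congr r; apply: eq_mktuple => i; rewrite /relabel /= -tnth_nth. Qed.

Variable r : m0.-tuple S -> m1.-tuple S -> R.
Hypothesis symr : sym_kernel r.

Lemma measurable_kernel (d : measure_display) (T : measurableType d)
    (Y0 : 'I_m0 -> T -> S) (Y1 : 'I_m1 -> T -> S) :
  (forall i, measurable_fun setT (Y0 i)) -> (forall j, measurable_fun setT (Y1 j)) ->
  measurable_fun setT (fun w => r [tuple Y0 i w | i < m0] [tuple Y1 j w | j < m1]).
Proof.
case: symr => mr _ _ mY0 mY1.
pose Y w := ([tuple Y0 i w | i < m0], [tuple Y1 j w | j < m1]).
apply: (measurableT_comp mr (g := Y)); apply: measurable_fun_pair.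
  apply/measurable_fun_tnthP => i; rewrite (_ : _ \o _ = Y0 i)//.
  by apply/funext => w /=; rewrite tnth_mktuple.
apply/measurable_fun_tnthP => i; rewrite (_ : _ \o _ = Y1 i)//.
by apply/funext => w /=; rewrite tnth_mktuple.
Qed.

Lemma finitary_kernel_at s t : finitary (labels s t) (kernel_at r s t).
Proof.
split => [z z' zz'|d T Y mY]; last exact: measurable_kernel.
by congr r; apply: eq_mktuple => i; apply: zz'; rewrite mem_labels /= mem_tnth.
Qed.

Lemma finitary_kernel_head : finitary head_labels (kernel_head r).
Proof.
split => [z z' zz'|d T Y mY]; last exact: measurable_kernel.
by congr r; apply: eq_mktuple => i; apply: zz'; rewrite mem_labels /= mem_iota add0n ltn_ord.
Qed.

Lemma kernel_at_perm s s' t t' z : perm_eq s s' -> perm_eq t t' ->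
  kernel_at r s t z = kernel_at r s' t' z.
Proof.
case: symr => _ rs rt ss' tt'.
have perm_obs m b (q q' : m.-tuple nat) : perm_eq q q' ->
    perm_eq [tuple z (b, tnth q i) | i < m] [tuple z (b, tnth q' i) | i < m].
  have obsE (u : m.-tuple nat) :
      [tuple z (b, tnth u i) | i < m] = map (fun i => z (b, i)) u :> seq S.
    by rewrite -[X in map _ X](map_tnth_enum u) -map_comp.
  by move=> qq'; rewrite !obsE perm_map.
by rewrite /kernel_at (rs _ _ _ (perm_obs _ _ _ _ ss')) (rt _ _ _ (perm_obs _ _ _ _ tt')).
Qed.

Section exchangeable_sample.
Context {d : measure_display} {O : measurableType d} (P : probability O R)
  (X : bool * nat -> O -> S).
Hypothesis mX : forall i, measurable_fun setT (X i).
Hypothesis iX : mutually_independent P X.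
Hypothesis idX : forall i j A, measurable A -> P (X i @^-1` A) = P (X j @^-1` A).

Let finitary_sqr L (Phi : (bool * nat -> S) -> R) :
  finitary L Phi -> finitary L (fun z => Phi z ^+ 2).
Proof. by apply: (finitary_comp (g := fun x : R => x ^+ 2)); exact: measurable_funX. Qed.

Lemma Ex_sqr_kernel_at s t : uniq s -> uniq t ->
  Ex P (fun w => kernel_at r s t (X ^~ w) ^+ 2) = Ex P (fun w => kernel_head r (X ^~ w) ^+ 2).
Proof.
move=> us ut; under eq_Ex do rewrite kernel_at_relabel.
by rewrite -(Ex_reindex mX iX idX (relabel_inj us ut) (finitary_sqr finitary_kernel_head)).
Qed.

Hypothesis L2r : L2 P (fun w => kernel_head r (X ^~ w)).

Lemma L2_kernel_at s t : uniq s -> uniq t -> L2 P (fun w => kernel_at r s t (X ^~ w)).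
Proof.
move=> us ut; split; first exact: measurable_finitary (finitary_kernel_at s t) mX.
under [X in L1 P X]eq_fun do rewrite kernel_at_relabel.
apply: (L1_reindex mX iX idX (relabel_inj us ut) (finitary_sqr finitary_kernel_head)).1.
by case: L2r.
Qed.

Definition hidden (a b : nat) : pred (bool * nat) := fun e => ~~ (e.2 < if e.1 then b else a)%N.

Local Notation head_mean a b := (partial_mean P X (hidden a b) (kernel_head r)).

Lemma Ex_kernel_at_hidden (A : pred (bool * nat)) a b s t z : uniq s -> uniq t ->
  (forall i, A (false, tnth s i) = ~~ (i < a)%N) ->
  (forall j, A (true, tnth t j) = ~~ (j < b)%N) ->
  partial_mean P X A (kernel_at r s t) z = head_mean a b (fun e => z (relabel s t e)).
Proof.
move=> us ut As At.
pose Phi x := kernel_head r (fun e => if hidden a b e then x e else z (relabel s t e)).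
have finPhi : finitary head_labels Phi.
  split=> [x x' xx'|d' T Y mY].
    by apply: finitary_kernel_head.1 => e eL; case: ifP => // _; exact: xx'.
  apply: (measurable_finitary (Y := fun e w => if hidden a b e then Y e w else z (relabel s t e))
    finitary_kernel_head) => e.
  by case: (hidden a b e).
rewrite /partial_mean -/(Phi _) (Ex_reindex mX iX idX (relabel_inj us ut) finPhi).
apply: eq_Ex => w; congr r; apply: eq_mktuple => i; rewrite /relabel /= -!tnth_nth.
  by rewrite As.
by rewrite At.
Qed.

(* Conditionally on the shared observations, [kernel_at r s t] has mean [head_mean a b]
   (up to reordering), independently of the remaining arguments of [kernel_at r s' t']. *)
Lemma overlap_orthogonal s s' t t' : uniq s -> uniq t -> uniq s' -> uniq t' ->
  {ae P, forall w, head_mean (count (mem s') s) (count (mem t') t) (X ^~ w) = 0} ->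
  Ex P (fun w => kernel_at r s t (X ^~ w) * kernel_at r s' t' (X ^~ w)) = 0.
Proof.
move=> us ut us' ut'; set a := count _ _; set b := count _ _ => head_mean0.
have [so [sso so_s']] := reorder_tuple s s'.
have [to [tto to_t']] := reorder_tuple t t'.
have uso : uniq so by rewrite -(perm_uniq sso).
have uto : uniq to by rewrite -(perm_uniq tto).
pose A : pred (bool * nat) := fun e => e.2 \notin (if e.1 then t' : seq nat else s').
under eq_Ex do rewrite mulrC (kernel_at_perm _ sso tto).
have fin' := finitary_kernel_at s' t'; have fino := finitary_kernel_at so to.
have L2o := L2_kernel_at uso uto; have L2' := L2_kernel_at us' ut'.
rewrite (Ex_mul_partial_mean iX mX (A := A) fino fin' _ (L2_L1 L2o) (L2M L2' L2o)); last first.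
  by move=> e; rewrite mem_labels /A negbK.
apply: ae_eq0_Ex.
  exact: measurable_finitary (finitaryM fin' (finitary_partial_mean P mX A fino)) mX.
have finh := finitary_partial_mean P mX (hidden a b) finitary_kernel_head.
apply: filterS (ae_reindex mX iX idX (relabel_inj uso uto) finh head_mean0) => w head0.
rewrite (@Ex_kernel_at_hidden A a b)// ?head0 ?mulr0// => i; rewrite /A /=.
  by rewrite so_s'.
by rewrite to_t'.
Qed.

End exchangeable_sample.
End two_sample_kernels.

Section ustat_variance.
Context {R : realType} {p m0 m1 : nat} {d : measure_display} {O : measurableType d}
  (P : probability O R) (X : bool * nat -> O -> p.-tuple R).
Local Notation S := (p.-tuple R).
Hypothesis mX : forall i, measurable_fun setT (X i).
Hypothesis iX : mutually_independent P X.
Hypothesis idX : forall i j A, measurable A -> P (X i @^-1` A) = P (X j @^-1` A).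
Variable r : m0.-tuple S -> m1.-tuple S -> R.

Lemma hprojE a b x y : hproj P X r a b x y = Ex P (hfill X r a b x y).
Proof. by rewrite /hproj unlock. Qed.

Definition projection a b (z : bool * nat -> S) : R :=
  hproj P X r a b (fun i => z (false, i)) (fun j => z (true, j)).

Lemma projectionE a b : projection a b = partial_mean P X (hidden a b) (kernel_head r).
Proof.
apply/funext => z; rewrite /projection hprojE; apply: eq_Ex => w; congr r.
  by apply: eq_mktuple => i; rewrite /hidden /= if_neg.
by apply: eq_mktuple => j; rewrite /hidden /= if_neg.
Qed.

Hypothesis symr : sym_kernel r.
Hypothesis L2r : L2 P (fun w => kernel_head r (X ^~ w)).

Let fin_head := finitary_kernel_head symr.

Lemma L2_projection a b : L2 P (fun w => projection a b (X ^~ w)).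
Proof. by rewrite projectionE; exact: (L2_partial_mean iX mX _ fin_head L2r). Qed.

Lemma Ex_projection a b :
  Ex P (fun w => projection a b (X ^~ w)) = Ex P (fun w => kernel_head r (X ^~ w)).
Proof. by rewrite projectionE; exact: (Ex_partial_mean iX mX _ fin_head (L2_L1 L2r)). Qed.

Lemma L1_hfill_ae a b : {ae P, forall w,
  L1 P (hfill X r a b (fun i => X (false, i) w) (fun j => X (true, j) w))}.
Proof.
apply: filterS (L1_partial_ae iX mX (hidden a b) fin_head (L2_L1 L2r)) => w.
apply: eq_L1 => w'; congr r.
  by apply: eq_mktuple => i; rewrite /hidden /= if_neg.
by apply: eq_mktuple => j; rewrite /hidden /= if_neg.
Qed.

Let nat_tuple n m (s : m.-tuple 'I_n) : m.-tuple nat := [tuple of map (@nat_of_ord n) s].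

Let count_overlap n m (s s' : m.-tuple 'I_n) : increasing s ->
  count (mem (nat_tuple s')) (nat_tuple s) = #|entries s :&: entries s'|%SET.
Proof.
move=> /increasing_uniq us; rewrite /= count_map -size_filter -(card_uniqP (filter_uniq _ us)).
apply: eq_card => x; rewrite !inE mem_filter /= mem_map; last exact: val_inj.
by rewrite andbC.
Qed.

Let uniq_nat_tuple n m (s : m.-tuple 'I_n) : increasing s -> uniq (nat_tuple s).
Proof. by move=> /increasing_uniq us; rewrite map_inj_uniq//; exact: val_inj. Qed.

Let incr2 n0 n1 (q : m0.-tuple 'I_n0 * m1.-tuple 'I_n1) : bool :=
  increasing q.1 && increasing q.2.

Let sample_kernel n0 n1 (q : m0.-tuple 'I_n0 * m1.-tuple 'I_n1) (w : O) : R :=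
  kernel_at r (nat_tuple q.1) (nat_tuple q.2) (X ^~ w).

Let UstatE n0 n1 w : Ustat X r n0 n1 w = ('C(n0, m0)%:R)^-1 * ('C(n1, m1)%:R)^-1 *
  \sum_(q | @incr2 n0 n1 q) sample_kernel q w.
Proof.
rewrite /Ustat; congr (_ * _).
rewrite -(pair_big (@increasing n0 m0) (@increasing n1 m1)
  (fun s t => kernel_at r (nat_tuple s) (nat_tuple t) (X ^~ w))) /=.
by apply: eq_bigr => s _; apply: eq_bigr => t _; congr r; apply: eq_mktuple => i;
   rewrite tnth_map.
Qed.

Let L2_sample_kernel n0 n1 (q : m0.-tuple 'I_n0 * m1.-tuple 'I_n1) :
  incr2 q -> L2 P (sample_kernel q).
Proof. by move=> /andP[incr0 incr1]; apply: L2_kernel_at => //; exact: uniq_nat_tuple. Qed.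

Lemma L2_Ustat n0 n1 : L2 P (fun w => Ustat X r n0 n1 w).
Proof.
apply: (eq_L2 (fun w => esym (UstatE n0 n1 w))); apply: L2Z.
by apply: L2_sum => q; exact: L2_sample_kernel.
Qed.

(* The projections of [r] vanish for all overlap sizes not above some pair in [L]. *)
Definition degenerate_below (L : seq (nat * nat)) : Prop := forall a b, (a <= m0)%N ->
  (b <= m1)%N -> ~~ has (fun l => (l.1 <= a)%N && (l.2 <= b)%N) L ->
  {ae P, forall w, projection a b (X ^~ w) = 0}.

Let overlap n m k (s s' : m.-tuple 'I_n) : R := (k <= #|entries s :&: entries s'|%SET)%N%:R.

Let Ex_sample_kernel_mul_le (L : seq (nat * nat)) n0 n1
    (q q' : m0.-tuple 'I_n0 * m1.-tuple 'I_n1) : degenerate_below L -> incr2 q -> incr2 q' ->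
  Ex P (fun w => sample_kernel q w * sample_kernel q' w) <=
  Ex P (fun w => kernel_head r (X ^~ w) ^+ 2) *
    \sum_(l <- L) overlap l.1 q.1 q'.1 * overlap l.2 q.2 q'.2.
Proof.
move=> degen incrq incrq'; set V := Ex P (fun w => kernel_head r (X ^~ w) ^+ 2).
have V0 : 0 <= V by exact: Ex_sqr_ge0.
have sqrV (q0 : m0.-tuple 'I_n0 * m1.-tuple 'I_n1) : incr2 q0 ->
    Ex P (fun w => sample_kernel q0 w ^+ 2) = V.
  by move=> /andP[incr0 incr1]; apply: Ex_sqr_kernel_at => //; exact: uniq_nat_tuple.
have overlap_ge0 (l : nat * nat) : 0 <= overlap l.1 q.1 q'.1 * overlap l.2 q.2 q'.2.
  by rewrite mulr_ge0.
have [/hasP[l lL /andP[l1 l2]]|disjoint] := boolP (has (fun l =>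
    (l.1 <= #|entries q.1 :&: entries q'.1|%SET)%N &&
    (l.2 <= #|entries q.2 :&: entries q'.2|%SET)%N) L).
  apply: (@le_trans _ _ V).
    have := Ex_cauchy_schwarz (L2_sample_kernel incrq) (L2_sample_kernel incrq').
    rewrite !sqrV// -expr2 => cauchy_schwarz.
    by rewrite (le_trans (ler_norm _))// -(ler_pXn2r (n := 2)) ?nnegrE// real_normK ?num_real.
  rewrite -[leLHS]mulr1 ler_wpM2l// (big_rem l)//= {1}/overlap l1 {1}/overlap l2 mulr1 lerDl.
  exact: sumr_ge0.
rewrite [leLHS](_ : _ = 0) ?mulr_ge0 ?sumr_ge0//.
case/andP: incrq incrq' => incr0 incr1 /andP[incr0' incr1'].
apply: overlap_orthogonal => //; [exact: uniq_nat_tuple..|].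
rewrite !count_overlap// -projectionE; apply: degen => //.
  by rewrite (leq_trans (subset_leq_card (finset.subsetIl _ _)))// card_entries.
by rewrite (leq_trans (subset_leq_card (finset.subsetIl _ _)))// card_entries.
Qed.

Lemma ustat_variance (L : seq (nat * nat)) n0 n1 : degenerate_below L ->
  Ex P (fun w => Ustat X r n0 n1 w ^+ 2) <= Ex P (fun w => kernel_head r (X ^~ w) ^+ 2) *
    \sum_(l <- L) ('C(m0, l.1)%:R * (m0%:R / n0%:R) ^+ l.1) *
                  ('C(m1, l.2)%:R * (m1%:R / n1%:R) ^+ l.2).
Proof.
move=> degen; set V := Ex P (fun w => kernel_head r (X ^~ w) ^+ 2).
have V0 : 0 <= V by exact: Ex_sqr_ge0.
pose c0 : R := ('C(n0, m0)%:R)^-1; pose c1 : R := ('C(n1, m1)%:R)^-1.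
under eq_Ex do rewrite UstatE.
rewrite Ex_sqrZ; last by apply: L2_sum => q; exact: L2_sample_kernel.
rewrite Ex_sqr_sum => [|q]; last exact: L2_sample_kernel.
apply: (@le_trans _ _ ((c0 * c1) ^+ 2 * \sum_(q | @incr2 n0 n1 q) \sum_(q' | @incr2 n0 n1 q')
    V * \sum_(l <- L) overlap l.1 q.1 q'.1 * overlap l.2 q.2 q'.2)).
  apply: ler_wpM2l; first exact: sqr_ge0.
  by apply: ler_sum => q incrq; apply: ler_sum => q'; exact: Ex_sample_kernel_mul_le.
under eq_bigr => q _ do rewrite -mulr_sumr exchange_big.
rewrite -mulr_sumr exchange_big mulrCA exprMn ler_wpM2l// mulr_sumr; apply: ler_sum => l _.
rewrite (sum_prod_pairs (@increasing n0 m0) (@increasing n1 m1) (overlap l.1) (overlap l.2)).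
by rewrite mulrACA; apply: ler_pM; [rewrite mulr_ge0 ?sqr_ge0 ?sumr_ge0// => s _;
   exact: sumr_ge0..|exact: sum_overlap_le|exact: sum_overlap_le].
Qed.

End ustat_variance.

(** * Kernels which are sums over single cases or over pairs of cases *)

Section sums_over_increasing_tuples.
Context {R : realType} (n m : nat).
Local Open Scope set_scope.

Lemma sum_increasing_const (c : R) :
  \sum_(t : m.-tuple 'I_n | increasing t) c = 'C(n, m)%:R * c.
Proof.
rewrite (sum_increasing m (fun=> c)) sumr_const mulr_natl; congr (_ *+ _).
by have := card_draws 'I_n m; rewrite card_ord => <-; apply: eq_card => A; rewrite !inE.
Qed.

Let sum_tnth (t : m.-tuple 'I_n) (c : 'I_n -> R) : increasing t ->
  \sum_(i < m) c (tnth t i) = \sum_(x in entries t) c x.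
Proof.
move=> /increasing_uniq ut; rewrite -(big_tuple _ _ t predT) /= big_uniq//=.
by apply: eq_bigl => x; rewrite inE.
Qed.

Lemma sum_increasing_single (c : 'I_n -> R) : (0 < m)%N ->
  \sum_(t : m.-tuple 'I_n | increasing t) \sum_(i < m) c (tnth t i) =
  'C(n - 1, m - 1)%:R * \sum_(i < n) c i.
Proof.
move=> m_gt0; under eq_bigr => t it do rewrite sum_tnth//.
rewrite (sum_increasing m (fun A : {set 'I_n} => \sum_(x in A) c x)).
under eq_bigr => A _ do rewrite big_mkcond /=.
rewrite exchange_big mulr_sumr; apply: eq_bigr => x _ /=.
rewrite -[X in 'C(n - X, _)](cards1 x) -[X in 'C(_, m - X)](cards1 x).
rewrite -sum_supersets ?cards1// mulr_suml; apply: eq_bigr => A _.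
by rewrite finset.sub1set; case: (x \in A); rewrite ?mul1r ?mul0r.
Qed.

Let sum_tnth_pairs (t : m.-tuple 'I_n) (c : 'I_n -> 'I_n -> R) : increasing t ->
  \sum_(i < m) \sum_(j < m | j != i) c (tnth t i) (tnth t j) =
  \sum_(x < n) \sum_(y < n | y != x) ([set x; y] \subset entries t)%:R * c x y.
Proof.
move=> incrt; transitivity (\sum_(x in entries t) \sum_(y in entries t | y != x) c x y).
  rewrite -(sum_tnth (fun x => \sum_(y in entries t | y != x) c x y) incrt).
  apply: eq_bigr => i _; rewrite [RHS]big_mkcondr [LHS]big_mkcond /=.
  rewrite -(sum_tnth (fun y => if y != tnth t i then c (tnth t i) y else 0) incrt).
  apply: eq_bigr => j _; congr (if ~~ _ then _ else _).
  by apply/eqP/eqP => [->//|]; move/tuple_uniqP : (increasing_uniq incrt); apply.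
rewrite big_mkcond; apply: eq_bigr => x _; rewrite big_mkcondl /=.
case: ifP => xt; last first.
  by rewrite big1// => y _; rewrite finset.subUset !finset.sub1set xt mul0r.
apply: eq_bigr => y _; rewrite finset.subUset !finset.sub1set xt.
by case: (y \in _); rewrite ?mul1r ?mul0r.
Qed.

Lemma sum_increasing_pairs (c : 'I_n -> 'I_n -> R) : (1 < m)%N ->
  \sum_(t : m.-tuple 'I_n | increasing t)
    \sum_(i < m) \sum_(j < m | j != i) c (tnth t i) (tnth t j) =
  'C(n - 2, m - 2)%:R * \sum_(i < n) \sum_(j < n | j != i) c i j.
Proof.
move=> m_gt1; under eq_bigr => t incrt do rewrite sum_tnth_pairs//.
rewrite (sum_increasing m (fun A : {set 'I_n} =>
  \sum_(x < n) \sum_(y < n | y != x) ([set x; y] \subset A)%:R * c x y)).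
rewrite exchange_big mulr_sumr; apply: eq_bigr => x _ /=.
rewrite exchange_big mulr_sumr; apply: eq_bigr => y yx /=.
have card_xy : #|[set x; y]| = 2%N by rewrite cards2 eq_sym yx.
by rewrite -mulr_suml sum_supersets card_xy.
Qed.

End sums_over_increasing_tuples.

Section pairs_of_observations.
Context {d dS : measure_display} {O : measurableType d} {S : measurableType dS}
  {R : realType} {I : eqType} (P : probability O R) (X : I -> O -> S) (F : probability S R).
Hypothesis mX : forall i, measurable_fun setT (X i).
Hypothesis iX : mutually_independent P X.
Hypothesis FX : forall e A, measurable A -> P (X e @^-1` A) = F A.
Variable k : S -> S -> R.
Hypothesis L2k : L2 (F \x F)%E (fun z => k z.1 z.2).

Let mk : measurable_fun setT (fun z : S * S => k z.1 z.2) := L2_measurable L2k.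

Lemma L2_pair e e' : e != e' -> L2 P (fun w => k (X e w) (X e' w)).
Proof.
by move=> ee'; exact/(L2_law (measurable_sample_pair mX e e') (pair_law mX iX FX ee') mk).
Qed.

Definition centered_at x : Prop := L1 F (k x) /\ Ex F (k x) = 0.

Hypothesis symk : forall x y, k x y = k y x.
Hypothesis degk : {ae F, forall x, Ex F (k x) = 0}.

Lemma centered_at_ae : {ae F, forall x, centered_at x}.
Proof. exact: filterS2 (L1_slice_ae (L2_L1 L2k)) degk. Qed.

Lemma Ex_degenerate : Ex (F \x F)%E (fun z => k z.1 z.2) = 0.
Proof.
rewrite Ex_fubini; last exact: L2_L1.
by apply: ae_eq0_Ex degk; exact: measurable_Ex_slice mk.
Qed.

Lemma partial_mean_pair A e e' z : e != e' -> centered_at (z e) -> centered_at (z e') ->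
  L1 P (fun w => k (if A e then X e w else z e) (if A e' then X e' w else z e')) /\
  partial_mean P X A (fun x => k (x e) (x e')) z =
  if A e || A e' then 0 else k (z e) (z e').
Proof.
move=> ee' [Lz Ez] [Lz' Ez']; rewrite /partial_mean.
have mslice x : measurable_fun setT (k x) := measurable_slice1 x mk.
case: (A e); case: (A e') => /=.
- split; first by apply: L2_L1; exact: L2_pair.
  by rewrite -[RHS]Ex_degenerate (Ex_law (measurable_sample_pair mX _ _) (pair_law mX iX FX ee') mk).
- under [X in L1 P X]eq_fun do rewrite symk; under eq_Ex do rewrite symk.
  by split; [exact/(L1_law (mX e) (FX e))|rewrite (Ex_law (mX e) (FX e))].
- by split; [exact/(L1_law (mX e') (FX e'))|rewrite (Ex_law (mX e') (FX e'))].
- by split; [exact: L1_cst|rewrite Ex_cst].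
Qed.

End pairs_of_observations.

Section additive_kernels.
Context {R : realType} {dS : measure_display} {S : measurableType dS} {m0 m1 : nat}.

Definition sumker (g : S -> R) (_ : m0.-tuple S) (y : m1.-tuple S) : R :=
  \sum_(j < m1) g (tnth y j).

Definition pairker (k : S -> S -> R) (_ : m0.-tuple S) (y : m1.-tuple S) : R :=
  2^-1 * \sum_(i < m1) \sum_(j < m1 | j != i) k (tnth y i) (tnth y j).

Lemma kernel_head_sumker (g : S -> R) z :
  kernel_head (sumker g) z = \sum_(j < m1) g (z (true, nat_of_ord j)).
Proof. by apply: eq_bigr => j _; rewrite tnth_mktuple. Qed.

Lemma kernel_head_pairker (k : S -> S -> R) z : kernel_head (pairker k) z =
  2^-1 * \sum_(i < m1) \sum_(j < m1 | j != i) k (z (true, nat_of_ord i)) (z (true, nat_of_ord j)).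
Proof.
by congr (_ * _); apply: eq_bigr => i _; apply: eq_bigr => j _; rewrite !tnth_mktuple.
Qed.

Lemma sym_kernelB (r r' : m0.-tuple S -> m1.-tuple S -> R) :
  sym_kernel r -> sym_kernel r' -> sym_kernel (fun x y => r x y - r' x y).
Proof.
move=> [mr rx ry] [mr' rx' ry']; split.
- exact: measurable_funB.
- by move=> x x' y xx'; rewrite (rx _ _ _ xx') (rx' _ _ _ xx').
- by move=> x y y' yy'; rewrite (ry _ _ _ yy') (ry' _ _ _ yy').
Qed.

Lemma sym_kernel_sumker (g : S -> R) : measurable_fun setT g -> sym_kernel (sumker g).
Proof.
move=> mg; split => // [|controls y y' yy'].
  apply: measurable_sum => j; apply: (measurableT_comp mg).
  exact: (measurableT_comp (measurable_tnth j)).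
by rewrite /sumker -!(big_tuple _ _ _ predT) /=; exact: perm_big.
Qed.

Lemma sym_kernel_pairker (k : S -> S -> R) :
  measurable_fun setT (fun z : S * S => k z.1 z.2) -> sym_kernel (pairker k).
Proof.
move=> mk; split => // [|controls y y' yy'].
  apply: measurable_funM => //; apply: measurable_sum => i.
  under eq_fun do rewrite big_mkcond; apply: measurable_sum => j; case: (j != i) => //.
  pose entry_pair (z : m0.-tuple S * m1.-tuple S) := (tnth z.2 i, tnth z.2 j).
  apply: (measurableT_comp mk (g := entry_pair)).
  by apply: measurable_fun_pair; exact: (measurableT_comp (measurable_tnth _)).
have offdiagE (u : m1.-tuple S) : \sum_(i < m1) \sum_(j < m1 | j != i) k (tnth u i) (tnth u j) =
    \sum_(x <- u) \sum_(x' <- u) k x x' - \sum_(x <- u) k x x.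
  rewrite !big_tuple -sumrB; apply: eq_bigr => i _.
  by rewrite big_tuple [in RHS](bigD1 i)//= addrAC subrr add0r.
rewrite /pairker !offdiagE !(perm_big _ yy'); congr (_ * (_ - _)).
by apply: eq_bigr => x _; exact: perm_big.
Qed.

Section iid_sample.
Context {d : measure_display} {O : measurableType d} (P : probability O R)
  (X : bool * nat -> O -> S) (F : probability S R).
Hypothesis mX : forall i, measurable_fun setT (X i).
Hypothesis iX : mutually_independent P X.
Hypothesis FX : forall e A, measurable A -> P (X e @^-1` A) = F A.

Lemma L2_sumker (g : S -> R) : L2 F g -> L2 P (fun w => kernel_head (sumker g) (X ^~ w)).
Proof.
move=> L2g; under eq_fun do rewrite kernel_head_sumker.
by apply: L2_sum => j _; apply/(L2_law (mX _) (FX _)) => //; exact: L2_measurable L2g.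
Qed.

Lemma partial_mean_sumker (g : S -> R) A z : L2 F g -> Ex F g = 0 ->
  partial_mean P X A (kernel_head (sumker g)) z =
  \sum_(j < m1 | ~~ A (true, nat_of_ord j)) g (z (true, nat_of_ord j)).
Proof.
move=> L2g Eg; have mg := L2_measurable L2g.
have LgX e : L1 P (fun w => g (X e w)) by exact/(L1_law (mX e) (FX e))/L2_L1.
rewrite /partial_mean; under eq_Ex do rewrite kernel_head_sumker.
rewrite Ex_sum => [|j _]; last by case: (A _) => //; exact: L1_cst.
rewrite [RHS]big_mkcond; apply: eq_bigr => j _; case: (A _) => /=; last by rewrite Ex_cst.
by rewrite (Ex_law (mX _) (FX _)).
Qed.

Section pair_kernel.
Variable k : S -> S -> R.
Hypothesis L2k : L2 (F \x F)%E (fun z => k z.1 z.2).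

Let case_neq (i j : 'I_m1) : j != i -> (true, nat_of_ord i) != (true, nat_of_ord j).
Proof. by apply: contraNneq => -[ij]; rewrite eq_sym; exact/eqP/val_inj. Qed.

Lemma L2_pairker : L2 P (fun w => kernel_head (pairker k) (X ^~ w)).
Proof.
under eq_fun do rewrite kernel_head_pairker.
apply: L2Z; apply: L2_sum => i _; apply: L2_sum => j /case_neq ij.
exact: (L2_pair mX iX FX L2k ij).
Qed.

Hypothesis symk : forall x y, k x y = k y x.
Hypothesis degk : {ae F, forall x, Ex F (k x) = 0}.

Lemma partial_mean_pairker A : {ae P, forall w,
  partial_mean P X A (kernel_head (pairker k)) (X ^~ w) =
  2^-1 * \sum_(i < m1 | ~~ A (true, nat_of_ord i))
    \sum_(j < m1 | (j != i) && ~~ A (true, nat_of_ord j))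
      k (X (true, nat_of_ord i) w) (X (true, nat_of_ord j) w)}.
Proof.
have centered : {ae P, forall w, forall i : 'I_m1, centered_at F k (X (true, nat_of_ord i) w)}.
  by apply: filter_forall => i; exact: (ae_law (mX _) (FX _) (centered_at_ae L2k degk)).
apply: filterS centered => w centered.
have pair i j (ji : j != i) := partial_mean_pair mX iX FX L2k symk degk A
  (z := X ^~ w) (case_neq ji) (centered i) (centered j).
rewrite [LHS]/partial_mean; under eq_Ex do rewrite kernel_head_pairker.
rewrite ExZ; last first.
  by apply: L1_sum => i _; apply: L1_sum => j ji; exact: (pair i j ji).1.
congr (_ * _); rewrite Ex_sum => [|i _]; last first.
  by apply: L1_sum => j ji; exact: (pair i j ji).1.
rewrite [RHS]big_mkcond; apply: eq_bigr => i _.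
rewrite Ex_sum => [|j ji]; last exact: (pair i j ji).1.
rewrite (eq_bigr _ (fun j ji => (pair i j ji).2)) big_mkcondr /=.
case: (A (true, nat_of_ord i)) => /=; first by rewrite big1.
by apply: eq_bigr => j _; rewrite if_neg.
Qed.

End pair_kernel.
End iid_sample.
End additive_kernels.

Section additive_ustats.
Context {R : realType} {p m0 m1 : nat} {d : measure_display} {O : measurableType d}
  (X : bool * nat -> O -> p.-tuple R).
Local Notation S := (p.-tuple R).

Lemma UstatB (r r' : m0.-tuple S -> m1.-tuple S -> R) n0 n1 w :
  Ustat X (fun x y => r x y - r' x y) n0 n1 w = Ustat X r n0 n1 w - Ustat X r' n0 n1 w.
Proof.
rewrite /Ustat -mulrBr -sumrB; congr (_ * _).
by apply: eq_bigr => s _; rewrite -sumrB.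
Qed.

Let Ustat_case_kernel (g : m1.-tuple S -> R) n0 n1 w : (m0 <= n0)%N ->
  Ustat X (fun (_ : m0.-tuple S) y => g y) n0 n1 w = ('C(n1, m1)%:R)^-1 *
  \sum_(t : m1.-tuple 'I_n1 | increasing t)
    g [tuple X (true, nat_of_ord (tnth t j)) w | j < m1].
Proof.
move=> mn; rewrite /Ustat sum_increasing_const mulrA; congr (_ * _).
by rewrite mulrAC mulVf ?mul1r// pnatr_eq0 -lt0n bin_gt0.
Qed.

Lemma Ustat_sumker (g : S -> R) n0 n1 w : (m0 <= n0)%N -> (0 < m1)%N -> (m1 <= n1)%N ->
  Ustat X (sumker g : m0.-tuple S -> m1.-tuple S -> R) n0 n1 w =
  m1%:R / n1%:R * \sum_(i < n1) g (X (true, nat_of_ord i) w).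
Proof.
move=> mn0 m1_gt0 mn1; rewrite Ustat_case_kernel//.
under eq_bigr do under eq_bigr do rewrite tnth_mktuple.
rewrite (sum_increasing_single (fun i => g (X (true, nat_of_ord i) w)))// mulrA; congr (_ * _).
have n1_gt0 : (0 < n1)%N by exact: leq_trans mn1.
apply/eqP; rewrite mulrC eqr_div ?pnatr_eq0 -?lt0n ?bin_gt0// -!natrM; apply/eqP; congr _%:R.
by have := mul_bin_diag n1 (m1 - 1); rewrite [in X in _ = X -> _]subn1 prednK// -subn1 mulnC.
Qed.

Lemma mul_bin_diag2 n m : (1 < m)%N -> (m <= n)%N ->
  (n * n.-1 * 'C(n - 2, m - 2) = m * m.-1 * 'C(n, m))%N.
Proof.
case: m => [|[|m]]// _; case: n => [|[|n]]// _; rewrite !subSS !subn0 /=.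
rewrite -mulnA; have -> := mul_bin_diag n.+1 m; rewrite mulnCA.
by have -> := mul_bin_diag n.+2 m.+1; rewrite mulnCA mulnA.
Qed.

Lemma Ustat_pairker (k : S -> S -> R) n0 n1 w : (m0 <= n0)%N -> (1 < m1)%N -> (m1 <= n1)%N ->
  Ustat X (pairker k : m0.-tuple S -> m1.-tuple S -> R) n0 n1 w =
  m1%:R * (m1%:R - 1) / 2 * ((n1%:R * (n1%:R - 1))^-1 *
  \sum_(i < n1) \sum_(j < n1 | j != i) k (X (true, nat_of_ord i) w) (X (true, nat_of_ord j) w)).
Proof.
move=> mn0 m1_gt1 mn1; rewrite Ustat_case_kernel// -mulr_sumr.
under eq_bigr do under eq_bigr do under eq_bigr do rewrite !tnth_mktuple.
rewrite (sum_increasing_pairs (fun i j => k (X (true, nat_of_ord i) w) (X (true, nat_of_ord j) w)))//.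
rewrite !mulrA; congr (_ * _).
have n1_gt1 : (1 < n1)%N by exact: leq_trans mn1.
have predE n : (1 < n)%N -> n%:R - 1 = n.-1%:R :> R by case: n => // n _; rewrite -natr1 addrK.
have C0 : 'C(n1, m1)%:R != 0 :> R by rewrite pnatr_eq0 -lt0n bin_gt0.
have n1_neq0 : n1%:R != 0 :> R by rewrite pnatr_eq0 -lt0n ltnW.
have n1B1_neq0 : n1.-1%:R != 0 :> R by rewrite pnatr_eq0 -lt0n -ltnS prednK// ltnW.
rewrite !predE//; have /(congr1 (fun n => n%:R : R)) := mul_bin_diag2 m1_gt1 mn1.
rewrite !natrM => /(canRL (mulKf (mulf_neq0 n1_neq0 n1B1_neq0))) ->.
by field; rewrite C0 n1_neq0 n1B1_neq0.
Qed.

End additive_ustats.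

(** * Completeness of L2 *)

Lemma cvg0_dominated {R : realType} (a b : nat -> R) : (forall n, `|a n| <= b n) ->
  b n @[n --> \oo] --> (0 : R) -> a n @[n --> \oo] --> (0 : R).
Proof.
move=> ab b0; apply: norm_cvg0.
apply: (@squeeze_cvgr _ _ _ _ (fun=> 0) b) => //; last exact: cvg_cst.
by apply: nearW => n; rewrite normr_ge0 ab.
Qed.

Section L2_completeness.
Context {d : measure_display} {T : measurableType d} {R : realType} (P : probability T R).
Implicit Types (u : nat -> T -> R).

Lemma ae_cvg_series (f_ : nat -> T -> R) (M : R) : (forall k, L1 P (f_ k)) ->
  (forall n, \sum_(0 <= k < n) Ex P (fun x => `|f_ k x|) <= M) ->
  {ae P, forall x, cvgn (series (f_ ^~ x))}.
Proof.
move=> Lf sum_le; pose total x := (\sum_(0 <= k <oo) `|f_ k x|%:E)%E.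
have mnorm k : measurable_fun setT (fun x => `|f_ k x|%:E).
  by apply/measurable_EFinP/measurableT_comp => //; exact: L1_measurable (Lf k).
have total_ge0 x : (0 <= total x)%E by apply: nneseries_ge0 => k _ _; rewrite lee_fin.
have mtotal : measurable_fun setT total.
  apply: (emeasurable_fun_cvg (fun n x => \sum_(0 <= k < n) `|f_ k x|%:E)%E).
    by move=> n; exact: emeasurable_sum.
  by move=> x _; apply: is_cvg_nneseries => k _ _; rewrite lee_fin.
have total_integrable : P.-integrable setT total.
  apply/integrableP; split => //; under eq_integral do rewrite gee0_abs//.
  rewrite integral_nneseries//; apply: (@le_lt_trans _ _ M%:E); last exact: ltey.
  apply: lime_le; first by apply: is_cvg_nneseries => k _ _; exact: integral_ge0.
  apply: nearW => n; under eq_bigr do rewrite (L1_int (L1_norm (Lf _))).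
  by rewrite sumEFin lee_fin.
apply: filterS (integrable_ae measurableT total_integrable) => x /(_ I) total_fin.
apply: normed_cvg; apply: nondecreasing_is_cvgn.
  by apply: nondecreasing_series => k _ _ /=.
exists (fine (total x)) => _ [n _ <-]; rewrite -lee_fin fineK// /series /= -sumEFin.
by apply: nneseries_lim_ge => k _ _; rewrite lee_fin.
Qed.

Lemma ae_cvg_measurable u : (forall k, measurable_fun setT (u k)) ->
  {ae P, forall x, cvgn (u ^~ x)} ->
  exists2 v : T -> R, measurable_fun setT v & {ae P, forall x, u k x @[k --> \oo] --> v x}.
Proof.
move=> mu cvgu; exists (fun x => fine (limn_esup (fun k => (u k x)%:E))).
  apply: measurableT_comp => //; apply: measurable_fun_limn_esup => k.
  exact/measurable_EFinP.
apply: filterS cvgu => x cvgux; have cvgE : (u k x)%:E @[k --> \oo] --> (lim (u ^~ x @ \oo))%:E.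
  by apply: cvg_EFin => //; exact: nearW.
by rewrite (cvg_limn_einf_sup cvgE).2.
Qed.

Definition L2_cauchy u : Prop := forall e, 0 < e -> exists N, forall n m,
  (N <= n)%N -> (N <= m)%N -> Ex P (fun x => (u n x - u m x) ^+ 2) <= e.

Lemma fast_subsequence u : L2_cauchy u -> exists nk : nat -> nat, (forall k, (k <= nk k)%N) /\
  forall k, Ex P (fun x => (u (nk k.+1) x - u (nk k) x) ^+ 2) <= (2^-1) ^+ k ^+ 2.
Proof.
move=> cauchy; have quarter k : 0 < (2^-1 : R) ^+ k ^+ 2 by rewrite !exprn_gt0.
have [N near_N] := choice (fun k => cauchy _ (quarter k)).
pose nk k := (k + \sum_(i < k.+1) N i)%N.
have N_le k j : (k <= j)%N -> (N k <= nk j)%N.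
  move=> kj; rewrite /nk (bigD1 (Ordinal (kj : (k < j.+1)%N))) //=.
  by rewrite addnCA leq_addr.
by exists nk; split => k; [exact: leq_addr|apply: near_N; exact: N_le].
Qed.

Lemma ae_cvg_fast_L2 u : (forall k, L2 P (u k)) ->
  (forall k, Ex P (fun x => (u k.+1 x - u k x) ^+ 2) <= (2^-1) ^+ k ^+ 2) ->
  {ae P, forall x, cvgn (u ^~ x)}.
Proof.
move=> L2u fast; have L2d k : L2 P (fun x => u k.+1 x - u k x) by exact: L2B.
have norm_le k : Ex P (fun x => `|u k.+1 x - u k x|) <= (2^-1) ^+ k.
  by apply: Ex_norm_le_sqrt => //; rewrite exprn_ge0.
have geometric n : \sum_(0 <= k < n) (2^-1 : R) ^+ k <= 2.
  have -> : \sum_(0 <= k < n) (2^-1 : R) ^+ k = 2 - 2 * (2^-1) ^+ n.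
    elim: n => [|n IH]; first by rewrite big_geq// expr0; lra.
    by rewrite big_nat_recr//= IH exprS; lra.
  by rewrite gerBl mulr_ge0// exprn_ge0.
apply: filterS (ae_cvg_series (fun k => L2_L1 (L2d k)) (M := 2) _) => [x|n]; last first.
  by apply: le_trans (geometric n); apply: ler_sum.
have -> : series (fun k => u k.+1 x - u k x) = fun n => u n x - u 0%N x.
  by apply/funext => n; rewrite /series /= (telescope_sumr (u ^~ x)).
move=> cvgB; have -> : u ^~ x = fun n => (u n x - u 0%N x) + u 0%N x.
  by apply/funext => n; rewrite subrK.
by apply: is_cvgD => //; exact: is_cvg_cst.
Qed.

Definition cvg_L2 u (v : T -> R) : Prop :=
  Ex P (fun x => (u n x - v x) ^+ 2) @[n --> \oo] --> (0 : R).

Lemma cvg_L2_le u v (B : nat -> R) : (forall n, Ex P (fun x => (u n x - v x) ^+ 2) <= B n) ->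
  B n @[n --> \oo] --> (0 : R) -> cvg_L2 u v.
Proof.
by move=> uvB; apply: cvg0_dominated => n; rewrite ger0_norm ?Ex_sqr_ge0.
Qed.

Lemma cvg_L2Z u v (c : R) : (forall n, L2 P (u n)) -> L2 P v -> cvg_L2 u v ->
  cvg_L2 (fun n x => c * u n x) (fun x => c * v x).
Proof.
move=> Lu Lv uv; apply: (cvg_L2_le (B := fun n => c ^+ 2 * Ex P (fun x => (u n x - v x) ^+ 2))).
  by move=> n; rewrite -Ex_sqrZ; [under eq_Ex do rewrite -mulrBr|exact: L2B].
by rewrite -[X in _ --> X](mulr0 (c ^+ 2)); apply: cvgM => //; exact: cvg_cst.
Qed.

Let cvg_double (a b : nat -> R) : a n @[n --> \oo] --> (0 : R) -> b n @[n --> \oo] --> (0 : R) ->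
  2 * a n + 2 * b n @[n --> \oo] --> (0 : R).
Proof.
move=> a0 b0; rewrite -[X in _ --> X](mulr0 2) -[X in 2 * X]addr0.
under eq_fun do rewrite -mulrDr.
by apply: cvgM; [exact: cvg_cst|exact: cvgD].
Qed.

Lemma cvg_L2D u u' v v' : (forall n, L2 P (u n)) -> (forall n, L2 P (u' n)) ->
  L2 P v -> L2 P v' -> cvg_L2 u v -> cvg_L2 u' v' ->
  cvg_L2 (fun n x => u n x + u' n x) (fun x => v x + v' x).
Proof.
move=> Lu Lu' Lv Lv' uv uv'; apply: cvg_L2_le (cvg_double uv uv') => n.
by under eq_Ex do rewrite opprD addrACA; exact: Ex_sqrD_le (L2B (Lu n) Lv) (L2B (Lu' n) Lv').
Qed.

Lemma cvg_L2_unique u v v' : (forall n, L2 P (u n)) -> L2 P v -> L2 P v' ->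
  cvg_L2 u v -> cvg_L2 u v' -> {ae P, forall x, v x = v' x}.
Proof.
move=> Lu Lv Lv' uv uv'; apply: Ex_sqrB_eq0_ae => //; apply/eqP.
rewrite eq_le Ex_sqr_ge0 andbT -(cvg_lim _ (cvg_double uv uv'))//.
apply: limr_ge; first exact: cvgP (cvg_double uv uv').
apply: nearW => n; have := Ex_sqrD_le (L2B Lv (Lu n)) (L2B (Lu n) Lv').
under eq_Ex do rewrite addrA subrK.
by under [X in _ <= 2 * X + _]eq_Ex do rewrite -sqrrN opprB.
Qed.

Lemma cvg_L2_inner u v w : (forall n, L2 P (u n)) -> L2 P v -> L2 P w -> cvg_L2 u v ->
  Ex P (fun x => u n x * w x) @[n --> \oo] --> Ex P (fun x => v x * w x).
Proof.
move=> Lu Lv Lw uv; pose C := Ex P (fun x => w x ^+ 2).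
have dist_le n : `|Ex P (fun x => u n x * w x) - Ex P (fun x => v x * w x)| <=
    Num.sqrt (Ex P (fun x => (u n x - v x) ^+ 2) * C).
  rewrite -ExB; [|exact: L2M..]; rewrite -sqrtr_sqr ler_wsqrtr//.
  under eq_Ex do rewrite -mulrBl; exact: Ex_cauchy_schwarz (L2B (Lu n) Lv) Lw.
apply/subr_cvg0; apply: (cvg0_dominated dist_le).
rewrite -[X in _ --> X]sqrtr0 -[X in Num.sqrt X](mul0r C).
apply: continuous_cvg; first exact: sqrt_continuous.
by apply: cvgM => //; exact: cvg_cst.
Qed.

Lemma L2_cauchy_gram u (c : R) : (forall n, L2 P (u n)) ->
  (forall e, 0 < e -> exists N, forall n m, (N <= n)%N -> (N <= m)%N ->
     `|Ex P (fun x => u n x * u m x) - c| <= e) -> L2_cauchy u.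
Proof.
move=> Lu gram e e0; have [N near_c] := gram (e / 4) (divr_gt0 e0 (ltr0n _ 4)).
exists N => n m Nn Nm; rewrite Ex_sqrB//.
under [X in X - _ + _]eq_Ex do rewrite expr2; under [X in _ + X <= _]eq_Ex do rewrite expr2.
move: (near_c n n Nn Nn) (near_c n m Nn Nm) (near_c m m Nm Nm).
by rewrite !ler_norml => /andP[? ?] /andP[? ?] /andP[? ?]; lra.
Qed.

Lemma L2_complete u : (forall n, L2 P (u n)) -> L2_cauchy u ->
  exists2 v, L2 P v & cvg_L2 u v.
Proof.
move=> L2u cauchy; have [nk [nk_ge fast]] := fast_subsequence cauchy.
have L2w k : L2 P (u (nk k)) by [].
have [v mv cvgv] := ae_cvg_measurable (fun k => L2_measurable (L2w k)) (ae_cvg_fast_L2 L2w fast).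
have near_v e : 0 < e -> exists N, forall n, (N <= n)%N ->
    L1 P (fun x => (u n x - v x) ^+ 2) /\ Ex P (fun x => (u n x - v x) ^+ 2) <= e.
  move=> e0; have [N near_N] := cauchy _ e0; exists N => n Nn.
  apply: (L1_fatou (f_ := fun k x => (u n x - u (nk k) x) ^+ 2)).
  - by move=> k; case: (L2B (L2u n) (L2w k)).
  - by move=> k x; exact: sqr_ge0.
  - by apply: measurable_funX; apply: measurable_funB mv; exact: L2_measurable (L2u n).
  - apply: filterS cvgv => x cvgvx.
    have cvgd : u n x - u (nk k) x @[k --> \oo] --> u n x - v x.
      by apply: cvgB; [exact: cvg_cst|exact: cvgvx].
    exact: (cvgM cvgd cvgd).
  - by exists N => // k /= Nk; apply: near_N => //; exact: leq_trans Nk (nk_ge k).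
exists v.
  have [N /(_ N (leqnn N)) [L1d _]] := near_v 1 ltr01.
  have L2d : L2 P (fun x => u N x - v x).
    by split=> //; apply: measurable_funB mv; exact: L2_measurable (L2u N).
  by apply: eq_L2 (L2B (L2u N) L2d) => x; rewrite subKr.
apply/cvgrPdist_le => e e0; have [N near_N] := near_v e e0.
exists N => // n /= Nn; rewrite sub0r normrN ger0_norm ?Ex_sqr_ge0//.
by have [] := near_N n Nn.
Qed.

End L2_completeness.

Lemma rectangles_ae0 {d d' : measure_display} {T : measurableType d} {T' : measurableType d'}
    {R : realType} (P : probability T R) (Q : probability T' R) (f : T * T' -> R) :
  L1 (P \x Q)%E f ->
  (forall A B, measurable A -> measurable B ->
     Ex (P \x Q)%E (fun z => \1_A z.1 * \1_B z.2 * f z) = 0) ->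
  {ae (P \x Q)%E, forall z, f z = 0}.
Proof.
move=> Lf rect; have mf : measurable_fun setT (fun z => (f z)%:E) by exact: measurable_int Lf.
have rectE A B : measurable A -> measurable B ->
    (\int[(P \x Q)%E]_(z in A `*` B) (f z)%:E = 0)%E.
  move=> mA mB; have mAB : measurable (A `*` B) by exact: measurableX.
  rewrite -[RHS]/((0 : R)%:E) -(rect A B mA mB) integral_mkcond -L1_int.
    apply: eq_integral => z _; rewrite patchE !indicE in_setX -natrM mulnb.
    by case: (_ && _); rewrite ?mul1r ?mul0r.
  apply: L1_dom (L1_norm Lf); last first.
    by move=> z; rewrite -mulrA !normrM !indicE; do 2 case: (_ \in _); rewrite ?normr1 ?normr0 ?mul1r ?mul0r.
  by apply: measurable_funM; [apply: measurable_funM; apply: measurableT_comp => //;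
    exact: measurable_indic|exact/measurable_EFinP].
have intT : (\int[(P \x Q)%E]_(z in setT) (f z)%:E = 0)%E by rewrite -setXTT rectE.
suff int0 C : measurable C -> (\int[(P \x Q)%E]_(z in C) (f z)%:E = 0)%E.
  have : ae_eq (P \x Q)%E setT (fun z => (f z)%:E) (cst 0%E).
    by apply: integral_ae_eq => // C _ mC; rewrite int0// integral0.
  by apply: filterS => z /(_ I) [].
rewrite measurable_prod_measurableType; move: C.
apply: dynkin_induction => //=.
- by rewrite measurable_prod_measurableType.
- move=> _ _ [A1 mA1 [A2 mA2 <-]] [B1 mB1 [B2 mB2 <-]].
  exists (A1 `&` B1); first exact: measurableI.
  by exists (A2 `&` B2); [exact: measurableI|rewrite setXI].
- by move=> _ [A mA [B mB <-]]; exact: rectE.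
- move=> C mC intC; move: intT; rewrite -(setUv C) integral_setU//.
  + by rewrite intC add0e.
  + exact: measurableC.
  + by rewrite setUv.
  + by rewrite disj_set2E setICr.
- move=> C mC tC intC; rewrite integral_bigcup//.
    by rewrite eseries0// => k _ _; exact: intC.
  by apply: integrableS Lf => //; exact: bigcup_measurable.
Qed.

(** * Hilbert-Schmidt operators *)

Section integral_operators.
Context {d : measure_display} {S : measurableType d} {R : realType} (F : probability S R).
Local Notation FF := (F \x F)%E.
Implicit Types (k u v : S * S -> R) (g h : S -> R).

Definition integral_op k g (x : S) : R := Ex F (fun t => k (x, t) * g t).

Definition kernel_comp k u (z : S * S) : R := integral_op k (fun t => u (t, z.2)) z.1.

Definition swap_invariant k : Prop := forall x y, k (x, y) = k (y, x).

Lemma ae_fst (Q : S -> Prop) : {ae F, forall x, Q x} -> {ae FF, forall z, Q z.1}.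
Proof.
apply: (ae_law (U := fst) (P := FF)) => // A mA.
have -> : (@fst S S) @^-1` A = A `*` setT by apply/seteqP; split => [z|z []].
apply: etrans (product_measure1E F F mA measurableT) _.
by rewrite [X in (_ * X)%E](probability_setT F) mule1.
Qed.

Lemma ae_snd (Q : S -> Prop) : {ae F, forall x, Q x} -> {ae FF, forall z, Q z.2}.
Proof.
apply: (ae_law (U := snd) (P := FF)) => // A mA.
have -> : (@snd S S) @^-1` A = setT `*` A by apply/seteqP; split => [z|z []].
apply: etrans (product_measure1E F F measurableT mA) _.
by rewrite [X in (X * _)%E](probability_setT F) mul1e.
Qed.

Lemma L1_transpose k : L1 FF k -> L1 FF (fun z => k (z.2, z.1)).
Proof.
move=> Lk; have mk := L1_measurable Lk.
have mkT : measurable_fun setT (fun z : S * S => k (z.2, z.1)) by exact: measurable_swapped.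
apply/integrableP; split; first exact/measurable_EFinP.
have /integrableP[_] := Lk.
rewrite fubini_tonelli2//; last by apply: measurableT_comp => //; exact/measurable_EFinP.
by rewrite fubini_tonelli1//; apply: measurableT_comp => //; exact/measurable_EFinP.
Qed.

Lemma Ex_transpose k : L1 FF k -> Ex FF (fun z => k (z.2, z.1)) = Ex FF k.
Proof. by move=> Lk; rewrite Ex_fubini ?Ex_fubini2//; exact: L1_transpose. Qed.

Lemma L2_transpose k : L2 FF k -> L2 FF (fun z => k (z.2, z.1)).
Proof. by move=> [mk Lk]; split; [exact: measurable_swapped|exact: (L1_transpose Lk)]. Qed.

Lemma cvg_L2_transpose (u : nat -> S * S -> R) v : (forall n, L2 FF (u n)) -> L2 FF v ->
  cvg_L2 FF u v -> cvg_L2 FF (fun n z => u n (z.2, z.1)) (fun z => v (z.2, z.1)).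
Proof.
move=> Lu Lv uv; rewrite /cvg_L2; under eq_fun => n do
  rewrite (Ex_transpose (k := fun z => (u n z - v z) ^+ 2) (L2B (Lu n) Lv).2).
exact: uv.
Qed.

Lemma measurable_integral_op k g : measurable_fun setT k -> measurable_fun setT g ->
  measurable_fun setT (integral_op k g).
Proof.
move=> mk mg; apply: (measurable_Ex_slice F (f := fun z => k z * g z.2)).
by apply: measurable_funM => //; exact: measurableT_comp.
Qed.

Lemma measurable_kernel_comp k u : measurable_fun setT k -> measurable_fun setT u ->
  measurable_fun setT (kernel_comp k u).
Proof.
move=> mk mu.
apply: (measurable_Ex_slice F (f := fun q : (S * S) * S => k (q.1.1, q.2) * u (q.2, q.1.2))).
apply: measurable_funM.
  apply: (measurableT_comp mk (g := fun q : (S * S) * S => (q.1.1, q.2))).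
  by apply: measurable_fun_pair => //; exact: measurableT_comp.
apply: (measurableT_comp mu (g := fun q : (S * S) * S => (q.2, q.1.2))).
by apply: measurable_fun_pair => //; exact: measurableT_comp.
Qed.

Lemma sqr_integral_op_le_ae k g : L2 FF k -> L2 F g -> {ae F, forall x,
  integral_op k g x ^+ 2 <= Ex F (fun t => g t ^+ 2) * Ex F (fun t => k (x, t) ^+ 2)}.
Proof.
move=> Lk Lg; apply: filterS (L2_slice1_ae Lk) => x Lx.
by rewrite mulrC; exact: Ex_cauchy_schwarz.
Qed.

Lemma L2_integral_op k g : L2 FF k -> L2 F g -> L2 F (integral_op k g).
Proof.
move=> Lk Lg; have mop := measurable_integral_op (L2_measurable Lk) (L2_measurable Lg).
split => //; apply: L1_dom_ae (L1Z (Ex F (fun t => g t ^+ 2)) (L1_fubini Lk.2)).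
  exact: measurable_funX.
by apply: filterS (sqr_integral_op_le_ae Lk Lg) => x; rewrite ger0_norm// sqr_ge0.
Qed.

Lemma Ex_sqr_integral_op_le k g : L2 FF k -> L2 F g -> Ex F (fun x => integral_op k g x ^+ 2) <=
  Ex FF (fun z => k z ^+ 2) * Ex F (fun x => g x ^+ 2).
Proof.
move=> Lk Lg; have Lrow := L1_fubini Lk.2.
rewrite (Ex_fubini Lk.2) mulrC -ExZ//.
exact: le_Ex_ae (L2_integral_op Lk Lg).2 (L1Z _ Lrow) (sqr_integral_op_le_ae Lk Lg).
Qed.

Lemma sqr_kernel_comp_le_ae k u : L2 FF k -> L2 FF u -> {ae FF, forall z,
  kernel_comp k u z ^+ 2 <= Ex F (fun t => k (z.1, t) ^+ 2) * Ex F (fun t => u (t, z.2) ^+ 2)}.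
Proof.
move=> Lk Lu; apply: filterS2 (ae_fst (L2_slice1_ae Lk)) (ae_snd (L2_slice2_ae Lu)) => z Lz1 Lz2.
exact: (Ex_cauchy_schwarz Lz1 Lz2).
Qed.

Let L1_cols u : L2 FF u -> L1 F (fun y => Ex F (fun t => u (t, y) ^+ 2)).
Proof. by move=> [_ Lu]; exact: (L1_fubini (L1_transpose Lu)). Qed.

Lemma L2_kernel_comp k u : L2 FF k -> L2 FF u -> L2 FF (kernel_comp k u).
Proof.
move=> Lk Lu; have mcomp := measurable_kernel_comp (L2_measurable Lk) (L2_measurable Lu).
split => //; apply: L1_dom_ae (L1_prod (L1_fubini Lk.2) (L1_cols Lu)).
  exact: measurable_funX.
by apply: filterS (sqr_kernel_comp_le_ae Lk Lu) => z; rewrite ger0_norm// sqr_ge0.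
Qed.

Lemma Ex_sqr_kernel_comp_le k u : L2 FF k -> L2 FF u ->
  Ex FF (fun z => kernel_comp k u z ^+ 2) <=
  Ex FF (fun z => k z ^+ 2) * Ex FF (fun z => u z ^+ 2).
Proof.
move=> Lk Lu; have Lrow := L1_fubini Lk.2; have Lcol := L1_cols Lu.
rewrite (Ex_fubini Lk.2) (Ex_fubini2 Lu.2) -(Ex_prod Lrow Lcol).
exact: le_Ex_ae (L2_kernel_comp Lk Lu).2 (L1_prod Lrow Lcol) (sqr_kernel_comp_le_ae Lk Lu).
Qed.

Lemma Ex_bilinear k g h : L2 FF k -> L2 F g -> L2 F h ->
  Ex FF (fun z => k z * (g z.1 * h z.2)) = Ex F (fun x => g x * integral_op k h x).
Proof.
move=> Lk Lg Lh; rewrite Ex_fubini; last by apply: L2M => //; exact: L2_prod.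
apply: eq_Ex => x; rewrite -Ex_scale; first by apply: eq_Ex => t /=; ring.
by apply: measurable_funM; [apply: measurable_slice1; case: Lk|case: Lh].
Qed.

Lemma integral_op_adjoint k g h : L2 FF k -> swap_invariant k -> L2 F g -> L2 F h ->
  Ex F (fun x => integral_op k g x * h x) = Ex F (fun x => g x * integral_op k h x).
Proof.
move=> Lk symk Lg Lh; rewrite -(Ex_bilinear Lk Lg Lh); under eq_Ex do rewrite mulrC.
have Lgh : L2 FF (fun z => g z.1 * h z.2) := L2_prod Lg Lh.
rewrite -(Ex_bilinear Lk Lh Lg) -[RHS](Ex_transpose (L2M Lk Lgh)).
by apply: eq_Ex => z /=; rewrite symk mulrC [g z.2 * _]mulrC mulrC -surjective_pairing.
Qed.

Lemma kernel_comp_adjoint k u v : L2 FF k -> swap_invariant k -> L2 FF u -> L2 FF v ->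
  Ex FF (fun z => kernel_comp k u z * v z) = Ex FF (fun z => u z * kernel_comp k v z).
Proof.
move=> Lk symk Lu Lv; have Lku := L2_kernel_comp Lk Lu; have Lkv := L2_kernel_comp Lk Lv.
rewrite (Ex_fubini2 (L2M Lku Lv)) (Ex_fubini2 (L2M Lu Lkv)).
apply: ae_eq_Ex.
- exact: (measurable_Ex_slice2 F (L1_measurable (L2M Lku Lv))).
- exact: (measurable_Ex_slice2 F (L1_measurable (L2M Lu Lkv))).
apply: filterS2 (L2_slice2_ae Lu) (L2_slice2_ae Lv) => y Luy Lvy.
exact: (integral_op_adjoint Lk symk Luy Lvy).
Qed.

Lemma integral_op_comp k u g x : L2 F (fun t => k (x, t)) -> L2 FF u -> L2 F g ->
  integral_op k (integral_op u g) x = integral_op (kernel_comp k u) g x.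
Proof.
move=> Lk Lu Lg; have Lkg := L2M Lu (L2_prod Lk Lg).
rewrite -[LHS](Ex_bilinear Lu Lk Lg) (Ex_fubini2 Lkg); apply: eq_Ex => s /=.
rewrite mulrC -Ex_scale; first by apply: eq_Ex => t; ring.
by apply: measurable_funM; [case: Lk|apply: measurable_slice2; case: Lu].
Qed.

Lemma kernel_comp_assoc k u v : L2 FF k -> L2 FF u -> L2 FF v ->
  {ae FF, forall z, kernel_comp k (kernel_comp u v) z = kernel_comp (kernel_comp k u) v z}.
Proof.
move=> Lk Lu Lv.
apply: filterS2 (ae_fst (L2_slice1_ae Lk)) (ae_snd (L2_slice2_ae Lv)) => z Lz1 Lz2.
exact: (integral_op_comp Lz1 Lu Lz2).
Qed.

Lemma integral_opD k g h x : L2 F (fun t => k (x, t)) -> L2 F g -> L2 F h ->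
  integral_op k (fun t => g t + h t) x = integral_op k g x + integral_op k h x.
Proof.
move=> Lk Lg Lh; rewrite -ExD; [|exact: L2M..].
by apply: eq_Ex => t; rewrite mulrDr.
Qed.

Lemma integral_opZ k g (c : R) x : measurable_fun setT k -> measurable_fun setT g ->
  integral_op k (fun t => c * g t) x = c * integral_op k g x.
Proof.
move=> mk mg; rewrite -Ex_scale; first by apply: eq_Ex => t; ring.
by apply: measurable_funM => //; exact: measurable_slice1.
Qed.

Lemma kernel_compZ k u (c : R) z : measurable_fun setT k -> measurable_fun setT u ->
  kernel_comp k (fun z => c * u z) z = c * kernel_comp k u z.
Proof. by move=> mk mu; apply: integral_opZ => //; exact: measurable_slice2. Qed.

Lemma kernel_compB k u v : L2 FF k -> L2 FF u -> L2 FF v -> {ae FF, forall z,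
  kernel_comp k (fun z => u z - v z) z = kernel_comp k u z - kernel_comp k v z}.
Proof.
move=> Lk Lu Lv; apply: filterS3 (ae_fst (L2_slice1_ae Lk)) (ae_snd (L2_slice2_ae Lu))
  (ae_snd (L2_slice2_ae Lv)) => z Lkz Luz Lvz.
rewrite /kernel_comp /integral_op -ExB; [|exact: (L2M Lkz Luz)|exact: (L2M Lkz Lvz)].
by apply: eq_Ex => t; rewrite mulrBr.
Qed.

Lemma Ex_sqr_kernel_compB_le k u v : L2 FF k -> L2 FF u -> L2 FF v ->
  Ex FF (fun z => (kernel_comp k u z - kernel_comp k v z) ^+ 2) <=
  Ex FF (fun z => k z ^+ 2) * Ex FF (fun z => (u z - v z) ^+ 2).
Proof.
move=> Lk Lu Lv; apply: le_trans (Ex_sqr_kernel_comp_le Lk (L2B Lu Lv)).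
rewrite (ae_eq_Ex_sqr (g := kernel_comp k (fun z => u z - v z)))//.
- exact: L2_measurable (L2B (L2_kernel_comp Lk Lu) (L2_kernel_comp Lk Lv)).
- exact: L2_measurable (L2_kernel_comp Lk (L2B Lu Lv)).
- by apply: filterS (kernel_compB Lk Lu Lv) => z ->.
Qed.

Lemma kernel_comp_eq_ae k u v : L2 FF k -> L2 FF u -> L2 FF v ->
  {ae FF, forall z, u z = v z} -> {ae FF, forall z, kernel_comp k u z = kernel_comp k v z}.
Proof.
move=> Lk Lu Lv uv; apply: Ex_sqrB_eq0_ae; [exact: L2_kernel_comp..|apply/eqP].
rewrite eq_le Ex_sqr_ge0 andbT (le_trans (Ex_sqr_kernel_compB_le Lk Lu Lv))//.
rewrite [X in _ * X]ae_eq0_Ex ?mulr0//.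
  by apply: measurable_funX; exact: L2_measurable (L2B Lu Lv).
by apply: filterS uv => z ->; rewrite subrr expr0n.
Qed.

Lemma cvg_L2_kernel_comp k (u : nat -> S * S -> R) v : L2 FF k -> (forall n, L2 FF (u n)) ->
  L2 FF v -> cvg_L2 FF u v -> cvg_L2 FF (fun n => kernel_comp k (u n)) (kernel_comp k v).
Proof.
move=> Lk Lu Lv uv; apply: (cvg_L2_le (fun n => Ex_sqr_kernel_compB_le Lk (Lu n) Lv)).
by rewrite -[X in _ --> X](mulr0 (Ex FF (fun z => k z ^+ 2))); apply: cvgM => //; exact: cvg_cst.
Qed.

Lemma cvg_L2_integral_op (u : nat -> S * S -> R) v g : (forall n, L2 FF (u n)) -> L2 FF v ->
  L2 F g -> cvg_L2 FF u v -> cvg_L2 F (fun n => integral_op (u n) g) (integral_op v g).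
Proof.
move=> Lu Lv Lg uv.
apply: (cvg_L2_le (B := fun n => Ex FF (fun z => (u n z - v z) ^+ 2) * Ex F (fun x => g x ^+ 2))).
  move=> n; have LB := L2B (Lu n) Lv.
  apply: le_trans (Ex_sqr_integral_op_le LB Lg).
  rewrite (ae_eq_Ex_sqr (g := integral_op (fun z => u n z - v z) g))//.
  - by apply: L2_measurable (L2B _ _); exact: L2_integral_op.
  - exact: L2_measurable (L2_integral_op LB Lg).
  apply: filterS2 (L2_slice1_ae (Lu n)) (L2_slice1_ae Lv) => x Lux Lvx.
  by rewrite /integral_op -ExB; [under [RHS]eq_Ex do rewrite mulrBl|exact: L2M..].
by rewrite -[X in _ --> X](mul0r (Ex F (fun x => g x ^+ 2))); apply: cvgM => //; exact: cvg_cst.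
Qed.

End integral_operators.

Lemma logconvex_growth {R : realType} (b : nat -> R) : 0 < b 0%N -> 0 < b 1%N ->
  (forall j, b j.+1 ^+ 2 <= b j * b j.+2) -> (forall i j, b (i + j).+1 <= b i * b j) ->
  exists rho, [/\ 0 < rho, (forall i, rho ^+ i.+1 <= b i) & (forall i, b i.+1 <= rho * b i)].
Proof.
move=> b0 b1 lc sm.
have bpos j : 0 < b j /\ 0 < b j.+1.
  elim: j => [//|j [pj pj1]]; split => //.
  have h : 0 < b j * b j.+2 by apply: lt_le_trans (lc j); rewrite exprn_gt0.
  by rewrite -(pmulr_rgt0 _ pj).
have bp j : 0 < b j by case: (bpos j).
pose r j := b j.+1 / b j.
have rE j : b j.+1 = r j * b j by rewrite /r divfK// gt_eqF.
have r_gt0 j : 0 < r j by rewrite divr_gt0.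
have rS j : r j <= r j.+1.
  have := lc j; have p1 := bp j; have p2 := bp j.+1.
  by rewrite /r ler_pdivrMr// mulrAC ler_pdivlMr// -expr2 [leRHS]mulrC.
have r_nd : nondecreasing_seq r by apply/nondecreasing_seqP.
have r_ub j : r j <= b 0%N by rewrite /r ler_pdivrMr//; have := sm 0%N j; rewrite add0n.
have cr : cvgn r by apply: nondecreasing_is_cvgn => //; exists (b 0%N) => _ [j _ <-].
pose rho := limn r.
have r_le j : r j <= rho by exact: nondecreasing_cvgn_le.
exists rho; split => [|i|i].
- exact: lt_le_trans (r_gt0 0%N) (r_le 0%N).
- have pw j : r j ^+ i.+1 <= b i.
    have H m : r j ^+ m * b j <= b (m + j)%N.
      elim: m => [|m IH]; first by rewrite expr0 mul1r.
      rewrite exprS -mulrA addSn rE; apply: ler_pM => //.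
      - exact: ltW.
      - by rewrite mulr_ge0 ?exprn_ge0// ltW.
      - by apply: r_nd; exact: leq_addl.
    by have := le_trans (H i.+1) (sm i j); rewrite ler_pM2r.
  have cp : (fun j => r j ^+ i.+1) @ \oo --> rho ^+ i.+1.
    apply: (@continuous_cvg _ _ _ _ _ r (fun y : R => y ^+ i.+1) rho); [exact: exprn_continuous|exact: cr].
  by apply: (cvgr_to_le cp); exact: nearW.
- by rewrite rE ler_wpM2r// ltW.
Qed.

Section kernel_powers.
Context {d : measure_display} {S : measurableType d} {R : realType} (F : probability S R).
Local Notation FF := (F \x F)%E.
Variable k : S * S -> R.
Hypothesis Lk : L2 FF k.
Hypothesis symk : swap_invariant k.

(* The kernel of the [n.+1]-st power of [integral_op F k]. *)
Definition kernel_pow (n : nat) : S * S -> R := iter n (kernel_comp F k) k.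

Local Notation kp := kernel_pow.

Lemma L2_kernel_pow n : L2 FF (kp n).
Proof. by elim: n => [//|n IH]; exact: L2_kernel_comp. Qed.

Definition kernel_pow_norm (n : nat) : R := Ex FF (fun z => kp n z ^+ 2).

Lemma inner_kernel_pow i j n : (i + j)%N = n.*2 ->
  Ex FF (fun z => kp i z * kp j z) = kernel_pow_norm n.
Proof.
have shift i' j' : Ex FF (fun z => kp i' z * kp j' z) = Ex FF (fun z => kp 0 z * kp (i' + j') z).
  elim: i' j' => [|i' IH] j'; first by rewrite add0n.
  by rewrite addSnnS -IH; exact: (kernel_comp_adjoint Lk symk (L2_kernel_pow i') (L2_kernel_pow j')).
by move=> ijn; rewrite shift ijn -addnn -shift.
Qed.

Lemma kernel_powD i j : {ae FF, forall z, kp (i + j).+1 z = kernel_comp F (kp i) (kp j) z}.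
Proof.
elim: i => [|i IH]; first exact: aeW.
have Lij := L2_kernel_comp (L2_kernel_pow i) (L2_kernel_pow j).
apply: filterS2 (kernel_comp_eq_ae Lk (L2_kernel_pow _) Lij IH)
  (kernel_comp_assoc Lk (L2_kernel_pow i) (L2_kernel_pow j)) => z powD <-.
exact: powD.
Qed.

Lemma kernel_pow_norm_logconvex j :
  kernel_pow_norm j.+1 ^+ 2 <= kernel_pow_norm j * kernel_pow_norm j.+2.
Proof.
rewrite -(@inner_kernel_pow j j.+2); last by rewrite addnS -addSn addnn.
exact: Ex_cauchy_schwarz (L2_kernel_pow _) (L2_kernel_pow _).
Qed.

Lemma kernel_pow_norm_submul i j :
  kernel_pow_norm (i + j).+1 <= kernel_pow_norm i * kernel_pow_norm j.
Proof.
have Lij := L2_kernel_comp (L2_kernel_pow i) (L2_kernel_pow j).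
apply: le_trans (Ex_sqr_kernel_comp_le (L2_kernel_pow i) (L2_kernel_pow j)).
rewrite /kernel_pow_norm (ae_eq_Ex_sqr _ _ (kernel_powD i j))//; last exact: L2_measurable Lij.
exact: L2_measurable (L2_kernel_pow _).
Qed.

Lemma Ex_sqr_integral_op g : L2 F g -> Ex F (fun x => integral_op F k g x ^+ 2) =
  Ex FF (fun z => kp 1 z * (g z.1 * g z.2)).
Proof.
move=> Lg; have Lkg := L2_integral_op Lk Lg; under eq_Ex do rewrite expr2.
rewrite (integral_op_adjoint Lk symk Lg Lkg) (Ex_bilinear (L2_kernel_pow 1) Lg Lg).
apply: ae_eq_Ex.
- exact: measurable_funM (L2_measurable Lg) (L2_measurable (L2_integral_op Lk Lkg)).
- exact: measurable_funM (L2_measurable Lg) (L2_measurable (L2_integral_op (L2_kernel_pow 1) Lg)).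
by apply: filterS (L2_slice1_ae Lk) => x Lx; rewrite (integral_op_comp Lx Lk Lg).
Qed.

(* If [kernel_comp F k k = 0] then [integral_op F k] kills every indicator, so [k]
   integrates to zero on rectangles. *)
Lemma kernel_pow1_eq0_ae : kernel_pow_norm 1 = 0 -> {ae FF, forall z, k z = 0}.
Proof.
move=> norm0; have kk0 := Ex_sqr_eq0_ae (L2_kernel_pow 1) norm0.
have L2I A : measurable A -> L2 F (\1_A : S -> R).
  move=> mA; apply: (L2_bnd _ (M := 1)); first exact: measurable_indic.
  by move=> x; rewrite indicE; case: (x \in A); rewrite ?normr1 ?normr0.
apply: rectangles_ae0 (L2_L1 Lk) _ => A B mA mB; have LA := L2I A mA; have LB := L2I B mB.
have LkB := L2_integral_op Lk LB.
have kB0 : {ae F, forall x, integral_op F k \1_B x = 0}.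
  apply: (Ex_sqr_eq0_ae LkB); rewrite Ex_sqr_integral_op//.
  apply: ae_eq0_Ex; first exact: L1_measurable (L2M (L2_kernel_pow 1) (L2_prod LB LB)).
  by apply: filterS kk0 => z ->; rewrite mul0r.
under eq_Ex do rewrite mulrC; rewrite (Ex_bilinear Lk LA LB).
apply: ae_eq0_Ex; first exact: measurable_funM (L2_measurable LA) (L2_measurable LkB).
by apply: filterS kB0 => x ->; rewrite mulr0.
Qed.

Hypothesis k_neq0 : 0 < Ex FF (fun z => k z ^+ 2).

Lemma kernel_pow_growth : exists rho, [/\ 0 < rho,
  (forall i, rho ^+ i.+1 <= kernel_pow_norm i) &
  (forall i, kernel_pow_norm i.+1 <= rho * kernel_pow_norm i)].
Proof.
apply: logconvex_growth => [//||j|i j];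
  [|exact: kernel_pow_norm_logconvex|exact: kernel_pow_norm_submul].
rewrite lt_neqAle eq_sym Ex_sqr_ge0 andbT; apply/eqP => /kernel_pow1_eq0_ae k0.
move: k_neq0; rewrite ae_eq0_Ex ?ltxx//.
  by apply: measurable_funX; case: Lk.
by apply: filterS k0 => z ->; rewrite expr0n.
Qed.

Section scaled_powers.
Variable rho : R.
Hypothesis rho_gt0 : 0 < rho.
Hypothesis norm_ge : forall i, rho ^+ i.+1 <= kernel_pow_norm i.
Hypothesis norm_le : forall i, kernel_pow_norm i.+1 <= rho * kernel_pow_norm i.

Definition scaled_even_pow n (z : S * S) : R := (rho ^+ n.+1)^-1 * kp n.*2.+1 z.

Let s i := kernel_pow_norm i / rho ^+ i.+1.

Let s_ge1 i : 1 <= s i.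
Proof. by rewrite ler_pdivlMr ?exprn_gt0// mul1r. Qed.

Let is_cvg_s : cvgn s.
Proof.
apply: nonincreasing_is_cvgn; last by exists 1 => _ [i _ <-].
apply/nonincreasing_seqP => i; rewrite /s ler_pdivrMr ?exprn_gt0// [rho ^+ i.+2]exprS.
rewrite [leRHS](_ : _ = rho * kernel_pow_norm i); first exact: norm_le.
by field; rewrite expf_neq0// gt_eqF.
Qed.

Lemma L2_scaled_even_pow n : L2 FF (scaled_even_pow n).
Proof. exact: L2Z (L2_kernel_pow _). Qed.

Let inner_scaled n m :
  Ex FF (fun z => scaled_even_pow n z * scaled_even_pow m z) = s (n + m).+1.
Proof.
transitivity (Ex FF (fun z => (rho ^+ n.+1)^-1 * (rho ^+ m.+1)^-1 *
    (kp n.*2.+1 z * kp m.*2.+1 z))); first by apply: eq_Ex => z; rewrite /scaled_even_pow; ring.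
rewrite ExZ; last exact: L2M (L2_kernel_pow _) (L2_kernel_pow _).
rewrite (@inner_kernel_pow _ _ (n + m).+1); last by rewrite addSn addnS doubleS doubleD.
by rewrite /s mulrC -invfM -exprD addnS addSn.
Qed.

Lemma inner_scaled_even_pow_ge1 n m :
  1 <= Ex FF (fun z => scaled_even_pow n z * scaled_even_pow m z).
Proof. by rewrite inner_scaled. Qed.

Lemma cauchy_scaled_even_pow : L2_cauchy FF scaled_even_pow.
Proof.
apply: (L2_cauchy_gram (c := limn s) L2_scaled_even_pow) => e e0.
have /cvgrPdist_le /(_ _ e0) [N _ near_lim] := is_cvg_s.
exists N => n m Nn Nm; rewrite inner_scaled distrC; apply: near_lim => /=.
by rewrite leqW// (leq_trans Nn)// leq_addr.
Qed.

Lemma kernel_comp_scaled_even_pow n : kernel_comp F k (kernel_comp F k (scaled_even_pow n)) =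
  fun z => rho * scaled_even_pow n.+1 z.
Proof.
have mk := L2_measurable Lk; have mkp m := L2_measurable (L2_kernel_pow m).
have -> : kernel_comp F k (scaled_even_pow n) = fun z => (rho ^+ n.+1)^-1 * kp n.*2.+2 z.
  by apply/funext => z; exact: kernel_compZ.
apply/funext => z; rewrite kernel_compZ// /scaled_even_pow doubleS.
rewrite -[kernel_comp F k _ z]/(kp n.*2.+3 z) [rho ^+ n.+2]exprS.
by field; rewrite expf_neq0 ?gt_eqF.
Qed.

End scaled_powers.

(* The scaled even powers of [k] converge in L2, and [kernel_comp F k \o kernel_comp F k]
   maps each of them to [rho] times the next one. *)
Lemma fixed_kernel : exists rho u, [/\ 0 < rho, L2 FF u, 0 < Ex FF (fun z => u z ^+ 2) &
  {ae FF, forall z, kernel_comp F k (kernel_comp F k u) z = rho * u z}].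
Proof.
have [rho [rho0 norm_ge norm_le]] := kernel_pow_growth.
pose u := scaled_even_pow rho; have Lu n : L2 FF (u n) := L2_scaled_even_pow rho n.
have [v Lv uv] := L2_complete Lu (cauchy_scaled_even_pow rho0 norm_ge norm_le).
have Lkw w : L2 FF w -> L2 FF (kernel_comp F k w) := L2_kernel_comp Lk.
exists rho, v; split => //.
  apply: (@lt_le_trans _ _ 1) => //; under eq_Ex do rewrite expr2.
  have uv_ge1 n : 1 <= Ex FF (fun z => v z * u n z).
    apply: cvgr_to_ge (cvg_L2_inner Lu Lv (Lu n) uv) _.
    by apply: nearW => m; exact: inner_scaled_even_pow_ge1.
  apply: cvgr_to_ge (cvg_L2_inner Lu Lv Lv uv) _.
  by apply: nearW => n; under eq_Ex do rewrite mulrC.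
apply: (@cvg_L2_unique _ _ _ FF (fun n => kernel_comp F k (kernel_comp F k (u n)))).
- by move=> n; do 2 apply: (Lkw _).
- by do 2 apply: (Lkw _).
- exact: L2Z.
- apply: (cvg_L2_kernel_comp Lk (fun n => Lkw _ (Lu n)) (Lkw _ Lv)).
  exact: cvg_L2_kernel_comp.
rewrite /cvg_L2; under eq_fun do rewrite kernel_comp_scaled_even_pow//.
have := cvg_L2Z rho Lu Lv uv; rewrite /cvg_L2 -cvg_shiftS; exact.
Qed.

End kernel_powers.

Section eigenfunctions.
Context {d : measure_display} {S : measurableType d} {R : realType} (F : probability S R).
Local Notation FF := (F \x F)%E.

Lemma ae_slice2_eq0 (f : S * S -> R) : L2 FF f -> {ae FF, forall z, f z = 0} ->
  {ae F, forall y, {ae F, forall x, f (x, y) = 0}}.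
Proof.
move=> Lf f0; have LfT := L1_fubini (L1_transpose Lf.2).
have Ef0 : Ex F (fun y => Ex F (fun x => f (x, y) ^+ 2)) = 0.
  rewrite -(Ex_fubini2 Lf.2); apply: ae_eq0_Ex; first by apply: measurable_funX; case: Lf.
  by apply: filterS f0 => z ->; rewrite expr0n.
apply: filterS2 (L2_slice2_ae Lf) (Ex0_ae LfT (fun y => Ex_sqr_ge0 F _) Ef0) => y.
exact: Ex_sqr_eq0_ae.
Qed.

Variable k : S * S -> R.
Hypothesis Lk : L2 FF k.

Definition is_eigenfunction (mu : R) (g : S -> R) : Prop :=
  [/\ L2 F g, 0 < Ex F (fun x => g x ^+ 2) & {ae F, forall x, integral_op F k g x = mu * g x}].

Lemma fixed_kernel_slice rho (u : S * S -> R) : L2 FF u -> 0 < Ex FF (fun z => u z ^+ 2) ->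
  {ae FF, forall z, kernel_comp F k (kernel_comp F k u) z = rho * u z} ->
  exists g, [/\ L2 F g, 0 < Ex F (fun x => g x ^+ 2) &
    {ae F, forall x, integral_op F k (integral_op F k g) x = rho * g x}].
Proof.
move=> Lu u0 fixu; pose f z := kernel_comp F k (kernel_comp F k u) z - rho * u z.
have Lf : L2 FF f by apply: L2B (L2Z _ Lu); do 2 apply: (L2_kernel_comp Lk _).
have f0 : {ae FF, forall z, f z = 0} by apply: filterS fixu => z /eqP; rewrite -subr_eq0 => /eqP.
have slices := ae_slice2_eq0 Lf f0.
apply: contrapT => no_slice; move: u0; rewrite (Ex_fubini2 Lu.2) ae_eq0_Ex ?ltxx//.
  by apply: (measurable_Ex_slice2 F (f := fun z => u z ^+ 2)); apply: measurable_funX; case: Lu.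
apply: filterS2 (L2_slice2_ae Lu) slices => y Luy fy0.
apply/eqP/negPn/negP => uy_neq0; apply: no_slice; exists (fun x => u (x, y)); split => //.
  by rewrite lt_neqAle eq_sym uy_neq0 Ex_sqr_ge0.
by apply: filterS fy0 => x /eqP; rewrite subr_eq0 => /eqP.
Qed.

(* [op (op g) = c^2 g] factors as [(op - c) (op g + c g) = 0]. *)
Lemma eigenfunction_of_square (c : R) g : L2 F g -> 0 < Ex F (fun x => g x ^+ 2) ->
  {ae F, forall x, integral_op F k (integral_op F k g) x = c ^+ 2 * g x} ->
  exists (mu : R) g', `|mu| = `|c| /\ is_eigenfunction mu g'.
Proof.
move=> Lg g0 op2g; have Lopg := L2_integral_op Lk Lg; have Lcg := L2Z c Lg.
pose gp x := integral_op F k g x + c * g x; have Lgp : L2 F gp by exact: L2D.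
have eig_gp : {ae F, forall x, integral_op F k gp x = c * gp x}.
  apply: filterS2 op2g (L2_slice1_ae Lk) => x op2gx Lx.
  rewrite (integral_opD Lx Lopg Lcg) op2gx (integral_opZ _ _ _ (L2_measurable Lk))//.
    by rewrite /gp; ring.
  exact: L2_measurable Lg.
have [gp0|gp_neq0] := eqVneq (Ex F (fun x => gp x ^+ 2)) 0.
  exists (- c), g; rewrite normrN; split => //; split => //.
  apply: filterS (Ex_sqr_eq0_ae Lgp gp0) => x /eqP; rewrite addr_eq0 => /eqP ->.
  by rewrite mulNr.
by exists c, gp; split => //; split => //; rewrite lt_neqAle eq_sym gp_neq0 Ex_sqr_ge0.
Qed.

Theorem hilbert_schmidt_eigenfunction : swap_invariant k -> 0 < Ex FF (fun z => k z ^+ 2) ->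
  exists (mu : R) g, mu != 0 /\ is_eigenfunction mu g.
Proof.
move=> symk k_neq0; have [rho [u [rho0 Lu u0 fixu]]] := fixed_kernel Lk symk k_neq0.
have [g [Lg g0]] := fixed_kernel_slice Lu u0 fixu.
rewrite -[rho]sqr_sqrtr ?ltW// => op2g.
have [mu [g' [mu_c eig]]] := eigenfunction_of_square Lg g0 op2g.
by exists mu, g'; split => //; rewrite -normr_eq0 mu_c normr_eq0 gt_eqF ?sqrtr_gt0.
Qed.

End eigenfunctions.

Section eigenfunction_expansion.
Context {d : measure_display} {S : measurableType d} {R : realType} (F : probability S R).
Local Notation FF := (F \x F)%E.
Implicit Types (k : S * S -> R) (lam : nat -> R) (phi : nat -> S -> R).

Definition eigensystem k lam phi : Prop :=
  [/\ forall j, lam j != 0 -> L2 F (phi j),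
      forall i j, lam i != 0 -> lam j != 0 ->
        Ex F (fun x => phi i x * phi j x) = if i == j then 1 else 0,
      forall j, lam j != 0 -> {ae F, forall x, integral_op F k (phi j) x = lam j * phi j x} &
      forall (mu : R) (g : S -> R), mu != 0 -> L2 F g ->
        {ae F, forall x, integral_op F k g x = mu * g x} ->
        (forall j, lam j = mu -> Ex F (fun x => g x * phi j x) = 0) ->
        {ae F, forall x, g x = 0}].

Variables (k : S * S -> R) (lam : nat -> R) (phi : nat -> S -> R).
Hypothesis Lk : L2 FF k.
Hypothesis symk : swap_invariant k.
Hypothesis eigk : eigensystem k lam phi.

(* [phi j] is arbitrary when [lam j = 0]. *)
Definition efun j (x : S) : R := if lam j == 0 then 0 else phi j x.

Local Notation psi := efun.

Lemma L2_efun j : L2 F (psi j).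
Proof.
rewrite /efun; case: eqVneq => [_|lj]; first exact: L2_cst.
by case: eigk => L2phi _ _ _; exact: L2phi.
Qed.

Lemma orth_efun i j : Ex F (fun x => psi i x * psi j x) =
  if (i == j) && (lam i != 0) then 1 else 0.
Proof.
rewrite /efun; have [i0|i0] := eqVneq (lam i) 0.
  by rewrite andbF; under eq_Ex do rewrite mul0r; rewrite Ex_cst.
have [j0|j0] := eqVneq (lam j) 0; last by case: eigk => _ orth _ _; rewrite andbT orth.
under eq_Ex do rewrite mulr0; rewrite Ex_cst.
by case: eqP => // ij; rewrite ij j0 eqxx in i0.
Qed.

Lemma eig_efun j : {ae F, forall x, integral_op F k (psi j) x = lam j * psi j x}.
Proof.
have [j0|j0] := eqVneq (lam j) 0.
  apply: aeW => x; rewrite j0 mul0r -[RHS](Ex_cst F 0); apply: eq_Ex => t.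
  by rewrite /efun j0 eqxx mulr0.
by rewrite /efun (negbTE j0); case: eigk => _ _ eig _; exact: eig.
Qed.

Definition tensor_square j (z : S * S) : R := psi j z.1 * psi j z.2.

Local Notation tsq := tensor_square.

Definition resid J (z : S * S) : R := k z - \sum_(l < J) lam l * tsq l z.

Lemma L2_tensor_square j : L2 FF (tsq j).
Proof. exact: L2_prod (L2_efun j) (L2_efun j). Qed.

Lemma L2_resid J : L2 FF (resid J).
Proof. by apply: L2B => //; apply: L2_sum => l _; apply: L2Z; exact: L2_tensor_square. Qed.

Lemma resid_swap J : swap_invariant (resid J).
Proof.
move=> x y; rewrite /resid symk; congr (_ - _); apply: eq_bigr => l _.
by rewrite /tensor_square /= [psi l y * _]mulrC.
Qed.

Lemma inner_tensor_square i j : Ex FF (fun z => tsq i z * tsq j z) =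
  if (i == j) && (lam i != 0) then 1 else 0.
Proof.
have Lij := L2M (L2_efun i) (L2_efun j); under eq_Ex do rewrite mulrACA.
by rewrite (Ex_prod Lij Lij) orth_efun; case: ifP; rewrite ?mulr1 ?mulr0.
Qed.

Lemma inner_kernel_tensor_square j : Ex FF (fun z => k z * tsq j z) = lam j.
Proof.
have Lj := L2_efun j; rewrite (Ex_bilinear Lk Lj Lj).
transitivity (Ex F (fun x => lam j * (psi j x * psi j x))).
  apply: ae_eq_Ex.
  - exact: measurable_funM (L2_measurable Lj) (L2_measurable (L2_integral_op Lk Lj)).
  - by apply: measurable_funM => //; apply: measurable_funM; exact: L2_measurable Lj.
  - by apply: filterS (eig_efun j) => x ->; ring.
rewrite ExZ; last exact: L2M.
by rewrite orth_efun eqxx /=; case: eqVneq => [->|_]; rewrite ?mulr1// mulr0.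
Qed.

Lemma sum_lam_orth J j : \sum_(l < J) lam l *
  (if (nat_of_ord l == j) && (lam l != 0) then 1 else 0) = if (j < J)%N then lam j else 0.
Proof.
have [jJ|Jj] := ltnP j J.
  rewrite (bigD1 (Ordinal jJ)) //= eqxx /= big1 ?addr0.
    by case: eqVneq => [->|_]; rewrite ?mulr0 ?mulr1.
  by move=> l; rewrite -val_eqE /= => /negbTE ->; rewrite mulr0.
rewrite big1// => l _; rewrite (_ : (nat_of_ord l == j) = false) ?mulr0//.
by apply: ltn_eqF; exact: leq_trans (ltn_ord l) Jj.
Qed.

Lemma Ex_resid_mul J w : L2 FF w -> Ex FF (fun z => resid J z * w z) =
  Ex FF (fun z => k z * w z) - \sum_(l < J) lam l * Ex FF (fun z => tsq l z * w z).
Proof.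
move=> Lw; have Ltw l : L1 FF (fun z => tsq l z * w z) by exact: L2M (L2_tensor_square l) Lw.
under eq_Ex do rewrite mulrBl mulr_suml.
under eq_Ex do under eq_bigr do rewrite -mulrA.
rewrite ExB; [|exact: L2M|by apply: L1_sum => l _; exact: L1Z].
rewrite Ex_sum => [|l _]; last exact: L1Z.
by congr (_ - _); apply: eq_bigr => l _; rewrite ExZ.
Qed.

Lemma inner_resid_tensor_square J j :
  Ex FF (fun z => resid J z * tsq j z) = if (j < J)%N then 0 else lam j.
Proof.
rewrite (Ex_resid_mul J (L2_tensor_square j)) inner_kernel_tensor_square.
under eq_bigr do rewrite inner_tensor_square.
by rewrite sum_lam_orth; case: ifP; rewrite ?subrr ?subr0.
Qed.

Definition resid_norm J : R := Ex FF (fun z => resid J z ^+ 2).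

Lemma inner_resid J J' : (J <= J')%N ->
  Ex FF (fun z => resid J z * resid J' z) = resid_norm J'.
Proof.
suff to_kernel I : (I <= J')%N ->
    Ex FF (fun z => resid I z * resid J' z) = Ex FF (fun z => k z * resid J' z).
  by move=> JJ'; rewrite to_kernel// -(to_kernel J').
move=> IJ'; rewrite (Ex_resid_mul I (L2_resid J')) big1 ?subr0// => l _.
under eq_Ex do rewrite mulrC.
by rewrite inner_resid_tensor_square (leq_trans (ltn_ord l) IJ') mulr0.
Qed.

Lemma cauchy_resid : L2_cauchy FF resid.
Proof.
have norm_ni : nonincreasing_seq resid_norm.
  apply/nonincreasing_seqP => J; have LJ := L2_resid J; have LJ1 := L2_resid J.+1.
  have := Ex_sqr_ge0 FF (fun z => resid J z - resid J.+1 z).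
  by rewrite Ex_sqrB// inner_resid// -!/(resid_norm _); lra.
have cvg_norm : cvgn resid_norm.
  by apply: nonincreasing_is_cvgn => //; exists 0 => _ [J _ <-]; exact: Ex_sqr_ge0.
apply: (L2_cauchy_gram (c := limn resid_norm) L2_resid) => e e0.
have /cvgrPdist_le /(_ _ e0) [N _ near_lim] := cvg_norm; exists N => n m Nn Nm.
rewrite distrC; have [nm|/ltnW mn] := leqP n m; first by rewrite inner_resid//; exact: near_lim.
by under eq_Ex do rewrite mulrC; rewrite inner_resid//; exact: near_lim.
Qed.

Lemma resid_limit : exists k', [/\ L2 FF k', swap_invariant k' & cvg_L2 FF resid k'].
Proof.
have [v Lv cvgv] := L2_complete L2_resid cauchy_resid; have LvT := L2_transpose Lv.
exists (fun z => 2^-1 * (v z + v (z.2, z.1))); split.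
- exact/L2Z/L2D.
- by move=> x y /=; rewrite addrC.
have cvgvT := cvg_L2_transpose L2_resid Lv cvgv.
have LrT J : L2 FF (fun z => resid J (z.2, z.1)) := L2_transpose (L2_resid J).
have residE : (fun J z => 2^-1 * (resid J z + resid J (z.2, z.1))) = resid.
  by apply/funext => J; apply/funext => -[x y] /=; rewrite [resid J (y, x)]resid_swap; field.
have := cvg_L2Z 2^-1 (fun J => L2D (L2_resid J) (LrT J)) (L2D Lv LvT)
  (cvg_L2D L2_resid LrT Lv LvT cvgv cvgvT).
by rewrite residE.
Qed.

Lemma integral_op_resid J g : L2 F g -> {ae F, forall x, integral_op F (resid J) g x =
  integral_op F k g x - \sum_(l < J) lam l * psi l x * Ex F (fun t => psi l t * g t)}.
Proof.
move=> Lg; apply: filterS (L2_slice1_ae Lk) => x Lx.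
have Lpg l : L1 F (fun t => psi l t * g t) by exact: L2M (L2_efun l) Lg.
transitivity (Ex F (fun t => k (x, t) * g t - \sum_(l < J) lam l * psi l x * (psi l t * g t))).
  apply: eq_Ex => t; rewrite /resid mulrBl mulr_suml; congr (_ - _); apply: eq_bigr => l _.
  by rewrite /tensor_square /=; ring.
rewrite ExB; [|exact: L2M|by apply: L1_sum => l _; exact: L1Z].
by congr (_ - _); rewrite Ex_sum => [|l _]; [apply: eq_bigr => l _; rewrite ExZ|exact: L1Z].
Qed.

Lemma integral_op_resid_efun J j : (j < J)%N ->
  {ae F, forall x, integral_op F (resid J) (psi j) x = 0}.
Proof.
move=> jJ; apply: filterS2 (integral_op_resid J (L2_efun j)) (eig_efun j) => x -> ->.
rewrite (eq_bigr (fun l : 'I_J =>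
    lam l * (if (nat_of_ord l == j) && (lam l != 0) then 1 else 0) * psi j x)).
  by rewrite -mulr_suml sum_lam_orth jJ subrr.
by move=> l _; rewrite orth_efun mulrAC; case: eqVneq => [->//|_]; rewrite !mulr0 !mul0r.
Qed.

Section limit_eigenfunction.
Variables (k' : S * S -> R) (mu : R) (g : S -> R).
Hypothesis Lk' : L2 FF k'.
Hypothesis cvgk' : cvg_L2 FF resid k'.
Hypothesis mu_neq0 : mu != 0.
Hypothesis eigg : is_eigenfunction F k' mu g.

Let Lg : L2 F g. Proof. by case: eigg. Qed.

Lemma limit_eigenfunction_orth j : Ex F (fun x => psi j x * g x) = 0.
Proof.
have Lj := L2_efun j; have Ljg := L2_prod Lj Lg.
have limE : Ex FF (fun z => k' z * (psi j z.1 * g z.2)) = mu * Ex F (fun x => psi j x * g x).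
  rewrite (Ex_bilinear Lk' Lj Lg) -ExZ; last exact: L2M.
  apply: ae_eq_Ex.
  - exact: measurable_funM (L2_measurable Lj) (L2_measurable (L2_integral_op Lk' Lg)).
  - by apply: measurable_funM => //; exact: measurable_funM (L2_measurable Lj) (L2_measurable Lg).
  - by case: eigg => _ _; apply: filterS => x ->; ring.
have resid0 J : (j < J)%N -> Ex FF (fun z => resid J z * (psi j z.1 * g z.2)) = 0.
  move=> jJ; have LJ := L2_resid J.
  rewrite (Ex_bilinear LJ Lj Lg) -(integral_op_adjoint LJ (resid_swap J) Lj Lg).
  apply: ae_eq0_Ex.
    exact: measurable_funM (L2_measurable (L2_integral_op LJ Lj)) (L2_measurable Lg).
  by apply: filterS (integral_op_resid_efun jJ) => x ->; rewrite mul0r.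
have := cvg_L2_inner L2_resid Lk' Ljg cvgk'; rewrite limE => cvg_inner.
have lim0 : Ex FF (fun z => resid J z * (psi j z.1 * g z.2)) @[J --> \oo] --> (0 : R).
  by apply: cvg_near_cst; exists j.+1 => // J /= jJ; exact: resid0.
have /eqP : mu * Ex F (fun x => psi j x * g x) = 0 by exact: cvg_unique cvg_inner lim0.
by rewrite mulf_eq0 (negbTE mu_neq0) => /eqP.
Qed.

Lemma limit_eigenfunction_kernel : {ae F, forall x, integral_op F k g x = mu * g x}.
Proof.
have Lop := L2_integral_op Lk Lg; have Lop' := L2_integral_op Lk' Lg.
have LopJ J := L2_integral_op (L2_resid J) Lg.
have op_eq : {ae F, forall x, integral_op F k' g x = integral_op F k g x}.
  apply: (cvg_L2_unique LopJ Lop' Lop (cvg_L2_integral_op L2_resid Lk' Lg cvgk')).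
  have dist0 J : Ex F (fun x => (integral_op F (resid J) g x - integral_op F k g x) ^+ 2) = 0.
    apply: ae_eq0_Ex; first by apply: measurable_funX; exact: L2_measurable (L2B (LopJ J) Lop).
    apply: filterS (integral_op_resid J Lg) => x ->.
    by rewrite big1 ?subr0 ?subrr ?expr0n// => l _; rewrite limit_eigenfunction_orth mulr0.
  by rewrite /cvg_L2; under eq_fun do rewrite dist0; exact: cvg_cst.
by case: eigg => _ _; apply: filterS2 op_eq => x ->.
Qed.

Lemma limit_eigenfunction_absurd : False.
Proof.
case: eigg eigk => _ g0 _ [_ _ _ complete].
have gae0 : {ae F, forall x, g x = 0}.
  apply: (complete mu) => //; first exact: limit_eigenfunction_kernel.
  move=> j lamj; rewrite -[RHS](limit_eigenfunction_orth j); apply: eq_Ex => x.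
  by rewrite mulrC /efun lamj (negbTE mu_neq0).
move: g0; rewrite ae_eq0_Ex ?ltxx//; first by apply: measurable_funX; exact: L2_measurable Lg.
by apply: filterS gae0 => x ->; rewrite expr0n.
Qed.

End limit_eigenfunction.

(* A nonzero limit of the residuals would have an eigenfunction orthogonal to all of those
   listed, which is then an eigenfunction of [k] missed by the list. *)
Theorem eigenfunction_expansion : Ex FF (fun z => resid J z ^+ 2) @[J --> \oo] --> (0 : R).
Proof.
have [k' [Lk' symk' cvgk']] := resid_limit.
have [k'0|k'_neq0] := eqVneq (Ex FF (fun z => k' z ^+ 2)) 0.
  have distE J : Ex FF (fun z => resid J z ^+ 2) = Ex FF (fun z => (resid J z - k' z) ^+ 2).
    apply: ae_eq_Ex_sqr.
    - exact: L2_measurable (L2_resid J).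
    - exact: L2_measurable (L2B (L2_resid J) Lk').
    - by apply: filterS (Ex_sqr_eq0_ae Lk' k'0) => z ->; rewrite subr0.
  by under eq_fun do rewrite distE; exact: cvgk'.
have k'_gt0 : 0 < Ex FF (fun z => k' z ^+ 2) by rewrite lt_neqAle eq_sym k'_neq0 Ex_sqr_ge0.
have [mu [g [mu_neq0 eigg]]] := hilbert_schmidt_eigenfunction Lk' symk' k'_gt0.
by case: (limit_eigenfunction_absurd Lk' cvgk' mu_neq0 eigg).
Qed.

End eigenfunction_expansion.

(** * Law of large numbers and quadratic forms in normalized sums *)

Lemma cvg_approx {R : realType} (a : nat -> R) (l : R) :
  (forall e, 0 < e -> exists b l', [/\ \forall n \near \oo, `|a n - b n| <= e,
     `|l - l'| <= e & b n @[n --> \oo] --> l']) ->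
  a n @[n --> \oo] --> l.
Proof.
move=> approx; apply/cvgrPdist_le => e e0; have e3 : 0 < e / 3 by rewrite divr_gt0.
have [b [l' [ab ll' /cvgrPdist_le /(_ _ e3) bl']]] := approx _ e3.
apply: filterS2 ab bl' => n ab bl'.
rewrite (_ : l - a n = (l - l') + (l' - b n) - (a n - b n)); last by ring.
apply: le_trans (ler_normB _ _) _.
by have := ler_normD (l - l') (l' - b n); lra.
Qed.

Section iid_sums.
Context {d dS : measure_display} {O : measurableType d} {S : measurableType dS}
  {R : realType} (P : probability O R) (X : nat -> O -> S) (F : probability S R).
Hypothesis mX : forall i, measurable_fun setT (X i).
Hypothesis iX : mutually_independent P X.
Hypothesis FX : forall e A, measurable A -> P (X e @^-1` A) = F A.
Implicit Types (g : S -> R).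

Lemma L2_iid_sum g n : L2 F g -> L2 P (fun w => \sum_(i < n) g (X i w)).
Proof.
by move=> Lg; apply: L2_sum => i _; apply/(L2_law (mX _) (FX _)) => //; case: Lg.
Qed.

Lemma Ex_sqr_iid_sum g n : L2 F g -> Ex F g = 0 ->
  Ex P (fun w => (\sum_(i < n) g (X i w)) ^+ 2) = n%:R * Ex F (fun x => g x ^+ 2).
Proof.
move=> Lg Eg; have mg := L2_measurable Lg.
rewrite Ex_sqr_sum => [|i _]; last exact/(L2_law (mX _) (FX _)).
rewrite (eq_bigr (fun=> Ex F (fun x => g x ^+ 2))).
  by rewrite sumr_const card_ord mulr_natl.
move=> i _; rewrite (bigD1 i)//= big1 ?addr0 => [|j ji].
  under eq_Ex do rewrite -expr2.
  by rewrite (Ex_law (mX i) (FX _) (f := fun x => g x ^+ 2))//; exact: measurable_funX.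
have ij : nat_of_ord i != nat_of_ord j by rewrite eq_sym.
by rewrite (Ex_iid_mul mX iX FX ij (L2_L1 Lg) (L2_L1 Lg)) Eg mulr0.
Qed.

Definition average g n w : R := n%:R^-1 * \sum_(i < n) g (X i w).

Lemma L1_average g n : L1 F g -> L1 P (average g n).
Proof.
move=> Lg; apply: L1Z; apply: L1_sum => i _.
by apply/(L1_law (mX _) (FX _)) => //; exact: L1_measurable Lg.
Qed.

Lemma Ex_average g n : L1 F g -> Ex P (average g n.+1) = Ex F g.
Proof.
move=> Lg; have mg := L1_measurable Lg.
have LgX i : L1 P (fun w => g (X i w)) by exact/(L1_law (mX i) (FX _)).
rewrite ExZ; last exact: L1_sum.
rewrite Ex_sum// (eq_bigr (fun=> Ex F g)) => [|i _]; last exact: (Ex_law (mX i) (FX i) mg).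
by rewrite sumr_const card_ord -[X in _ * X]mulr_natl mulKf// pnatr_eq0.
Qed.

Lemma Ex_dist_average_le g g' n : L1 F g -> L1 F g' ->
  Ex P (fun w => `|average g n w - average g' n w|) <= Ex F (fun x => `|g x - g' x|).
Proof.
move=> Lg Lg'; have Ld := L1_norm (L1B Lg Lg').
have LdX i : L1 P (fun w => `|g (X i w) - g' (X i w)|).
  by apply/(L1_law (mX i) (FX _) (f := fun x => `|g x - g' x|)) => //; exact: L1_measurable Ld.
apply: (@le_trans _ _ (Ex P (fun w => n%:R^-1 * \sum_(i < n) `|g (X i w) - g' (X i w)|))).
  apply: le_Ex.
  - by apply: L1_norm; apply: L1B; exact: L1_average.
  - by apply: L1Z; exact: L1_sum.
  move=> w; rewrite /average -mulrBr -sumrB normrM ger0_norm ?invr_ge0//.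
  by rewrite ler_wpM2l ?invr_ge0// ler_norm_sum.
rewrite ExZ; last exact: L1_sum.
rewrite Ex_sum// (eq_bigr (fun=> Ex F (fun x => `|g x - g' x|))); last first.
  by move=> i _; apply: (Ex_law (mX i) (FX _) (f := fun x => `|g x - g' x|)); exact: L1_measurable Ld.
rewrite sumr_const card_ord -[X in _ * X]mulr_natl mulrA.
case: n => [|n]; first by rewrite mulr0 mul0r Ex_ge0.
by rewrite mulVf ?mul1r ?pnatr_eq0.
Qed.

Lemma weak_lln_L2 g : L2 F g ->
  Ex P (fun w => `|average g n w - Ex F g|) @[n --> \oo] --> (0 : R).
Proof.
move=> Lg; pose c x := g x - Ex F g; pose V := Ex F (fun x => c x ^+ 2).
have Lc : L2 F c by apply: L2B => //; exact: L2_cst.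
have Ec : Ex F c = 0 by rewrite (ExB (L2_L1 Lg) (L1_cst _ _)) Ex_cst subrr.
rewrite -cvg_shiftS; apply: (cvg0_dominated (b := fun n => Num.sqrt (n.+1%:R^-1 * V))) => [n|].
  have nn : n.+1%:R != 0 :> R by rewrite pnatr_eq0.
  have centerE w : average g n.+1 w - Ex F g = n.+1%:R^-1 * \sum_(i < n.+1) c (X i w).
    rewrite /c sumrB sumr_const card_ord mulrBr -[Ex F g *+ _]mulr_natl.
    by rewrite [in RHS]mulrA mulVf// mul1r.
  under eq_Ex do rewrite centerE; rewrite ger0_norm ?Ex_ge0//.
  apply: Ex_norm_le_sqrt; [exact/L2Z/L2_iid_sum|exact: sqrtr_ge0|].
  rewrite Ex_sqrZ; last exact: L2_iid_sum.
  rewrite Ex_sqr_iid_sum// sqr_sqrtr; last by rewrite mulr_ge0 ?invr_ge0 ?Ex_sqr_ge0.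
  by rewrite expr2 -mulrA mulKf.
rewrite -[X in _ --> X]sqrtr0 -[X in Num.sqrt X](mul0r V).
apply: continuous_cvg; first exact: sqrt_continuous.
by apply: cvgM; [exact: cvg_harmonic|exact: cvg_cst].
Qed.

Let clamp (K : nat) (x : R) : R := Num.max (- K%:R) (Num.min x K%:R).

Let clamp_le K x : `|clamp K x| <= K%:R.
Proof.
have K0 : 0 <= K%:R :> R by [].
by rewrite ler_norml /clamp le_max lexx /= ge_max ge_min lexx orbT andbT; lra.
Qed.

Let clamp_dist K x : `|x - clamp K x| <= `|x|.
Proof.
have K0 : 0 <= K%:R :> R by [].
rewrite /clamp maxEle minEle; case: (leP x K%:R) => [xK|Kx].
  by case: (leP (- K%:R) x) => [?|xK']; [rewrite subrr normr0|rewrite !ltr0_norm; lra].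
by rewrite ifT; [rewrite !gtr0_norm; lra|lra].
Qed.

Lemma Ex_dist_clamp_cvg g : L1 F g ->
  Ex F (fun x => `|g x - clamp K (g x)|) @[K --> \oo] --> (0 : R).
Proof.
move=> Lg; have mg := L1_measurable Lg.
rewrite -[X in _ --> X](Ex_cst F 0); apply: (Ex_dct (g := fun x => `|g x|)).
- move=> K; apply: measurableT_comp => //; apply: measurable_funB => //.
  by apply: measurable_maxr => //; exact: measurable_minr.
- exact: measurable_cst.
- exact: L1_norm.
- by move=> K x; rewrite normr_id; exact: clamp_dist.
apply: aeW => x; apply: cvg_near_cst; have [K _ xK] := nbhs_infty_ger `|g x|.
exists K => // K' /xK; rewrite /= ler_norml => /andP[K'x xK'].
by rewrite /clamp (min_idPl xK') (max_idPr K'x) subrr normr0.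
Qed.

Lemma weak_lln g : L1 F g ->
  Ex P (fun w => `|average g n w - Ex F g|) @[n --> \oo] --> (0 : R).
Proof.
move=> Lg; apply: cvg_approx => e e0; have e2 : 0 < e / 2 by rewrite divr_gt0.
have /cvgrPdist_le /(_ _ e2) [K _ /(_ K (leqnn K))] := Ex_dist_clamp_cvg Lg.
rewrite /= sub0r normrN ger0_norm ?Ex_ge0// => clamp_close.
pose gK x := clamp K (g x).
have mgK : measurable_fun setT gK.
  by apply: measurable_maxr => //; apply: measurable_minr => //; exact: L1_measurable Lg.
have LgK : L2 F gK by apply: (L2_bnd _ (M := K%:R)) => // x; exact: clamp_le.
exists (fun n => Ex P (fun w => `|average gK n w - Ex F gK|)), 0.
split; [|by rewrite subr0 normr0 ltW|exact: weak_lln_L2].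
apply: nearW => n; have La := L1_average n Lg; have LaK := L1_average n (L2_L1 LgK).
have Lcst (c : R) : L1 P (fun=> c) := L1_cst P c.
rewrite -ExB; [|by apply: L1_norm; exact: L1B..].
apply: le_trans (normr_Ex _) _; first by apply: L1B; apply: L1_norm; exact: L1B.
apply: (@le_trans _ _ (Ex P (fun w => `|average g n w - average gK n w| + `|Ex F g - Ex F gK|))).
  apply: le_Ex.
  - by apply: L1_norm; apply: L1B; apply: L1_norm; exact: L1B.
  - by apply: L1D => //; apply: L1_norm; exact: L1B.
  move=> w; apply: le_trans (ler_dist_dist _ _) _.
  rewrite (_ : _ - _ - _ = (average g n w - average gK n w) - (Ex F g - Ex F gK)); last by ring.
  exact: ler_normB.
rewrite ExD//; last by apply: L1_norm; exact: L1B.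
rewrite Ex_cst [leRHS](splitr e); apply: lerD.
  exact: le_trans (Ex_dist_average_le n Lg (L2_L1 LgK)) clamp_close.
rewrite -ExB//; last exact: L2_L1.
by apply: le_trans (normr_Ex _) clamp_close; apply: L1B => //; exact: L2_L1.
Qed.

Definition normalized_sum g n w : R := (Num.sqrt n%:R)^-1 * \sum_(i < n) g (X i w).

Lemma L2_normalized_sum g n : L2 F g -> L2 P (normalized_sum g n).
Proof. by move=> Lg; exact/L2Z/L2_iid_sum. Qed.

Lemma Ex_sqr_normalized_sum_le g n : L2 F g -> Ex F g = 0 ->
  Ex P (fun w => normalized_sum g n w ^+ 2) <= Ex F (fun x => g x ^+ 2).
Proof.
move=> Lg Eg; rewrite Ex_sqrZ; last exact: L2_iid_sum.
rewrite Ex_sqr_iid_sum// exprVn sqr_sqrtr// mulrA.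
case: n => [|n]; first by rewrite mulr0 mul0r Ex_sqr_ge0.
by rewrite mulVf ?mul1r ?pnatr_eq0.
Qed.

End iid_sums.

Section cosine_square.
Context {R : realType}.
Implicit Types (a b e x : R).

Lemma is_derive_scaled_cosM e b x :
  is_derive x 1 (fun x => b * cos (e * x)) (- (b * e) * sin (e * x)).
Proof.
have deM : is_derive x 1 (fun x : R => e * x) e.
  by have := is_deriveZ e (is_derive_id x (1 : R)); rewrite /GRing.scale /= mulr1.
have dcos := @is_derive1_comp _ cos (fun x => e * x) x _ _ (is_derive_cos (e * x)) deM.
by apply: is_derive_eq (is_deriveZ b dcos) _; rewrite /GRing.scale /=; ring.
Qed.

Lemma is_derive_scaled_sinM e b x :
  is_derive x 1 (fun x => b * sin (e * x)) (b * e * cos (e * x)).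
Proof.
have deM : is_derive x 1 (fun x : R => e * x) e.
  by have := is_deriveZ e (is_derive_id x (1 : R)); rewrite /GRing.scale /= mulr1.
have dsin := @is_derive1_comp _ sin (fun x => e * x) x _ _ (is_derive_sin (e * x)) deM.
by apply: is_derive_eq (is_deriveZ b dsin) _; rewrite /GRing.scale /=; ring.
Qed.

(* A smooth substitute for [a * (x ^+ 2 - 1)] with bounded derivatives. *)
Definition cossqr e a x : R := a * (2 / e ^+ 2 * (1 - cos (e * x)) - 1).

Lemma is_derive_cossqr e a x : e != 0 ->
  is_derive x 1 (cossqr e a) (a * (2 / e) * sin (e * x)).
Proof.
move=> e0; rewrite (_ : cossqr e a =
    (fun x => a * (2 / e ^+ 2 - 1)) + (fun x => - (a * (2 / e ^+ 2)) * cos (e * x))).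
  apply: is_derive_eq (is_deriveD (is_derive_cst (a * (2 / e ^+ 2 - 1)) x (1 : R))
    (is_derive_scaled_cosM e (- (a * (2 / e ^+ 2))) x)) _.
  by rewrite add0r; field.
by apply/funext => y; rewrite /cossqr !fctE; ring.
Qed.

Lemma C2_lipschitz_cossqr e a : 0 < e ->
  exists theta1 theta2 M, C2_lipschitz M (cossqr e a) theta1 theta2.
Proof.
move=> e0; have e_neq0 : e != 0 by rewrite gt_eqF.
pose M := `|a| * (2 / e + 2 + 2 * e).
have scaled_le c y : 0 <= c <= 2 / e + 2 + 2 * e -> `|y| <= 1 -> `|a * c * y| <= M.
  move=> /andP[c0 cM] y1; rewrite !normrM (ger0_norm c0) -mulrA ler_wpM2l//.
  by apply: le_trans cM; rewrite ler_piMr.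
have sin1 x : `|sin x| <= 1 by rewrite ler_norml sin_geN1 sin_le1.
have cos1 x : `|cos x| <= 1 by rewrite ler_norml cos_geN1 cos_le1.
have ie0 : 0 <= 2 / e by rewrite divr_ge0// ltW.
exists (fun x => a * (2 / e) * sin (e * x)), (fun x => a * 2 * cos (e * x)), M; split.
- by move=> x; exact: is_derive_cossqr.
- by move=> x; apply: is_derive_eq (is_derive_scaled_sinM e (a * (2 / e)) x) _; field.
- by move=> x; apply: scaled_le => //; lra.
- by move=> x; apply: scaled_le => //; lra.
apply: (derive_klipschitz (f1 := fun x => - (a * 2 * e) * sin (e * x))) => x.
  exact: is_derive_scaled_cosM.
by rewrite mulNr normrN -mulrA -mulrA mulrA; apply: scaled_le => //; lra.
Qed.

Lemma cossqr_approx e a x : 0 < e ->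
  `|cossqr e a x - a * (x ^+ 2 - 1)| <= `|a| * (2 * e * `|x| ^+ 3).
Proof.
move=> e0; have en : e != 0 by rewrite gt_eqF.
have dcos (y : R) : is_derive y 1 cos (- sin y) by exact: is_derive_cos.
have dsin (y : R) : is_derive y 1 (fun y => - sin y) (- cos y).
  by have := is_deriveN (is_derive_sin y).
have dNcos (y : R) : is_derive y 1 (fun y => - cos y) (sin y).
  by have := is_deriveN (dcos y); rewrite opprK.
have lip : 1.-lipschitz (fun y : R => - cos y).
  by apply: (derive_klipschitz dNcos) => y; rewrite ler_norml sin_geN1 sin_le1.
have := taylor2_cubic dcos dsin lip 0 (e * x).
rewrite add0r cos0 sin0 oppr0 mul0r subr0 mul1r => cos_taylor.
have -> : cossqr e a x - a * (x ^+ 2 - 1) =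
    a * (- (2 / e ^+ 2) * (cos (e * x) - 1 - - 1 * (e * x) ^+ 2 / 2)).
  by rewrite /cossqr; field.
have q0 : 0 <= 2 / e ^+ 2 by rewrite divr_ge0// sqr_ge0.
rewrite normrM ler_wpM2l// normrM normrN (ger0_norm q0).
apply: le_trans (ler_wpM2l q0 cos_taylor) _.
rewrite normrM exprMn (gtr0_norm e0) [leLHS](_ : _ = 2 * e * `|x| ^+ 3)//.
by field.
Qed.

End cosine_square.

Section quadratic_replacement.
Context {R : realType} {I : finType} (f : R -> R) (M : R) (a : I -> R).
Hypothesis fM : forall x, `|f x| <= M.
Hypothesis fL : M.-lipschitz f.

Let A := \sum_i `|a i|.

Let M_ge0 : 0 <= M. Proof. exact: klipschitz_ge0 fL. Qed.

Let A_ge0 : 0 <= A. Proof. exact: sumr_ge0. Qed.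

Lemma quadratic_replacement (e K : R) (s : I -> R) : 0 < e -> 0 < K ->
  `|f (\sum_i a i * (s i ^+ 2 - 1)) - f (\sum_i cossqr e (a i) (s i))| <=
  M * (A * (2 * e * K ^+ 3)) + 2 * M / K ^+ 2 * \sum_i s i ^+ 2.
Proof.
move=> e0 K0; have K2 : 0 < K ^+ 2 by rewrite exprn_gt0.
have small_ge0 : 0 <= M * (A * (2 * e * K ^+ 3)).
  by rewrite !mulr_ge0 ?exprn_ge0 ?(ltW e0) ?(ltW K0).
have large_ge0 : 0 <= 2 * M / K ^+ 2 * \sum_i s i ^+ 2.
  rewrite mulr_ge0 ?divr_ge0 ?(ltW K2)//; first exact: mulr_ge0.
  by apply: sumr_ge0 => i _; exact: sqr_ge0.
have [/forallP sK|] := boolP [forall i, `|s i| <= K].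
  apply: (@le_trans _ _ (M * (A * (2 * e * K ^+ 3)))); last by rewrite lerDl.
  apply: le_trans ((klipschitzP _ _).1 fL _ _) _; rewrite ler_wpM2l// -sumrB mulr_suml.
  apply: le_trans (ler_norm_sum _ _ _) _; apply: ler_sum => i _.
  rewrite distrC; apply: le_trans (cossqr_approx _ _ e0) _.
  rewrite ler_wpM2l// ler_wpM2l//; first by rewrite mulr_ge0// ltW.
  by rewrite lerXn2r ?nnegrE// ?ltW// sK.
rewrite negb_forall => /existsP[i]; rewrite -ltNge => Ki.
apply: (@le_trans _ _ (2 * M)).
  by apply: le_trans (ler_normB _ _) _; have := fM (\sum_i a i * (s i ^+ 2 - 1));
     have := fM (\sum_i cossqr e (a i) (s i)); lra.
apply: (@le_trans _ _ (2 * M / K ^+ 2 * \sum_i s i ^+ 2)); last by rewrite lerDr.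
rewrite -mulrA ler_peMr ?mulr_ge0// ler_pdivlMl// mulr1 (bigD1 i)//=.
apply: (@le_trans _ _ (s i ^+ 2)).
  by rewrite -[leRHS]real_normK ?num_real// lerXn2r ?nnegrE// ltW.
by rewrite lerDl; apply: sumr_ge0 => j _; exact: sqr_ge0.
Qed.

Lemma Ex_quadratic_replacement {d : measure_display} {T : measurableType d}
    (Q : probability T R) (s : I -> T -> R) (e K V : R) : (forall i, L2 Q (s i)) ->
  \sum_i Ex Q (fun w => s i w ^+ 2) <= V -> 0 < e -> 0 < K ->
  `|Ex Q (fun w => f (\sum_i a i * (s i w ^+ 2 - 1))) -
    Ex Q (fun w => f (\sum_i cossqr e (a i) (s i w)))| <=
  M * (A * (2 * e * K ^+ 3)) + 2 * M / K ^+ 2 * V.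
Proof.
move=> Ls EsV e0 K0; have ms i : measurable_fun setT (s i) := L2_measurable (Ls i).
have cf := klipschitz_continuous fL; have Lsum : L1 Q (fun w => \sum_i s i w ^+ 2).
  by apply: L1_sum => i _; case: (Ls i).
have Lquad : L1 Q (fun w => f (\sum_i a i * (s i w ^+ 2 - 1))).
  apply: (L1_continuous_comp Q _ cf fM); apply: measurable_sum => i.
  by apply: measurable_funM => //; apply: measurable_funB => //; exact: measurable_funX.
have Lcos : L1 Q (fun w => f (\sum_i cossqr e (a i) (s i w))).
  apply: (L1_continuous_comp Q _ cf fM); apply: measurable_sum => i.
  apply: measurableT_comp (ms i); apply: continuous_measurable.
  exact: is_derive_continuous (fun x => is_derive_cossqr (a i) x (lt0r_neq0 e0)).
rewrite -ExB//; apply: le_trans (normr_Ex (L1B Lquad Lcos)) _.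
apply: (@le_trans _ _ (Ex Q (fun w => M * (A * (2 * e * K ^+ 3)) +
    2 * M / K ^+ 2 * \sum_i s i w ^+ 2))).
  apply: le_Ex; first by apply: L1_norm; exact: L1B.
    by apply: L1D; [exact: L1_cst|exact: L1Z].
  by move=> w; exact: quadratic_replacement.
rewrite ExD; [|exact: L1_cst|exact: L1Z].
rewrite Ex_cst ExZ// lerD2l ler_wpM2l//.
  by apply: divr_ge0; [exact: mulr_ge0|rewrite exprn_ge0// ltW].
by rewrite Ex_sum// => i _; case: (Ls i).
Qed.

Lemma quadratic_replacement_params (V c : R) : 0 <= V -> 0 < c -> exists e K : R,
  [/\ 0 < e, 0 < K & M * (A * (2 * e * K ^+ 3)) + 2 * M / K ^+ 2 * V <= c].
Proof.
move=> V0 c0; have MV0 : 0 <= M * V by rewrite mulr_ge0.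
have MA0 : 0 <= M * A by rewrite mulr_ge0.
pose K := 1 + 4 * (M * V) / c.
have K1 : 1 <= K by rewrite lerDl divr_ge0 ?mulr_ge0// ltW.
have K0 : 0 < K by exact: lt_le_trans K1.
have K3 : 0 < K ^+ 3 by rewrite exprn_gt0.
exists (c / (4 * (M * A + 1) * K ^+ 3)), K; split => //.
  by rewrite divr_gt0// mulr_gt0// mulr_gt0//; lra.
have large_le : 2 * M / K ^+ 2 * V <= c / 2.
  have -> : 2 * M / K ^+ 2 * V = 2 * (M * V) / K ^+ 2 by ring.
  rewrite ler_pdivrMr ?exprn_gt0//; apply: (@le_trans _ _ (c / 2 * K)).
    rewrite /K mulrDr mulr1; have -> : c / 2 * (4 * (M * V) / c) = 2 * (M * V).
      by field; rewrite gt_eqF.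
    by rewrite lerDr divr_ge0// ltW.
  by rewrite ler_pM2l ?divr_gt0// expr2 ler_peMl// ltW.
have small_le : M * (A * (2 * (c / (4 * (M * A + 1) * K ^+ 3)) * K ^+ 3)) <= c / 2.
  have MA1 : 0 < M * A + 1 by lra.
  have -> : M * (A * (2 * (c / (4 * (M * A + 1) * K ^+ 3)) * K ^+ 3)) =
      c / 2 * (M * A / (M * A + 1)) by field; rewrite !gt_eqF.
  by rewrite ler_piMr ?divr_ge0 ?(ltW c0)// ler_pdivrMr// mul1r lerDl.
by rewrite [leRHS](splitr c) lerD.
Qed.

End quadratic_replacement.

Section quadratic_clt.
Context {R : realType} {I : finType} {d d' dS : measure_display} {O : measurableType d}
  {O' : measurableType d'} {S : measurableType dS}
  (P : probability O R) (P' : probability O' R) (F : probability S R)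
  (X : nat -> O -> S) (u : I -> S -> R) (Z : I -> O' -> R) (s : I -> R).
Hypothesis mX : forall k, measurable_fun setT (X k).
Hypothesis iX : mutually_independent P X.
Hypothesis FX : forall k A, measurable A -> P (X k @^-1` A) = F A.
Hypothesis mZ : forall i, measurable_fun setT (Z i).
Hypothesis iZ : mutually_independent P' Z.
Hypothesis normalZ : forall i A, measurable A -> P' (Z i @^-1` A) = normalR 0 1 A.
Hypothesis L2u : forall i, L2 F (u i).
Hypothesis Eu : forall i, Ex F (u i) = 0.
Hypothesis covu : forall i j, Ex F (fun x => u i x * u j x) = if i == j then s i ^+ 2 else 0.

Theorem quadratic_clt (a : I -> R) (f : R -> R) : smooth f ->
  Ex P (fun w => f (\sum_i a i * (normalized_sum X (u i) n w ^+ 2 - 1))) @[n --> \oo] -->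
  Ex P' (fun w => f (\sum_i a i * ((s i * Z i w) ^+ 2 - 1))).
Proof.
move=> sf; have [M fM fL] := smooth_bounded_lipschitz sf.
pose V := \sum_i s i ^+ 2; have V0 : 0 <= V by apply: sumr_ge0 => i _; exact: sqr_ge0.
have Esum n : \sum_i Ex P (fun w => normalized_sum X (u i) n w ^+ 2) <= V.
  apply: ler_sum => i _; apply: le_trans (Ex_sqr_normalized_sum_le mX iX FX n (L2u i) (Eu i)) _.
  by under eq_Ex do rewrite expr2; rewrite covu eqxx.
have EZ : \sum_i Ex P' (fun w => (s i * Z i w) ^+ 2) <= V.
  apply: ler_sum => i _; under eq_Ex do rewrite expr2.
  by rewrite (gaussian_cov s mZ iZ normalZ) eqxx.
apply: cvg_approx => c c0.
have [e [K [e0 K0 bound_le]]] := quadratic_replacement_params a fL V0 c0.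
exists (fun n => Ex P (fun w => f (\sum_i cossqr e (a i) (normalized_sum X (u i) n w)))),
  (Ex P' (fun w => f (\sum_i cossqr e (a i) (s i * Z i w)))); split.
- apply: nearW => n; apply: le_trans bound_le.
  exact: (Ex_quadratic_replacement a fM fL (fun i => L2_normalized_sum mX FX n (L2u i)) (Esum n) e0 K0).
- apply: le_trans bound_le.
  exact: (Ex_quadratic_replacement a fM fL (gaussian_L2 s mZ normalZ) EZ e0 K0).
exact: (additive_clt mX iX FX mZ iZ normalZ L2u Eu covu sf (fun i => C2_lipschitz_cossqr (a i) e0)).
Qed.

End quadratic_clt.

(** * Degenerate U-statistics of order two *)

Lemma small_multiple {R : realType} (D e : R) : 0 <= D -> 0 < e ->
  exists2 del, 0 < del & D * del <= e.
Proof.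
move=> D0 e0; have D1 : 0 < D + 1 by rewrite ltr_wpDl.
exists (e / (D + 1)); first by rewrite divr_gt0.
by rewrite mulrCA ger_pMr// ler_pdivrMr// mul1r lerDl.
Qed.

Section pair_sums.
Context {d dS : measure_display} {O : measurableType d} {S : measurableType dS}
  {R : realType} (P : probability O R) (X : nat -> O -> S) (F : probability S R).
Local Notation FF := (F \x F)%E.
Hypothesis mX : forall i, measurable_fun setT (X i).
Hypothesis iX : mutually_independent P X.
Hypothesis FX : forall e A, measurable A -> P (X e @^-1` A) = F A.

Definition pair_sum (k : S -> S -> R) n w : R :=
  \sum_(i < n) \sum_(j < n | j != i) k (X i w) (X j w).

Lemma pair_sum_pairs k n w : pair_sum k n w =
  \sum_(q : 'I_n * 'I_n | q.2 != q.1) k (X q.1 w) (X q.2 w).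
Proof.
exact: (pair_big_dep predT (fun i j => j != i) (fun i j : 'I_n => k (X i w) (X j w))).
Qed.

Section degenerate_kernel.
Variable k : S -> S -> R.
Hypothesis L2k : L2 FF (fun z => k z.1 z.2).

Let L2_distinct_pair n (q : 'I_n * 'I_n) : q.2 != q.1 ->
  L2 P (fun w => k (X q.1 w) (X q.2 w)).
Proof. by move=> qne; apply: (L2_pair mX iX FX L2k); rewrite eq_sym. Qed.

Lemma L2_pair_sum n : L2 P (pair_sum k n).
Proof.
by apply: (eq_L2 (fun w => esym (pair_sum_pairs k n w))); apply: L2_sum => q; exact: L2_distinct_pair.
Qed.

Hypothesis symk : forall x y, k x y = k y x.
Hypothesis degk : {ae F, forall x, Ex F (k x) = 0}.

Lemma Ex_mul_pairs_eq0 i j i' j' : i != j -> i' != j' -> i \notin [:: i'; j'] ->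
  Ex P (fun w => k (X i' w) (X j' w) * k (X i w) (X j w)) = 0.
Proof.
move=> ij i'j' i_notin; have mk := L2_measurable L2k.
have finitary_pair e e' : finitary [:: e; e'] (fun z : nat -> S => k (z e) (z e')).
  split=> [z z' zz'|d' T Y mY]; first by rewrite !zz' ?inE ?eqxx ?orbT.
  exact: (measurableT_comp mk (measurable_fun_pair (mY e) (mY e'))).
have L2ij := L2_pair mX iX FX L2k ij; have L2ij' := L2_pair mX iX FX L2k i'j'.
rewrite (Ex_mul_partial_mean iX mX (A := pred1 i) (finitary_pair i j) (finitary_pair i' j') _
  (L2_L1 L2ij) (L2M L2ij' L2ij)); last by move=> e e_in; apply: contra i_notin => /eqP <-.
apply: ae_eq0_Ex.
  exact: measurable_finitary (finitaryM (finitary_pair i' j')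
    (finitary_partial_mean P mX (pred1 i) (finitary_pair i j))) mX.
have centered e := ae_law (mX e) (FX e) (centered_at_ae L2k degk).
apply: filterS2 (centered i) (centered j) => w centered_i centered_j.
by rewrite (partial_mean_pair mX iX FX L2k symk degk (pred1 i) (z := X ^~ w) ij centered_i centered_j).2
  /= eqxx mulr0.
Qed.

Lemma Ex_sqr_pair_sum n :
  Ex P (fun w => pair_sum k n w ^+ 2) = 2 * n%:R * (n%:R - 1) * Ex FF (fun z => k z.1 z.2 ^+ 2).
Proof.
set V := Ex FF _; under eq_Ex do rewrite pair_sum_pairs.
rewrite Ex_sqr_sum; last exact: L2_distinct_pair.
pose swap (q : 'I_n * 'I_n) := (q.2, q.1).
have sqrV (q : 'I_n * 'I_n) : q.2 != q.1 -> Ex P (fun w => k (X q.1 w) (X q.2 w) ^+ 2) = V.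
  move=> qne; have ne : nat_of_ord q.1 != nat_of_ord q.2 by rewrite eq_sym.
  exact: (Ex_law (measurable_sample_pair mX _ _) (pair_law mX iX FX ne) (measurable_funX 2 (L2_measurable L2k))).
rewrite (eq_bigr (fun=> 2 * V)) => [|[i j] /= ji].
  rewrite -(pair_big_dep predT (fun i j : 'I_n => j != i) (fun _ _ => 2 * V)) /=.
  under eq_bigr => i _ do rewrite sumr_const cardC1 card_ord.
  rewrite sumr_const card_ord; case: n {swap sqrV} => [|n]; first by rewrite !mulr0n !mulr0 !mul0r.
  by rewrite -mulrnA -[LHS]mulr_natr natrM -(natr1 n) addrK; ring.
rewrite (bigD1 (i, j))//= (bigD1 (swap (i, j)))/=; last first.
  by rewrite eq_sym ji; apply/eqP => -[ij _]; rewrite ij eqxx in ji.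
rewrite big1 => [|[i' j'] /= /andP[/andP[j'i' qij] qji]].
  under eq_Ex do rewrite -expr2.
  under [X in _ + (X + _)]eq_Ex do rewrite [k (X j _) _]symk -expr2.
  by rewrite (sqrV (i, j))// addr0; ring.
have [i_in|i_notin] := boolP (nat_of_ord i \in [:: nat_of_ord i'; nat_of_ord j']); last first.
  under eq_Ex do rewrite mulrC.
  by apply: Ex_mul_pairs_eq0 => //; rewrite eq_sym.
have j_notin : nat_of_ord j \notin [:: nat_of_ord i'; nat_of_ord j'].
  move: i_in; rewrite !inE !val_eqE => /orP[] /eqP ij'; rewrite negb_or -ij' ji ?andbT /=.
    by move: qij; rewrite xpair_eqE -ij' eqxx eq_sym.
  by move: qji; rewrite xpair_eqE -ij' eqxx andbT eq_sym.
under eq_Ex do rewrite mulrC [k (X i _) _]symk.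
by apply: Ex_mul_pairs_eq0 => //; rewrite eq_sym.
Qed.

End degenerate_kernel.
Section quadratic_gap.
Variable g : S -> R.

Lemma pair_sum_tensor n w : pair_sum (fun x y => g x * g y) n w =
  n%:R * (normalized_sum X g n w ^+ 2 - average X (fun x => g x ^+ 2) n w).
Proof.
case: n => [|n]; first by rewrite /pair_sum big_ord0 mul0r.
have n_neq0 : n.+1%:R != 0 :> R by rewrite pnatr_eq0.
rewrite exprMn exprVn sqr_sqrtr// -mulrBr mulVKf// expr2 big_distrlr /= -sumrB.
apply: eq_bigr => i _.
by rewrite [in RHS](bigD1 i)//= -expr2 addrAC subrr add0r.
Qed.

Definition quadratic_gap n w : R := (n%:R - 1)^-1 * pair_sum (fun x y => g x * g y) n w -
  (normalized_sum X g n w ^+ 2 - Ex F (fun x => g x ^+ 2)).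

Hypothesis Lg : L2 F g.

Let L1_sqr_sum n : L1 P (fun w => normalized_sum X g n w ^+ 2).
Proof. by case: (L2_normalized_sum mX FX n Lg). Qed.

Let L1_average_sqr n : L1 P (average X (fun x => g x ^+ 2) n).
Proof. by apply: (L1_average mX FX); case: Lg. Qed.

Lemma L1_quadratic_gap n : L1 P (quadratic_gap n).
Proof.
apply: L1B; last exact: L1B (L1_cst _ _).
under eq_fun do rewrite pair_sum_tensor; exact/L1Z/L1Z/L1B.
Qed.

Hypothesis Eg : Ex F g = 0.

Lemma Ex_quadratic_gap_cvg0 : Ex P (fun w => `|quadratic_gap n w|) @[n --> \oo] --> (0 : R).
Proof.
set v := Ex F (fun x => g x ^+ 2); pose avg := average X (fun x => g x ^+ 2).
have avg_ge0 n w : 0 <= avg n w.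
  by rewrite mulr_ge0 ?invr_ge0// sumr_ge0// => i _; exact: sqr_ge0.
have Ldist n : L1 P (fun w => `|avg n w - v|) by apply: L1_norm; exact: L1B (L1_cst _ _).
rewrite -(cvg_shiftS (fun n => Ex P _)) -cvg_shiftS.
apply: (cvg0_dominated (b := fun n => n.+1%:R^-1 * (2 * v) + Ex P (fun w => `|avg n.+2 w - v|))).
  move=> n; rewrite ger0_norm ?Ex_ge0//.
  have n1_neq0 : n.+1%:R != 0 :> R by rewrite pnatr_eq0.
  have n1E : n.+2%:R - 1 = n.+1%:R :> R by rewrite -(natr1 n.+1) addrK.
  have Lmain : L1 P (fun w => n.+1%:R^-1 * (normalized_sum X g n.+2 w ^+ 2 + avg n.+2 w)).
    exact/L1Z/L1D.
  apply: (@le_trans _ _ (Ex P (fun w =>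
      n.+1%:R^-1 * (normalized_sum X g n.+2 w ^+ 2 + avg n.+2 w) + `|avg n.+2 w - v|))).
    apply: le_Ex; [exact/L1_norm/L1_quadratic_gap|exact: L1D|move=> w].
    rewrite /quadratic_gap pair_sum_tensor n1E -[n.+2%:R]natr1 -/v -/(avg _ _).
    rewrite [X in `|X|](_ : _ = n.+1%:R^-1 * (normalized_sum X g n.+2 w ^+ 2 - avg n.+2 w) -
      (avg n.+2 w - v)); last by field.
    apply: le_trans (ler_normB _ _) _; rewrite lerD2r normrM ger0_norm ?invr_ge0//.
    rewrite ler_wpM2l ?invr_ge0//; apply: le_trans (ler_normB _ _) _.
    by rewrite !ger0_norm ?sqr_ge0.
  rewrite ExD// ExZ; last exact: L1D.
  rewrite ExD// lerD2r ler_wpM2l ?invr_ge0// mulr_natl mulr2n lerD//.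
    exact: (Ex_sqr_normalized_sum_le mX iX FX _ Lg Eg).
  by rewrite (Ex_average mX FX _ Lg.2).
rewrite -[X in _ --> X]addr0; apply: cvgD.
  by rewrite -[X in _ --> X](mul0r (2 * v)); apply: cvgM; [exact: cvg_harmonic|exact: cvg_cst].
have := weak_lln mX iX FX Lg.2; rewrite -cvg_shiftS => lln.
by have := lln; rewrite -(cvg_shiftS (fun n => Ex P _)).
Qed.

End quadratic_gap.
End pair_sums.

Section degenerate_pair_clt.
Context {d dS d' : measure_display} {O : measurableType d} {S : measurableType dS}
  {O' : measurableType d'} {R : realType} (P : probability O R) (P' : probability O' R)
  (X : nat -> O -> S) (F : probability S R) (k : S -> S -> R) (lam : nat -> R)
  (phi : nat -> S -> R) (Z : nat -> O' -> R) (eta : O' -> R).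
Local Notation FF := (F \x F)%E.
Local Notation kk := (fun z => k z.1 z.2).
Hypothesis mX : forall i, measurable_fun setT (X i).
Hypothesis iX : mutually_independent P X.
Hypothesis FX : forall e A, measurable A -> P (X e @^-1` A) = F A.
Hypothesis L2k : L2 FF kk.
Hypothesis symk : forall x y, k x y = k y x.
Hypothesis degk : {ae F, forall x, Ex F (k x) = 0}.
Hypothesis eigk : eigensystem F kk lam phi.

Local Notation psi := (efun lam phi).
Local Notation rest J := (fun x y => resid kk lam phi J (x, y)).

Let integral_op_cst1 : {ae F, forall x, integral_op F kk (fun=> 1) x = 0}.
Proof. by apply: filterS degk => x <-; apply: eq_Ex => t; rewrite mulr1. Qed.

Lemma Ex_efun_degenerate l : Ex F (psi l) = 0.
Proof.
have [l0|l_neq0] := eqVneq (lam l) 0.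
  by rewrite -[RHS](Ex_cst F 0); apply: eq_Ex => x; rewrite /efun l0 eqxx.
have Lpsi := L2_efun eigk l; have mpsi := L2_measurable Lpsi.
have Lop1 := L2_integral_op L2k (L2_cst F 1); have Lop := L2_integral_op L2k Lpsi.
apply: (mulfI l_neq0); rewrite mulr0 -ExZ; last exact: L2_L1.
have adjoint := integral_op_adjoint L2k (fun x y => symk x y) Lpsi (L2_cst F 1).
transitivity (Ex F (fun x => integral_op F kk (psi l) x * 1)).
  apply: ae_eq_Ex; [exact: measurable_funM| |].
    by apply: measurable_funM => //; exact: L2_measurable Lop.
  by apply: filterS (eig_efun eigk l) => x ->; rewrite mulr1.
rewrite adjoint; apply: ae_eq0_Ex.
  by apply: measurable_funM => //; exact: L2_measurable Lop1.
by apply: filterS integral_op_cst1 => x ->; rewrite mulr0.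
Qed.

Lemma resid_degenerate J : {ae F, forall x, Ex F (rest J x) = 0}.
Proof.
apply: filterS2 (integral_op_resid L2k eigk J (L2_cst F 1)) integral_op_cst1 => x resid1 k1.
transitivity (integral_op F (resid kk lam phi J) (fun=> 1) x).
  by apply: eq_Ex => t; rewrite mulr1.
rewrite resid1 k1 big1 ?subr0// => l _; under eq_Ex do rewrite mulr1.
by rewrite Ex_efun_degenerate mulr0.
Qed.

Lemma eigenvalue_mul_Ex_sqr l : lam l * Ex F (fun x => psi l x ^+ 2) = lam l.
Proof.
under eq_Ex do rewrite expr2; rewrite (orth_efun eigk) eqxx /=.
by case: eqVneq => [->|_]; rewrite ?mulr1 ?mul0r.
Qed.

Local Notation truncated_sum J n w :=
  (\sum_(l < J) lam l * (normalized_sum X (psi l) n w ^+ 2 - 1)).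

Lemma pair_sum_expansion J n w :
  (n%:R - 1)^-1 * pair_sum X k n w - truncated_sum J n w =
  (n%:R - 1)^-1 * pair_sum X (rest J) n w + \sum_(l < J) lam l * quadratic_gap X F (psi l) n w.
Proof.
have -> : pair_sum X k n w = pair_sum X (rest J) n w +
    \sum_(l < J) lam l * pair_sum X (fun x y => psi l x * psi l y) n w.
  under [X in _ + X]eq_bigr do rewrite pair_sum_pairs mulr_sumr.
  rewrite exchange_big !pair_sum_pairs -big_split; apply: eq_bigr => q _ /=.
  by rewrite /resid subrK.
rewrite mulrDr -addrA; congr (_ + _); rewrite mulr_sumr -sumrB; apply: eq_bigr => l _.
rewrite /quadratic_gap [in RHS]mulrBr [lam l * (_ - Ex _ _)]mulrBr eigenvalue_mul_Ex_sqr.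
by rewrite mulrBr mulr1 mulrCA.
Qed.

Let L2_rest J : L2 FF (fun z => rest J z.1 z.2).
Proof. by apply: eq_L2 (L2_resid L2k eigk J) => -[]. Qed.

Let L2_pair_sum_rest J n : L2 P (pair_sum X (rest J) n).
Proof. exact: (L2_pair_sum mX iX FX (L2_rest J)). Qed.

Lemma Ex_norm_pair_sum_resid_le J n (rho : R) : 0 <= rho -> (1 < n)%N ->
  Ex FF (fun z => resid kk lam phi J z ^+ 2) <= rho ^+ 2 ->
  Ex P (fun w => `|(n%:R - 1)^-1 * pair_sum X (rest J) n w|) <= 2 * rho.
Proof.
move=> rho0 n_gt1 resid_le.
apply: Ex_norm_le_sqrt; [exact: L2Z|exact: mulr_ge0|].
rewrite Ex_sqrZ// (Ex_sqr_pair_sum mX iX FX (L2_rest J)); last exact: resid_degenerate.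
  under [Ex FF _]eq_Ex => z do rewrite -surjective_pairing.
  have nB1_ge1 : 1 <= n%:R - 1 :> R by rewrite lerBrDr -[1 + 1]/(2%:R) ler_nat.
  have nB1_gt0 : 0 < n%:R - 1 :> R by exact: lt_le_trans nB1_ge1.
  rewrite [leLHS](_ : _ = 2 * (n%:R / (n%:R - 1)) * Ex FF (fun z => resid kk lam phi J z ^+ 2)); last first.
    by field; rewrite gt_eqF.
  rewrite exprMn; apply: ler_pM => //; [|exact: Ex_sqr_ge0|].
    by rewrite mulr_ge0// divr_ge0// ltW.
  rewrite expr2 ler_wpM2l// ler_pdivrMr//; lra.
by move=> x y; exact: (resid_swap lam phi (fun x y => symk x y) J).
Qed.

Let L1_weighted_gap J n : L1 P (fun w => \sum_(l < J) lam l * quadratic_gap X F (psi l) n w).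
Proof. by apply: L1_sum => l _; apply/L1Z/(L1_quadratic_gap mX FX)/(L2_efun eigk). Qed.

Lemma Ex_weighted_gap_cvg0 J : Ex P (fun w =>
  `|\sum_(l < J) lam l * quadratic_gap X F (psi l) n w|) @[n --> \oo] --> (0 : R).
Proof.
have Lgap l n : L1 P (quadratic_gap X F (psi l) n).
  exact: (L1_quadratic_gap mX FX (L2_efun eigk l)).
apply: (cvg0_dominated (b := fun n => \sum_(l < J) `|lam l| *
    Ex P (fun w => `|quadratic_gap X F (psi l) n w|))) => [n|].
  rewrite ger0_norm ?Ex_ge0//.
  apply: (@le_trans _ _ (Ex P (fun w =>
      \sum_(l < J) `|lam l| * `|quadratic_gap X F (psi l) n w|))).
    apply: le_Ex => [||w]; first exact: L1_norm.
      by apply: L1_sum => l _; apply: L1Z; exact: L1_norm.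
    by apply: le_trans (ler_norm_sum _ _ _) _; apply: ler_sum => l _; rewrite normrM.
  rewrite Ex_sum => [|l _]; last by apply: L1Z; exact: L1_norm.
  by apply: ler_sum => l _; rewrite ExZ//; exact: L1_norm.
rewrite [X in _ --> X](_ : 0 = \sum_(l < J) `|lam l| * 0); last by rewrite big1// => l _; rewrite mulr0.
apply: cvg_big => [|l _]; first exact: add_continuous.
apply: cvgM; first exact: cvg_cst.
exact: (Ex_quadratic_gap_cvg0 mX iX FX (L2_efun eigk l) (Ex_efun_degenerate l)).
Qed.

Lemma truncation_error J (rho e : R) : 0 <= rho -> 0 < e ->
  Ex FF (fun z => resid kk lam phi J z ^+ 2) <= rho ^+ 2 ->
  \forall n \near \oo,
    L1 P (fun w => (n%:R - 1)^-1 * pair_sum X k n w - truncated_sum J n w) /\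
    Ex P (fun w => `|(n%:R - 1)^-1 * pair_sum X k n w - truncated_sum J n w|) <= 2 * rho + e.
Proof.
move=> rho0 e0 resid_le; have /cvgrPdist_le /(_ _ e0) := Ex_weighted_gap_cvg0 J.
apply: filterS2 (nbhs_infty_gt 1) => n n_gt1; rewrite sub0r normrN ger0_norm ?Ex_ge0// => gap_le.
under eq_fun do rewrite pair_sum_expansion; under eq_Ex do rewrite pair_sum_expansion.
have Lrest : L1 P (fun w => (n%:R - 1)^-1 * pair_sum X (rest J) n w) by exact/L1Z/L2_L1.
split; first exact: L1D.
apply: le_trans (lerD (Ex_norm_pair_sum_resid_le rho0 n_gt1 resid_le) gap_le).
rewrite -ExD; [|exact: L1_norm..].
by apply: le_Ex => [||w]; [exact/L1_norm/L1D|apply: L1D; exact: L1_norm|exact: ler_normD].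
Qed.

Hypothesis mZ : forall i, measurable_fun setT (Z i).
Hypothesis iZ : mutually_independent P' Z.
Hypothesis normalZ : forall i A, measurable A -> P' (Z i @^-1` A) = normalR 0 1 A.
Hypothesis meta : measurable_fun setT eta.
Hypothesis series_eta : {ae P', forall w,
  (\sum_(l < J) lam l * (Z l w ^+ 2 - 1)) @[J --> \oo] --> eta w}.

Lemma Ex_truncated_series_cvg (c : R) (f : R -> R) : smooth f ->
  Ex P' (fun w => f (c * \sum_(l < J) lam l * (Z l w ^+ 2 - 1))) @[J --> \oo] -->
  Ex P' (fun w => f (c * eta w)).
Proof.
move=> /smooth_bounded_lipschitz[M fM /klipschitz_continuous cf].
apply: (Ex_dct (g := fun=> M)) => //.
- move=> J; apply: measurable_continuous_comp => //; apply: measurable_funM => //.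
  apply: measurable_sum => l; apply: measurable_funM => //; apply: measurable_funB => //.
  exact: measurable_funX.
- by apply: measurable_continuous_comp => //; exact: measurable_funM.
- exact: L1_cst.
apply: filterS series_eta => w cvg_w; apply: continuous_cvg; first exact: cf.
by apply: cvgM; [exact: cvg_cst|exact: cvg_w].
Qed.

Lemma truncated_clt J (c : R) (f : R -> R) : smooth f ->
  Ex P (fun w => f (c * truncated_sum J n w)) @[n --> \oo] -->
  Ex P' (fun w => f (c * \sum_(l < J) lam l * (Z l w ^+ 2 - 1))).
Proof.
move=> sf; pose s (l : 'I_J) : R := (lam l != 0)%:R.
have cov (i j : 'I_J) : Ex F (fun x => psi i x * psi j x) = if i == j then s i ^+ 2 else 0.
  rewrite (orth_efun eigk) val_eqE /s; case: (i == j) => //=.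
  by case: (lam i != 0); rewrite ?expr1n ?expr0n.
have := quadratic_clt (u := fun l : 'I_J => psi l) (a := fun l : 'I_J => c * lam l) mX iX FX
  (fun l : 'I_J => mZ l) (independent_reindex iZ val_inj) (fun l : 'I_J => normalZ l)
  (fun l : 'I_J => L2_efun eigk l) (fun l : 'I_J => Ex_efun_degenerate l) cov sf.
under eq_fun do under eq_Ex do under eq_bigr do rewrite -mulrA.
under eq_fun do under eq_Ex do rewrite -mulr_sumr.
rewrite (_ : Ex P' _ = Ex P' (fun w => f (c * \sum_(l < J) lam l * (Z l w ^+ 2 - 1))))//.
apply: eq_Ex => w; rewrite mulr_sumr; congr f; apply: eq_bigr => l _; rewrite -mulrA /s.
by case: eqVneq => [->|_]; rewrite ?mul0r ?mul1r.
Qed.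

Theorem degenerate_pair_clt (c : R) (f : R -> R) : smooth f ->
  Ex P (fun w => f (c * ((n%:R - 1)^-1 * pair_sum X k n w))) @[n --> \oo] -->
  Ex P' (fun w => f (c * eta w)).
Proof.
move=> sf; have [M fM fL] := smooth_bounded_lipschitz sf.
apply: cvg_approx => e e0; have Mc0 : 0 <= M * `|c| by rewrite mulr_ge0// (klipschitz_ge0 fL).
have [rho rho0 rho_le] := small_multiple (mulr_ge0 Mc0 (ler0n R 3)) e0.
have /cvgrPdist_le /(_ _ e0) eta_near := Ex_truncated_series_cvg (c := c) sf.
have /cvgrPdist_le /(_ _ (exprn_gt0 2 rho0)) resid_near :=
  eigenfunction_expansion L2k (fun x y => symk x y) eigk.
have [J _ /(_ J (leqnn J)) [resid_le eta_le]] := filterI resid_near eta_near.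
rewrite /= sub0r normrN ger0_norm ?Ex_sqr_ge0// in resid_le.
exists (fun n => Ex P (fun w => f (c * truncated_sum J n w))),
  (Ex P' (fun w => f (c * \sum_(l < J) lam l * (Z l w ^+ 2 - 1)))).
split; [|exact: eta_le|exact: truncated_clt].
apply: filterS (truncation_error (ltW rho0) rho0 resid_le) => n [Lerr err_le].
have scaledB w : c * ((n%:R - 1)^-1 * pair_sum X k n w) - c * truncated_sum J n w =
    c * ((n%:R - 1)^-1 * pair_sum X k n w - truncated_sum J n w) by rewrite mulrBr.
have mpair : measurable_fun setT (pair_sum X k n) := L2_measurable (L2_pair_sum mX iX FX L2k n).
have mtrunc : measurable_fun setT (fun w => truncated_sum J n w).
  apply: measurable_sum => l; apply: measurable_funM => //; apply: measurable_funB => //.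
  exact/measurable_funX/L2_measurable/(L2_normalized_sum mX FX)/(L2_efun eigk).
apply: le_trans (Ex_klipschitz_diff _ fM fL _ _) _.
- by apply: measurable_funM => //; exact: measurable_funM.
- exact: measurable_funM.
- by under eq_fun do rewrite scaledB; exact: L1Z.
under eq_Ex do rewrite scaledB normrM.
rewrite ExZ; last exact: L1_norm.
by apply: le_trans rho_le; rewrite mulrA -[leRHS]mulrA ler_wpM2l//; lra.
Qed.

End degenerate_pair_clt.

(** * Projections of a two-sample kernel *)

Section projections.
Context {R : realType} {p m0 m1 : nat} {d : measure_display} {O : measurableType d}
  (P : probability O R) (X : bool * nat -> O -> p.-tuple R).
Local Notation S := (p.-tuple R).
Hypothesis mX : forall i, measurable_fun setT (X i).
Hypothesis iX : mutually_independent P X.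
Implicit Types (r : m0.-tuple S -> m1.-tuple S -> R).

Lemma eq_projection r a b z z' : (forall e, ~~ hidden a b e -> z e = z' e) ->
  projection P X r a b z = projection P X r a b z'.
Proof.
move=> zz'; rewrite !projectionE; apply: eq_Ex => w; congr (kernel_head r _).
by apply/funext => e; case: ifPn => // /zz'.
Qed.

Lemma projection00 r z :
  projection P X r 0 0 z = Ex P (fun w => kernel_head r (X ^~ w)).
Proof.
rewrite projectionE; apply: eq_Ex => w; congr (kernel_head r _).
by apply/funext => e; rewrite /hidden if_same ltn0.
Qed.

Lemma measurable_projection r a b (d' : measure_display) (T : measurableType d')
    (Y : bool * nat -> T -> S) : sym_kernel r -> (forall e, measurable_fun setT (Y e)) ->
  measurable_fun setT (fun t => projection P X r a b (Y ^~ t)).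
Proof.
move=> /finitary_kernel_head fin mY; rewrite projectionE.
exact: measurable_finitary (finitary_partial_mean P mX _ fin) mY.
Qed.

Lemma projectionB r r' a b : sym_kernel r -> sym_kernel r' ->
  L2 P (fun w => kernel_head r (X ^~ w)) -> L2 P (fun w => kernel_head r' (X ^~ w)) ->
  {ae P, forall w, projection P X (fun x y => r x y - r' x y) a b (X ^~ w) =
    projection P X r a b (X ^~ w) - projection P X r' a b (X ^~ w)}.
Proof.
move=> sr sr' Lr Lr'.
apply: filterS2 (L1_hfill_ae mX iX sr Lr a b) (L1_hfill_ae mX iX sr' Lr' a b) => w Lw Lw'.
by rewrite /projection !hprojE -ExB.
Qed.

Lemma projection_tower r a b a' b' : (a <= a')%N -> (b <= b')%N -> sym_kernel r ->
  L1 P (fun w => kernel_head r (X ^~ w)) ->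
  {ae P, forall w, projection P X r a b (X ^~ w) =
    partial_mean P X (hidden a b) (projection P X r a' b') (X ^~ w)}.
Proof.
move=> aa' bb' /finitary_kernel_head fin Lr.
apply: filterS (L1_partial_ae iX mX (hidden a b) fin Lr) => w Lw.
pose Phi x := kernel_head r (fun e => if hidden a b e then x e else X e w).
have finPhi : finitary (@head_labels m0 m1) Phi.
  split=> [x x' xx'|d' T Y mY].
    by apply: fin.1 => e eL; case: ifP => // _; exact: xx'.
  apply: (measurable_finitary (Y := fun e t => if hidden a b e then Y e t else X e w) fin) => e.
  by case: (hidden a b e).
rewrite !projectionE.
rewrite [LHS](esym (Ex_partial_mean iX mX (hidden a' b') finPhi Lw)) /partial_mean /Phi.
apply: eq_Ex => w'; apply: eq_Ex => w''; congr (kernel_head r _); apply/funext => e.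
have visible : hidden a' b' e -> hidden a b e.
  by rewrite /hidden -!leqNgt; apply: leq_trans; case: e.1.
by have [//|/negP ab_e] := boolP (hidden a b e); case: ifPn => // /visible.
Qed.

Variable F : probability S R.
Hypothesis FX : forall e A, measurable A -> P (X e @^-1` A) = F A.
Local Notation FF := (F \x F)%E.

Lemma projection_sumker g a b z : L2 F g -> Ex F g = 0 ->
  projection P X (sumker g : m0.-tuple S -> m1.-tuple S -> R) a b z =
  \sum_(j < m1 | (j < b)%N) g (z (true, nat_of_ord j)).
Proof.
move=> Lg Eg; rewrite projectionE (partial_mean_sumker mX FX)//.
by apply: eq_bigl => j; rewrite /hidden /= negbK.
Qed.

Section pair_kernel.
Variable k : S -> S -> R.
Hypothesis L2k : L2 FF (fun z => k z.1 z.2).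
Hypothesis symk : forall x y, k x y = k y x.
Hypothesis degk : {ae F, forall x, Ex F (k x) = 0}.
Local Notation pairk := (pairker k : m0.-tuple S -> m1.-tuple S -> R).

Let projection_pairker a b : {ae P, forall w, projection P X pairk a b (X ^~ w) =
  2^-1 * \sum_(i < m1 | (i < b)%N) \sum_(j < m1 | (j != i) && (j < b)%N)
    k (X (true, nat_of_ord i) w) (X (true, nat_of_ord j) w)}.
Proof.
apply: filterS (partial_mean_pairker (m0 := m0) (m1 := m1) mX iX FX L2k symk degk (hidden a b)) => w.
have visible (j : 'I_m1) : ~~ hidden a b (true, nat_of_ord j) = (j < b)%N by rewrite negbK.
rewrite projectionE => ->; rewrite (eq_bigl _ _ visible); congr (_ * _).
by apply: eq_bigr => i _; apply: eq_bigl => j; rewrite visible.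
Qed.

Lemma projection_pairker_le1 a b : (b <= 1)%N ->
  {ae P, forall w, projection P X pairk a b (X ^~ w) = 0}.
Proof.
move=> b_le1; apply: filterS (projection_pairker a b) => w ->.
rewrite big1 ?mulr0// => i ib; rewrite big1// => j /andP[ji jb]; case/eqP: ji; apply: val_inj.
have /eqP i0 : nat_of_ord i == 0%N by rewrite -leqn0 -ltnS; exact: leq_trans b_le1.
have /eqP j0 : nat_of_ord j == 0%N by rewrite -leqn0 -ltnS; exact: leq_trans b_le1.
by rewrite [LHS]j0 [RHS]i0.
Qed.

Lemma projection_pairker_2 a : (1 < m1)%N ->
  {ae P, forall w, projection P X pairk a 2 (X ^~ w) = k (X (true, 0%N) w) (X (true, 1%N) w)}.
Proof.
move=> m1_gt1; apply: filterS (projection_pairker a 2) => w ->.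
rewrite (big_ord_narrow m1_gt1) !big_ord_recl big_ord0 addr0.
rewrite !(big_ord_narrow_cond m1_gt1) [X in X + _]big_mkcond [X in _ + X]big_mkcond.
rewrite !big_ord_recl !big_ord0 /= !add0r !addr0 /bump /= addn0 [k (X (true, 1%N) w) _]symk.
by field.
Qed.

End pair_kernel.
End projections.

Section hoeffding_residuals.
Context {R : realType} {p m0 m1 : nat} {d : measure_display} {O : measurableType d}
  (P : probability O R) (X : bool * nat -> O -> p.-tuple R) (F : probability (p.-tuple R) R)
  (h : m0.-tuple (p.-tuple R) -> m1.-tuple (p.-tuple R) -> R).
Local Notation S := (p.-tuple R).
Local Notation FF := (F \x F)%E.
Hypothesis mX : forall i, measurable_fun setT (X i).
Hypothesis iX : mutually_independent P X.
Hypothesis FX : forall e A, measurable A -> P (X e @^-1` A) = F A.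
Hypothesis symh : sym_kernel h.
Hypothesis L2h : L2 P (fun w => kernel_head h (X ^~ w)).
Hypothesis Eh : Ex P (fun w => kernel_head h (X ^~ w)) = 0.

Definition proj01 (x : S) : R := projection P X h 0 1 (fun=> x).

(* The default [x] outside the cases makes this the paper's expression up to conversion. *)
Definition proj02 (x y : S) : R :=
  projection P X h 0 2 (fun e => if e.1 then if e.2 == 0%N then x else y else x).

Lemma projection01 z : projection P X h 0 1 z = proj01 (z (true, 0%N)).
Proof. by apply: eq_projection => -[[] [|j]]. Qed.

Lemma projection02 z : projection P X h 0 2 z = proj02 (z (true, 0%N)) (z (true, 1%N)).
Proof. by apply: eq_projection => -[[] [|[|j]]]. Qed.

Lemma measurable_proj01 : measurable_fun setT proj01.
Proof. exact: (measurable_projection P mX 0 1 (Y := fun _ x => x) symh (fun=> @measurable_id _ _ _)). Qed.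

Lemma measurable_proj02 : measurable_fun setT (fun z : S * S => proj02 z.1 z.2).
Proof.
apply: (measurable_projection P mX 0 2
  (Y := fun e (z : S * S) => if e.1 then if e.2 == 0%N then z.1 else z.2 else z.1) symh) => e.
by case: e => [[] [|j]]; [exact: measurable_fst|exact: measurable_snd|exact: measurable_fst..].
Qed.

Lemma L2_proj01 : L2 F proj01.
Proof.
apply/(L2_law (mX (true, 0%N)) (FX _) measurable_proj01).
by apply: eq_L2 (L2_projection mX iX symh L2h 0 1) => w; rewrite projection01.
Qed.

Lemma L2_proj02 : L2 FF (fun z => proj02 z.1 z.2).
Proof.
have case01 : (true, 0%N) != (true, 1%N) by [].
apply/(L2_law (measurable_sample_pair mX _ _) (pair_law mX iX FX case01) measurable_proj02).
by apply: eq_L2 (L2_projection mX iX symh L2h 0 2) => w; rewrite projection02.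
Qed.

Lemma Ex_proj01 : Ex F proj01 = 0.
Proof.
rewrite -(Ex_law (mX (true, 0%N)) (FX _) measurable_proj01).
rewrite -[RHS]Eh -(Ex_projection mX iX symh L2h 0 1).
by apply: eq_Ex => w; rewrite projection01.
Qed.

Lemma proj02_sym x y : (1 < m1)%N -> proj02 x y = proj02 y x.
Proof.
case: symh => _ _ symh1 m1_gt1; rewrite /proj02 /projection !hprojE; apply: eq_Ex => w.
apply: symh1; pose i0 := Ordinal (ltnW m1_gt1 : (0 < m1)%N); pose i1 := Ordinal m1_gt1.
apply/tuple_permP; exists (tperm i0 i1); congr (tval _); apply: eq_from_tnth => j.
rewrite !tnth_mktuple; case: tpermP => [->|->|j0 j1] //=.
have j_ge2 : (1 < j)%N.
  case: j j0 j1 => [[|[|j]] jm] //= j0 j1; first by case: j0; exact: val_inj.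
  by case: j1; exact: val_inj.
by rewrite ltnNge j_ge2.
Qed.

Lemma Ex_proj02_ae : {ae F, forall x, Ex F (proj02 x) = proj01 x}.
Proof.
have mproj02 x : measurable_fun setT (proj02 x) := measurable_slice1 x measurable_proj02.
suff : {ae F, forall x, Ex F (proj02 x) - proj01 x = 0}.
  by apply: filterS => x /eqP; rewrite subr_eq0 => /eqP.
apply: (ae_law_inv (mX (true, 0%N)) (FX _)).
  by apply: measurable_funB measurable_proj01; exact: (measurable_Ex_slice F measurable_proj02).
apply: filterS (projection_tower mX iX (leqnn 0) (leqnSn 1) symh (L2_L1 L2h)) => w.
rewrite projection01 => ->; apply/eqP; rewrite subr_eq0; apply/eqP.
rewrite -(Ex_law (mX (true, 1%N)) (FX _) (mproj02 _)).
by apply: eq_Ex => w'; rewrite projection02.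
Qed.

Lemma xiE a b : xi P X h a b = (Ex P (fun w => projection P X h a b (X ^~ w) ^+ 2))%:E.
Proof.
have Lab := L2_projection mX iX symh L2h a b.
rewrite /xi /variance unlock [in X in X = _]unlock.
have -> : fine (\int[P]_w (projection P X h a b (X ^~ w))%:E)%E = 0.
  exact: etrans (Ex_projection mX iX symh L2h a b) Eh.
rewrite -L1_int; last by case: Lab.
by apply: eq_integral => w _; rewrite !fctE /= subr0 -expr2.
Qed.

Lemma xi_eq0_ae a b : xi P X h a b = 0%E -> {ae P, forall w, projection P X h a b (X ^~ w) = 0}.
Proof. by rewrite xiE => -[]; exact/Ex_sqr_eq0_ae/(L2_projection mX iX symh L2h). Qed.

Lemma xi01E : xi P X h 0 1 = (Ex F (fun x => proj01 x ^+ 2))%:E.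
Proof.
rewrite xiE -(Ex_law (mX (true, 0%N)) (FX _) (measurable_funX 2 measurable_proj01)).
by congr EFin; apply: eq_Ex => w; rewrite projection01.
Qed.

Lemma proj02_degenerate : xi P X h 0 1 = 0%E -> {ae F, forall x, Ex F (proj02 x) = 0}.
Proof.
move=> /xi_eq0_ae xi01; have : {ae F, forall x, proj01 x = 0}.
  apply: (ae_law_inv (mX (true, 0%N)) (FX _) measurable_proj01).
  by apply: filterS xi01 => w; rewrite projection01.
by apply: filterS2 Ex_proj02_ae => x ->.
Qed.

Definition linear_resid (x : m0.-tuple S) (y : m1.-tuple S) : R := h x y - sumker proj01 x y.

Definition pair_resid (x : m0.-tuple S) (y : m1.-tuple S) : R := h x y - pairker proj02 x y.

Let sym_sumker := sym_kernel_sumker (m0 := m0) (m1 := m1) measurable_proj01.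

Let sym_pairker := sym_kernel_pairker (m0 := m0) (m1 := m1) measurable_proj02.

Let L2_sum_part := L2_sumker (m0 := m0) (m1 := m1) mX FX L2_proj01.

Let L2_pair_part := L2_pairker (m0 := m0) (m1 := m1) mX iX FX L2_proj02.

Lemma sym_linear_resid : sym_kernel linear_resid.
Proof. exact: sym_kernelB. Qed.

Lemma sym_pair_resid : sym_kernel pair_resid.
Proof. exact: sym_kernelB. Qed.

Lemma L2_linear_resid : L2 P (fun w => kernel_head linear_resid (X ^~ w)).
Proof. exact: L2B. Qed.

Lemma L2_pair_resid : L2 P (fun w => kernel_head pair_resid (X ^~ w)).
Proof. exact: L2B. Qed.

Lemma linear_resid_degenerate : (0 < m1)%N ->
  degenerate_below P X linear_resid [:: (1, 0); (0, 2)]%N.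
Proof.
move=> m1_gt0 a b _ _ /=; rewrite orbF negb_or !negb_and -!ltnNge /= orbF ltnS leqn0.
move=> /andP[/eqP -> b_lt2].
apply: filterS (projectionB mX iX 0 b symh sym_sumker L2h L2_sum_part) => w ->.
rewrite (projection_sumker mX FX _ _ _ L2_proj01 Ex_proj01).
case: b b_lt2 => [|[|b]] // _; first by rewrite projection00 Eh big1 ?subrr// => j; rewrite ltn0.
by rewrite projection01 (big_ord_narrow m1_gt0) big_ord1 subrr.
Qed.

Section vanishing_linear_projection.
Hypothesis m1_gt1 : (1 < m1)%N.
Hypothesis xi01_eq0 : xi P X h 0 1 = 0%E.

Let proj02C x y : proj02 x y = proj02 y x. Proof. exact: proj02_sym. Qed.

Let degenerate_pair := proj02_degenerate xi01_eq0.

Let projection0_pair_resid b : (b <= 2)%N ->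
  {ae P, forall w, projection P X pair_resid 0 b (X ^~ w) = 0}.
Proof.
have split := projectionB mX iX 0 b symh sym_pairker L2h L2_pair_part.
have pair_le1 := projection_pairker_le1 (m0 := m0) (m1 := m1) mX iX FX L2_proj02 proj02C degenerate_pair 0.
case: b split => [|[|[|b]]]// split _.
- by apply: filterS2 split (pair_le1 0%N isT) => w -> ->; rewrite projection00 Eh subrr.
- by apply: filterS3 split (pair_le1 1%N isT) (xi_eq0_ae xi01_eq0) => w -> -> ->; rewrite subrr.
have pair_2 := projection_pairker_2 (m0 := m0) mX iX FX L2_proj02 proj02C degenerate_pair 0 m1_gt1.
by apply: filterS2 split pair_2 => w -> ->; rewrite projection02 subrr.
Qed.

Lemma pair_resid_degenerate : degenerate_below P X pair_resid [:: (1, 0); (0, 3)]%N.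
Proof. by case=> [|a] [|[|[|b]]] //= _ _ _; exact: projection0_pair_resid. Qed.

Lemma pair_resid_degenerate_xi10 : xi P X h 1 0 = 0%E ->
  degenerate_below P X pair_resid [:: (2, 0); (1, 1); (0, 3)]%N.
Proof.
move=> xi10; case=> [|[|a]] [|[|[|b]]] //= _ _ _; try exact: projection0_pair_resid.
have pair_le1 := projection_pairker_le1 (m0 := m0) (m1 := m1) mX iX FX L2_proj02 proj02C degenerate_pair 1.
apply: filterS3 (projectionB mX iX 1 0 symh sym_pairker L2h L2_pair_part) (pair_le1 0%N isT) (xi_eq0_ae xi10).
by move=> w -> -> ->; rewrite subrr.
Qed.

End vanishing_linear_projection.
End hoeffding_residuals.

(** * Limit laws *)

Section sample_sizes.
Context {R : realType} (n0 n1 : nat -> nat).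
Hypothesis n1_oo : ((n1 k)%:R : R) @[k --> \oo] --> +oo.
Hypothesis ratio0 : (n1 k)%:R / (n0 k + n1 k)%:R @[k --> \oo] --> (0 : R).

Lemma cvg_subsample (u : nat -> R) (l : R) : u n @[n --> \oo] --> l -> u (n1 k) @[k --> \oo] --> l.
Proof. by move/cvgrnyP : n1_oo => n1y; exact: cvg_comp n1y. Qed.

Lemma inv_size_cvg0 : (n1 k)%:R^-1 @[k --> \oo] --> (0 : R).
Proof.
apply/gtr0_cvgV0 => //; have /cvgryPgt /(_ 0) := n1_oo; exact.
Qed.

Lemma size_power_ratio_cvg0 j : (n1 k)%:R ^+ j * (n1 k)%:R ^- j.+1 @[k --> \oo] --> (0 : R).
Proof.
have powE (x : R) : x ^+ j * x ^- j.+1 = x^-1.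
  have [->|x_neq0] := eqVneq x 0; first by rewrite !expr0n !invr0 mulr0.
  by rewrite exprSr invfM mulrA mulfV ?mul1r// expf_neq0.
by under eq_cvg do rewrite powE; exact: inv_size_cvg0.
Qed.

Lemma size_ratio_cvg0 : (n1 k)%:R / (n0 k)%:R @[k --> \oo] --> (0 : R).
Proof.
pose q k : R := (n1 k)%:R / (n0 k + n1 k)%:R.
have ratioE k : (n1 k)%:R / (n0 k)%:R = q k / (1 - q k).
  have [n0_eq0|n0_neq0] := eqVneq (n0 k) 0%N.
    rewrite /q n0_eq0 add0n invr0 mulr0; have [->|n1_neq0] := eqVneq ((n1 k)%:R : R) 0; first by rewrite !mul0r.
    by rewrite divff// subrr invr0 mulr0.
  have sum_neq0 : (n0 k)%:R + (n1 k)%:R != 0 :> R.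
    by rewrite -natrD pnatr_eq0 addn_eq0 (negbTE n0_neq0).
  by rewrite /q natrD; field; rewrite sum_neq0 addrK pnatr_eq0.
rewrite -[X in _ --> X](mul0r (1 - 0)^-1); under eq_cvg do rewrite ratioE.
apply: cvgM; first exact: ratio0.
by apply: cvgV; [rewrite subr0 oner_neq0|apply: cvgB; [exact: cvg_cst|exact: ratio0]].
Qed.

Lemma sizes_large (a b : nat) : \forall k \near \oo, (a <= n0 k)%N /\ (b <= n1 k)%N.
Proof.
have half_gt0 : 0 < 2^-1 :> R by rewrite invr_gt0.
have /cvgryPge /(_ (maxn a (maxn b 1))%:R) := n1_oo.
have /cvgrPdist_le /(_ _ half_gt0) := ratio0.
apply: filterS2 => k; rewrite sub0r normrN ger0_norm ?divr_ge0// ler_nat !geq_max.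
move=> ratio_le /and3P[a_le b_le n1_gt0]; split => //; apply: leq_trans a_le _.
move: ratio_le; rewrite ler_pdivrMr ?ltr0n ?addn_gt0 ?n1_gt0 ?orbT// natrD -(ler_nat R); lra.
Qed.

End sample_sizes.

Lemma cvg_Ex_perturbation {d : measure_display} {T : measurableType d} {R : realType}
    (P : probability T R) (f : R -> R) (l : R) (Y B D : nat -> T -> R) : smooth f ->
  (forall k, measurable_fun setT (B k)) -> (forall k, L2 P (D k)) ->
  (\forall k \near \oo, forall w, Y k w = B k w + D k w) ->
  Ex P (fun w => D k w ^+ 2) @[k --> \oo] --> (0 : R) ->
  Ex P (fun w => f (B k w)) @[k --> \oo] --> l -> Ex P (fun w => f (Y k w)) @[k --> \oo] --> l.
Proof.
move=> /smooth_bounded_lipschitz[M fM fL] mB LD YE D0 cvgB.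
have M0 : 0 <= M := klipschitz_ge0 fL.
pose Y' k w := B k w + D k w; have mY' k : measurable_fun setT (Y' k).
  exact: measurable_funD (mB k) (L2_measurable (LD k)).
have Y'B k : L1 P (fun w => Y' k w - B k w).
  by apply: eq_L1 (L2_L1 (LD k)) => w; rewrite addrAC subrr add0r.
apply: (cvg_trans (G := Ex P (fun w => f (Y' k w)) @[k --> \oo])).
  by apply: near_eq_cvg; apply: filterS YE => k YE; apply: eq_Ex => w; rewrite YE.
apply: cvg_sub0 cvgB; apply: (cvg0_dominated (b := fun k => M * Num.sqrt (Ex P (fun w => D k w ^+ 2)))).
  move=> k; apply: le_trans (Ex_klipschitz_diff (mY' k) fM fL (mB k) (Y'B k)) _.
  under eq_Ex do rewrite addrAC subrr add0r; rewrite ler_wpM2l//.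
  by apply: Ex_norm_le_sqrt; rewrite ?sqrtr_ge0 ?sqr_sqrtr ?Ex_sqr_ge0.
rewrite -[X in _ --> X](mulr0 M) -[X in M * X]sqrtr0; apply: cvgM; first exact: cvg_cst.
by apply: continuous_cvg; [exact: sqrt_continuous|exact: D0].
Qed.

Lemma independent_1 {d dS : measure_display} {O : measurableType d} {S : measurableType dS}
    {R : realType} (P : probability O R) (X : 'I_1 -> O -> S) : mutually_independent P X.
Proof.
case=> [|i [|j J]] A; first by rewrite !big_nil probability_setT.
  by rewrite !big_seq1.
by rewrite /= !inE [i]ord1 [j]ord1 eqxx.
Qed.

Lemma central_limit {d dS : measure_display} {O : measurableType d} {S : measurableType dS}
    {R : realType} (P : probability O R) (X : nat -> O -> S) (F : probability S R)
    (g : S -> R) (c : R) (f : R -> R) : (forall i, measurable_fun setT (X i)) ->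
  mutually_independent P X -> (forall e A, measurable A -> P (X e @^-1` A) = F A) ->
  L2 F g -> Ex F g = 0 -> smooth f ->
  Ex P (fun w => f (c * normalized_sum X g n w)) @[n --> \oo] -->
  Ex (normalR 0 1) (fun x => f (c * Num.sqrt (Ex F (fun x => g x ^+ 2)) * x)).
Proof.
move=> mX iX FX Lg Eg sf; set s := Num.sqrt _.
have cov (i j : 'I_1) : Ex F (fun x => g x * g x) = if i == j then s ^+ 2 else 0.
  by rewrite [i]ord1 [j]ord1 eqxx sqr_sqrtr ?Ex_sqr_ge0//; apply: eq_Ex => x; rewrite expr2.
have scaleC2 (i : 'I_1) : exists theta1 theta2 M, C2_lipschitz M (fun x : R => c * x) theta1 theta2.
  exists (fun=> c), (fun=> 0), `|c|; split=> [x|x|x|x|].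
  - by have := is_deriveZ c (is_derive_id x (1 : R)); rewrite /GRing.scale /= mulr1.
  - exact: is_derive_cst.
  - by [].
  - by rewrite normr0.
  - by apply/klipschitzP => x y; rewrite subrr normr0 mulr_ge0.
have := additive_clt (Z := fun (_ : 'I_1) (x : R) => x) (P' := normalR 0 1) mX iX FX
  (fun=> @measurable_id _ _ _) (independent_1 _ _) (fun _ _ _ => erefl)
  (fun=> Lg) (fun=> Eg) cov sf scaleC2.
under eq_fun do under eq_Ex do rewrite big_ord1.
by under [X in _ --> X]eq_Ex do rewrite big_ord1 mulrA.
Qed.

Lemma Ex_normal_scale {R : realType} (s : R) (f : R -> R) : 0 < s -> measurable_fun setT f ->
  Ex (normal_prob 0 s) f = Ex (normalR 0 1) (fun x => f (s * x)).
Proof.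
move=> s0 mf; pose scale (x : R) : measurableTypeR R := s * x.
have mscale : measurable_fun setT scale by exact: measurable_funM.
apply/esym; apply: (Ex_law (G := normal_prob 0 s) mscale) => // A mA.
apply: etrans (esym (normal_affine 0 s0 mA)); rewrite normalRE; congr (normal_prob 0 1 _).
by apply/funext => x; rewrite /preimage /= add0r.
Qed.

Section two_sample_ustat.
Context {R : realType} {p m0 m1 : nat} {d : measure_display} {O : measurableType d}
  (P : probability O R) (X : bool * nat -> O -> p.-tuple R) (F : probability (p.-tuple R) R).
Local Notation S := (p.-tuple R).
Hypothesis mX : forall i, measurable_fun setT (X i).
Hypothesis iX : mutually_independent P X.
Hypothesis FX : forall e A, measurable A -> P (X e @^-1` A) = F A.
Variables n0 n1 : nat -> nat.
Hypothesis n1_oo : ((n1 k)%:R : R) @[k --> \oo] --> +oo.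
Hypothesis ratio0 : (n1 k)%:R / (n0 k + n1 k)%:R @[k --> \oo] --> (0 : R).

Let idX i j A : measurable A -> P (X i @^-1` A) = P (X j @^-1` A).
Proof. by move=> mA; rewrite !FX. Qed.

Local Notation cases := (fun j => X (true, j)).

Let mcases j : measurable_fun setT (cases j). Proof. exact: mX. Qed.

Let icases : mutually_independent P cases.
Proof. by apply: (independent_reindex iX (f := pair true)) => i j []. Qed.

Let Fcases j A : measurable A -> P (cases j @^-1` A) = F A. Proof. exact: FX. Qed.

Lemma Ex_sqr_scaled_Ustat_cvg0 (r : m0.-tuple S -> m1.-tuple S -> R) (L : seq (nat * nat))
    (c : nat -> R) : sym_kernel r -> L2 P (fun w => kernel_head r (X ^~ w)) ->
  degenerate_below P X r L ->
  {in L, forall l, c k ^+ 2 * ((n0 k)%:R ^- l.1 * (n1 k)%:R ^- l.2) @[k --> \oo] --> (0 : R)} ->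
  Ex P (fun w => (c k * Ustat X r (n0 k) (n1 k) w) ^+ 2) @[k --> \oo] --> (0 : R).
Proof.
move=> symr L2r degen rate0; set V := Ex P (fun w => kernel_head r (X ^~ w) ^+ 2).
pose a (l : nat * nat) : R := 'C(m0, l.1)%:R * m0%:R ^+ l.1 * ('C(m1, l.2)%:R * m1%:R ^+ l.2).
apply: (cvg0_dominated (b := fun k => V * \sum_(l <- L | l \in L)
    a l * (c k ^+ 2 * ((n0 k)%:R ^- l.1 * (n1 k)%:R ^- l.2)))) => [k|].
  have LU := L2_Ustat mX iX idX symr L2r (n0 k) (n1 k).
  rewrite ger0_norm ?Ex_sqr_ge0// Ex_sqrZ//.
  apply: le_trans (ler_wpM2l (sqr_ge0 _) (ustat_variance mX iX idX symr L2r (n0 k) (n1 k) degen)) _.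
  rewrite mulrCA -/V ler_wpM2l ?Ex_sqr_ge0// mulr_sumr -big_seq ler_sum// => l _.
  by rewrite !exprMn !exprVn /a le_eqVlt; apply/orP; left; apply/eqP; ring.
rewrite -[X in _ --> X](mulr0 V); apply: cvgM; first exact: cvg_cst.
rewrite [X in _ --> X](_ : 0 = \sum_(l <- L | l \in L) a l * 0); last first.
  by rewrite big1// => l _; rewrite mulr0.
by apply: cvg_big => [|l lL]; [exact: add_continuous|apply: cvgM; [exact: cvg_cst|exact: rate0]].
Qed.

Variable h : m0.-tuple S -> m1.-tuple S -> R.
Hypothesis symh : sym_kernel h.
Hypothesis L2h : L2 P (fun w => kernel_head h (X ^~ w)).
Hypothesis Eh : Ex P (fun w => kernel_head h (X ^~ w)) = 0.

Lemma measurable_scaled_Ustat (c : R) a b :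
  measurable_fun setT (fun w => c * Ustat X h a b w).
Proof. by apply: measurable_funM => //; exact: L2_measurable (L2_Ustat mX iX idX symh L2h a b). Qed.

Lemma linear_limit (f : R -> R) : (0 < m1)%N -> smooth f ->
  Ex P (fun w => f (Num.sqrt (n1 k)%:R * Ustat X h (n0 k) (n1 k) w)) @[k --> \oo] -->
  Ex (normalR 0 1) (fun x => f (m1%:R * Num.sqrt (Ex F (fun x => proj01 P X h x ^+ 2)) * x)).
Proof.
move=> m1_gt0 sf; have L2p1 := L2_proj01 mX iX FX symh L2h.
have symr := sym_linear_resid P mX symh; have L2r := L2_linear_resid mX iX FX symh L2h.
apply: (cvg_Ex_perturbation (D := fun k w => Num.sqrt (n1 k)%:R * Ustat X (linear_resid P X h) (n0 k) (n1 k) w)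
  (B := fun k w => m1%:R * normalized_sum cases (proj01 P X h) (n1 k) w) sf).
- by move=> k; apply: measurable_funM => //; exact: L2_measurable (L2_normalized_sum mcases Fcases _ L2p1).
- by move=> k; apply: L2Z; exact: L2_Ustat.
- apply: filterS (sizes_large n1_oo ratio0 m0 m1) => k [m0n0 m1n1] w.
  rewrite UstatB Ustat_sumker//.
  have sqrt_gt0 : 0 < Num.sqrt (n1 k)%:R :> R by rewrite sqrtr_gt0 ltr0n; exact: leq_trans m1n1.
  have := sqr_sqrtr (ler0n R (n1 k)); rewrite /normalized_sum; move: sqrt_gt0.
  by move: (Num.sqrt _) => s s_gt0 <-; field; rewrite gt_eqF.
- apply: (Ex_sqr_scaled_Ustat_cvg0 symr L2r (linear_resid_degenerate mX iX FX symh L2h Eh m1_gt0)).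
  move=> l; rewrite !inE => /orP[] /eqP -> /=.
    under eq_cvg do rewrite sqr_sqrtr// expr1 expr0 invr1 mulr1.
    exact: size_ratio_cvg0 ratio0.
  under eq_cvg do rewrite sqr_sqrtr// expr0 invr1 mul1r.
  exact: (size_power_ratio_cvg0 n1_oo 1).
have Ep1 := Ex_proj01 mX iX FX symh L2h Eh.
exact: (cvg_subsample n1_oo (central_limit (c := m1%:R) mcases icases Fcases L2p1 Ep1 sf)).
Qed.

Section pair_limit.
Context {d' : measure_display} {O' : measurableType d'} (P' : probability O' R)
  (lam : nat -> R) (phi : nat -> S -> R) (Z : nat -> O' -> R) (eta : O' -> R).
Hypothesis m1_gt1 : (1 < m1)%N.
Hypothesis xi01_eq0 : xi P X h 0 1 = 0%E.
Hypothesis xi10_or_rate : xi P X h 1 0 = 0%E \/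
  (n1 k ^ 2)%:R / (n0 k)%:R @[k --> \oo] --> (0 : R).
Hypothesis eigp : eigensystem F (fun z => proj02 P X h z.1 z.2) lam phi.
Hypothesis mZ : forall i, measurable_fun setT (Z i).
Hypothesis iZ : mutually_independent P' Z.
Hypothesis normalZ : forall i A, measurable A -> P' (Z i @^-1` A) = normalR 0 1 A.
Hypothesis meta : measurable_fun setT eta.
Hypothesis series_eta : {ae P', forall w,
  (\sum_(l < J) lam l * (Z l w ^+ 2 - 1)) @[J --> \oo] --> eta w}.

Let symr := sym_pair_resid P mX symh.

Let L2r := L2_pair_resid mX iX FX symh L2h.

Let Ex_sqr_pair_resid_cvg0 :
  Ex P (fun w => ((n1 k)%:R * Ustat X (pair_resid P X h) (n0 k) (n1 k) w) ^+ 2) @[k --> \oo] -->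
  (0 : R).
Proof.
have third : (n1 k)%:R ^+ 2 * ((n0 k)%:R ^- 0 * (n1 k)%:R ^- 3) @[k --> \oo] --> (0 : R).
  under eq_cvg do rewrite expr0 invr1 mul1r; exact: (size_power_ratio_cvg0 n1_oo 2).
case: xi10_or_rate => [xi10|rate].
  apply: (Ex_sqr_scaled_Ustat_cvg0 symr L2r
    (pair_resid_degenerate_xi10 mX iX FX symh L2h Eh m1_gt1 xi01_eq0 xi10)) => l.
  have cvg_ratio := size_ratio_cvg0 ratio0.
  rewrite !inE => /or3P[] /eqP -> //=.
    rewrite -[X in _ --> X](mulr0 0); under eq_cvg do rewrite expr0 invr1 mulr1 -exprVn -exprMn expr2.
    exact: cvgM.
  have cancel_size k : (n1 k)%:R ^+ 2 * ((n0 k)%:R ^- 1 * (n1 k)%:R ^- 1) = (n1 k)%:R / (n0 k)%:R :> R.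
    have [->|n1_neq0] := eqVneq ((n1 k)%:R : R) 0; first by rewrite expr0n !mul0r.
    by rewrite !expr1 expr2 mulrACA mulfV ?mulr1.
  by under eq_cvg do rewrite cancel_size.
apply: (Ex_sqr_scaled_Ustat_cvg0 symr L2r
  (pair_resid_degenerate mX iX FX symh L2h Eh m1_gt1 xi01_eq0)) => l.
rewrite !inE => /orP[] /eqP -> //=.
by under eq_cvg do rewrite expr0 invr1 mulr1 expr1 -natrX.
Qed.

Lemma pair_limit (f : R -> R) : smooth f ->
  Ex P (fun w => f ((n1 k)%:R * Ustat X h (n0 k) (n1 k) w)) @[k --> \oo] -->
  Ex P' (fun w => f (m1%:R * (m1%:R - 1) / 2 * eta w)).
Proof.
move=> sf; have L2p2 := L2_proj02 mX iX FX symh L2h.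
have p2C x y := proj02_sym P X symh x y m1_gt1.
have deg := proj02_degenerate mX iX FX symh L2h Eh xi01_eq0.
set C := m1%:R * (m1%:R - 1) / 2.
apply: (cvg_Ex_perturbation
  (D := fun k w => (n1 k)%:R * Ustat X (pair_resid P X h) (n0 k) (n1 k) w)
  (B := fun k w => C * (((n1 k)%:R - 1)^-1 * pair_sum cases (proj02 P X h) (n1 k) w)) sf).
- move=> k; apply: measurable_funM => //; apply: measurable_funM => //.
  exact: L2_measurable (L2_pair_sum mcases icases Fcases L2p2 _).
- by move=> k; apply: L2Z; exact: L2_Ustat.
- apply: filterS (sizes_large n1_oo ratio0 m0 m1) => k [m0n0 m1n1] w.
  have n1_gt1 : 1 < (n1 k)%:R :> R by rewrite ltr1n; exact: leq_trans m1n1.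
  rewrite UstatB Ustat_pairker// -/C -[\sum_(i < _) _]/(pair_sum cases (proj02 P X h) (n1 k) w).
  by field; rewrite subr_eq0 !gt_eqF// (lt_trans ltr01).
- exact: Ex_sqr_pair_resid_cvg0.
exact: (cvg_subsample n1_oo (degenerate_pair_clt (c := C) mcases icases Fcases L2p2 p2C deg eigp
  mZ iZ normalZ meta series_eta sf)).
Qed.

End pair_limit.

Lemma m1_gt1_of_xi02 : (0 < m1)%N -> xi P X h 0 1 = 0%E -> (0 < xi P X h 0 2)%E -> (1 < m1)%N.
Proof.
move=> m1_gt0 xi01 xi02; rewrite ltn_neqAle m1_gt0 andbT; apply: contraTneq xi02 => m1E.
suff -> : xi P X h 0 2 = xi P X h 0 1 by rewrite xi01 ltxx.
congr (variance P _); apply/funext => w; rewrite !hprojE; apply: eq_Ex => w'.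
by congr h; apply: eq_mktuple => i; rewrite !(leq_trans (ltn_ord i))// -m1E.
Qed.

End two_sample_ustat.

Lemma eigenvalue_seq_eigensystem {d : measure_display} {S : measurableType d} {R : realType}
    (F : probability S R) (k : S -> S -> R) (lam : nat -> R) :
  L2 (F \x F)%E (fun z => k z.1 z.2) -> eigenvalue_seq F k lam ->
  exists phi, eigensystem F (fun z => k z.1 z.2) lam phi.
Proof.
move=> L2k [phi [mphi [orth [eig compl]]]].
have L2phi j : lam j != 0 -> L2 F (phi j) by move=> /mphi[].
exists phi; split => // [i j li lj|j lj|mu g mu_neq0 [mg Lg] eig_g orth_g].
- by rewrite /Ex /Rintegral orth.
- by apply: filterS (eig j lj) => x E; rewrite /integral_op /Ex /Rintegral E.
apply: (compl mu g mu_neq0 mg Lg) => [|j lj].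
  apply: filterS2 (L2_slice1_ae L2k) eig_g => x Lx <-.
  by rewrite -L1_int//; exact: L2M.
by rewrite L1_int ?orth_g//; apply: L2M => //; apply: L2phi; rewrite lj.
Qed.

Theorem theorem1 (R : realType) (p m0 m1 : nat)
  (d : measure_display) (Omega : measurableType d) (P : probability Omega R)
  (X : bool * nat -> {RV P >-> p.-tuple R})
  (h : m0.-tuple (p.-tuple R) -> m1.-tuple (p.-tuple R) -> R)
  (n0 n1 : nat -> nat) :
  (0 < m0)%N -> (0 < m1)%N ->
  (* all observations are independent *)
  mutually_independent P (fun i w => X i w) ->
  (* null hypothesis: controls and cases all have the same distribution *)
  (forall i A, measurable A -> P (X i @^-1` A) = P (X (false, 0%N) @^-1` A)) ->
  (* the kernel: measurable, symmetric in each block of arguments *)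
  measurable_fun setT
    (fun z : m0.-tuple (p.-tuple R) * m1.-tuple (p.-tuple R) => h z.1 z.2) ->
  (forall (x x' : m0.-tuple (p.-tuple R)) (y : m1.-tuple (p.-tuple R)),
      perm_eq x x' -> h x y = h x' y) ->
  (forall (x : m0.-tuple (p.-tuple R)) (y y' : m1.-tuple (p.-tuple R)),
      perm_eq y y' -> h x y = h x y') ->
  (* mean zero and finite second moment *)
  ('E_P[fun w => h [tuple X (false, nat_of_ord i) w | i < m0]
                  [tuple X (true, nat_of_ord j) w | j < m1]] = 0)%E ->
  P.-integrable setT (fun w => ((h [tuple X (false, nat_of_ord i) w | i < m0]
                  [tuple X (true, nat_of_ord j) w | j < m1]) ^+ 2)%:E) ->
  (* asymptotic regime: n1 -> oo, n1 / n -> 0 with n = n0 + n1 *)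
  (((n1 k)%:R : R) @[k --> \oo] --> +oo) ->
  ((n1 k)%:R / (n0 k + n1 k)%:R @[k --> \oo] --> (0 : R)) ->
  let T k w := Ustat (fun i w => X i w) h (n0 k) (n1 k) w in
  let xi_ a b := xi P (fun i w => X i w) h a b in
  (* (1) *)
  ((0 < xi_ 0%N 1%N)%E ->
     cvg_in_dist P (fun k w => Num.sqrt (n1 k)%:R * T k w)
       (normal_prob 0 (m1%:R * Num.sqrt (fine (xi_ 0%N 1%N)))) (fun r => r)) /\
  (* (2) *)
  (xi_ 0%N 1%N = 0%E -> (0 < xi_ 0%N 2%N)%E ->
     (xi_ 1%N 0%N = 0%E \/ (((n1 k) ^ 2)%:R / (n0 k)%:R @[k --> \oo] --> (0 : R))) ->
     forall lam : nat -> R,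
       eigenvalue_seq (distribution P (X (true, 0%N)))
         (fun x y => hproj P (fun i w => X i w) h 0 2
                       (fun _ => x) (fun j => if j == 0%N then x else y)) lam ->
     forall (d' : measure_display) (Omega' : measurableType d')
            (P' : probability Omega' R) (Z : nat -> {RV P' >-> R}),
       mutually_independent P' (fun j w => Z j w) ->
       (forall j A, measurable A -> P' (Z j @^-1` A) = normal_prob 0 1 A) ->
       forall eta : {RV P' >-> R},
       {ae P', forall w, (\sum_(j < N) lam j * ((Z j w) ^+ 2 - 1)) @[N --> \oo]
                           --> eta w} ->
       cvg_in_dist P (fun k w => (n1 k)%:R * T k w)
         P' (fun w => m1%:R * (m1%:R - 1) / 2 * eta w)).
Proof.
move=> _ m1_gt0 iX null mh symh0 symh1 Eh L2h n1_oo ratio0 T xi_.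
pose X' i w := X i w; pose F := distribution P (X (true, 0%N)).
have mX i : measurable_fun setT (X' i) by exact: measurable_funP.
have FX e A : measurable A -> P (X' e @^-1` A) = F A.
  by move=> mA; rewrite /X' null// -(null (true, 0%N)).
have symh : sym_kernel h by [].
have {}L2h : L2 P (fun w => kernel_head h (X' ^~ w)) by split => //; exact: measurable_kernel.
have {}Eh : Ex P (fun w => kernel_head h (X' ^~ w)) = 0.
  by move: Eh; rewrite unlock => Eh; rewrite /Ex /Rintegral Eh.
have mT c a b := measurable_scaled_Ustat mX iX FX symh L2h c a b.
split=> [xi01|xi01 xi02 xi10_or_rate lam eig d' O' P' Z iZ normalZ eta series_eta].
  apply: cvg_in_dist_smooth => [k||f sf]; [exact: mT|exact: measurable_id|].
  have [M _ /klipschitz_continuous/continuous_measurable mf] := smooth_bounded_lipschitz sf.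
  move: xi01; rewrite /xi_ (xi01E mX iX FX symh L2h Eh) lte_fin => xi01.
  rewrite Ex_normal_scale ?mulr_gt0 ?ltr0n ?sqrtr_gt0//.
  exact: (linear_limit mX iX FX n1_oo ratio0 symh L2h Eh m1_gt0 sf).
have m1_gt1 := m1_gt1_of_xi02 m1_gt0 xi01 xi02.
have [phi eigp] := eigenvalue_seq_eigensystem (L2_proj02 mX iX FX symh L2h) eig.
apply: cvg_in_dist_smooth => [k||f sf]; [exact: mT|exact: measurable_funM|].
exact: (pair_limit mX iX FX n1_oo ratio0 symh L2h Eh m1_gt1 xi01 xi10_or_rate eigp
  (fun j => measurable_funP (Z j)) iZ normalZ (measurable_funP eta) series_eta sf).
Qed.
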